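(* Let $s\in[1,\infty)$, let $\Omega\subseteq\mathbb{H}^n$ be open and let $f\in W^{2,s}_{\mathcal H}(\Omega)$. Let $A\subseteq\Omega$ be open and such that $\mathrm{dist}(A,\partial\Omega)>0$. Then, for every $w\in\mathbb{H}^n$, $$\lim_{\varepsilon\searrow0}\frac{f(p\cdot\delta_\varepsilon(w))-f(p)-\varepsilon\langle\nabla^{\mathcal H}f(p),w_{\mathcal H}\rangle}{\varepsilon^2}=\frac12\big\langle\nabla^{2,\mathcal H}f(p)w_{\mathcal H},w_{\mathcal H}\big\rangle+w_N\,Tf(p)$$ where the limit is in $L^s(A)$ (as functions of $p$). In addition, if $\varepsilon>0$ and $w\in\mathbb{H}^n$ satisfy $\varepsilon\big(|w_{\mathcal H}|+2\sqrt{|w_N|}\big)<\mathrm{dist}(A,\partial\Omega)$, one has $$\left\|\frac{f(p\cdot\delta_\varepsilon(w))-f(p)-\varepsilon\langle\nabla^{\mathcal H}f(p),w_{\mathcal H}\rangle}{\varepsilon^2}\right\|_{L^s(A)}\le|w_N|\,\|Tf\|_{L^s(\Omega)}+|w_{\mathcal H}|^2\,\big\|\nabla^{2,\mathcal H}f\big\|_{L^s(\Omega)}.$$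
   Context: $n\ge1$, $N=2n+1$; $\mathbb{H}^n$ is $\mathbb{R}^N=\mathbb{R}^n\times\mathbb{R}^n\times\mathbb{R}$ with group law $(x,y,t)\cdot(x',y',t')=\big(x+x',\,y+y',\,t+t'+2\sum_{j=1}^n(x_j'y_j-x_jy_j')\big)$, dilations $\delta_\lambda(x,y,t)=(\lambda x,\lambda y,\lambda^2t)$, and Lebesgue measure. Left-invariant frame: $Z_j=X_j=\partial_{x_j}+2y_j\partial_t$, $Z_{n+j}=Y_j=\partial_{y_j}-2x_j\partial_t$ ($j=1,\dots,n$), $Z_N=T=\partial_t$. For $w=(w_1,\dots,w_N)$, $w_{\mathcal H}=(w_1,\dots,w_{2n})$ and $|w_{\mathcal H}|$ is its Euclidean norm. $\nabla^{\mathcal H}f=(Z_1f,\dots,Z_{2n}f)$ and $\nabla^{2,\mathcal H}f$ is the $2n\times2n$ matrix with entries $(\nabla^{2,\mathcal H}f)_{ij}=Z_iZ_jf$; $\langle\cdot,\cdot\rangle$ is the standard scalar product of components, and $L^s$ norms of vector- or matrix-valued functions are $L^s$ norms of the pointwise Euclidean (Frobenius) norm. $W^{2,s}_{\mathcal H}(\Omega)$ is the space of $u\in L^s(\Omega)$ whose distributional derivatives $Z_ju$ and $Z_iZ_ju$, $i,j=1,\dots,2n$, belong to $L^s(\Omega)$; for such $u$ one has $Tu=\frac14(Y_jX_j-X_jY_j)u\in L^s(\Omega)$. $\mathrm{dist}$ is computed with the Carnot–Carathéodory distance $d$ ($d(p,q)$ is the infimum of lengths $\int_0^1\sqrt{\langle\dot\gamma,\dot\gamma\rangle}\,d\tau$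 of absolutely continuous curves $\gamma:[0,1]\to\mathbb{H}^n$ from $p$ to $q$ with a.e. velocity in $\operatorname{span}(Z_1,\dots,Z_{2n})$, where $\langle\cdot,\cdot\rangle$ is the Riemannian metric making $Z_1,\dots,Z_N$ orthonormal); $\mathrm{dist}(A,\emptyset)=\infty$. For $\varepsilon$ as in the smallness condition, $p\cdot\delta_\varepsilon(w)\in\Omega$ for all $p\in A$. *)

(* Defs.v *)
From HB Require Import structures.
From mathcomp Require Import all_boot all_order all_algebra.
From mathcomp Require Import all_classical all_reals all_analysis.

Set Implicit Arguments.
Unset Strict Implicit.
Unset Printing Implicit Defensive.

Import Order.TTheory GRing.Theory Num.Theory.
Import numFieldNormedType.Exports.

Local Open Scope classical_set_scope.
Local Open Scope ring_scope.

Definition measure_rV_display : measure_display -> measure_display.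
Proof. exact. Qed.

(* The sigma-algebra on row vectors generated by the coordinates; for
   entries in R this is the Borel sigma-algebra of 'rV[R]_k. *)
Section measurable_rV.
Context {d} {T : sigmaRingType d}.
Variable k : nat.

Let coords : 'I_k -> 'rV[T]_k -> T := fun i v => v 0 i.

Let rV_set0 : g_sigma_preimage coords set0.
Proof. exact: sigma_algebra0. Qed.

Let rV_setC A : g_sigma_preimage coords A -> g_sigma_preimage coords (~` A).
Proof. exact: sigma_algebraC. Qed.

Let rV_bigcup (F : _^nat) : (forall i, g_sigma_preimage coords (F i)) ->
  g_sigma_preimage coords (\bigcup_i (F i)).
Proof. exact: sigma_algebra_bigcup. Qed.

HB.instance Definition _ := @isMeasurable.Build (measure_rV_display d)
  'rV[T]_k (g_sigma_preimage coords) rV_set0 rV_setC rV_bigcup.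

End measurable_rV.

Section lebesgue_rV.
Context {R : realType}.

Definition consrV k (z : (R * 'rV[R]_k)%type) : 'rV[R]_(k.+1) :=
  row_mx (z.1%:M : 'M[R]_1) z.2.

Lemma consrV_head k z (j : 'I_1) : @consrV k z 0 (lshift k j) = z.1.
Proof. by apply: etrans (row_mxEl _ _ _ _) _; rewrite mxE ord1 eqxx. Qed.

Lemma consrV_tail k z (j : 'I_k) : @consrV k z 0 (rshift 1 j) = z.2 0 j.
Proof. exact: row_mxEr. Qed.

(* The product of Lebesgue measure on R with m, carried to 'rV[R]_(k.+1). *)
Definition lebesgue_rVS k (m : {sigma_finite_measure set 'rV[R]_k -> \bar R})
    (A : set 'rV[R]_(k.+1)) : \bar R :=
  (lebesgue_measure \x m)%E (@consrV k @^-1` A).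

Lemma measurable_coord k (i : 'I_k) :
  measurable_fun [set: 'rV[R]_k] (fun v : 'rV[R]_k => v 0 i).
Proof.
move=> _ Y mY; rewrite setTI; apply: sub_sigma_algebra => /=.
rewrite -bigcup_seq/=; exists i => /=; first by rewrite mem_index_enum.
by exists Y => //; rewrite setTI.
Qed.

Lemma measurable_fun_rVP d (T : measurableType d) k (f : T -> 'rV[R]_k) :
  (forall i, measurable_fun [set: T] (fun x => f x 0 i)) ->
  measurable_fun [set: T] f.
Proof.
move=> mf _ Y; rewrite setTI; rewrite /measurable/= => gY.
suff /(_ _ gY) : g_sigma_preimage (fun i (v : 'rV[R]_k) => v 0 i) `<=`
    (fun A => measurable (f @^-1` A)) by [].
apply: smallest_sub.
  split => /= [|A mA|F mF].
  - by rewrite preimage_set0; exact: measurable0.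
  - by rewrite setTD preimage_setC; exact: measurableC.
  - by rewrite preimage_bigcup; exact: bigcup_measurable.
move=> A; rewrite -bigcup_seq /= => -[i _ [B mB <-]] /=.
by rewrite setTI -comp_preimage -[X in measurable X]setTI; exact: mf.
Qed.

Lemma measurable_consrV k :
  measurable_fun [set: (R * 'rV[R]_k)%type] (@consrV k).
Proof.
apply: measurable_fun_rVP => i.
case: (splitP (i : 'I_(1 + k))) => j ij.
- rewrite (_ : (fun x => _) = fst) //; apply/funext => x.
  by rewrite (_ : i = lshift k j); [rewrite consrV_head|exact: val_inj].
- rewrite (_ : (fun x => _) = (fun v : 'rV[R]_k => v 0 j) \o snd).
    by apply: measurableT_comp => //; exact: measurable_coord.
  apply/funext => x /=.
  by rewrite (_ : i = rshift 1 j); [rewrite consrV_tail|exact: val_inj].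
Qed.

Section step.
Variables (k : nat) (m : {sigma_finite_measure set 'rV[R]_k -> \bar R}).

Let pre_measurable (A : set 'rV[R]_(k.+1)) :
  measurable A -> measurable (@consrV k @^-1` A).
Proof. by move=> mA; rewrite -[X in measurable X]setTI; exact: measurable_consrV. Qed.

Let lebS0 : lebesgue_rVS m set0 = 0%E.
Proof. by rewrite /lebesgue_rVS preimage_set0 measure0. Qed.

Let lebS_ge0 A : (0 <= lebesgue_rVS m A)%E.
Proof. exact: measure_ge0. Qed.

Let lebS_sigma_additive : semi_sigma_additive (lebesgue_rVS m).
Proof.
move=> F mF tF mUF; rewrite /lebesgue_rVS preimage_bigcup.
apply: measure_semi_sigma_additive.
- by move=> n; exact: pre_measurable.
- apply/trivIsetP => /= i j _ _ ij; rewrite -preimage_setI.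
  by move/trivIsetP : tF => /(_ _ _ _ _ ij) ->//; rewrite preimage_set0.
- by rewrite -preimage_bigcup; exact: pre_measurable.
Qed.

HB.instance Definition _ := isMeasure.Build _ _ _ (lebesgue_rVS m)
  lebS0 lebS_ge0 lebS_sigma_additive.

Let unconsrV (v : 'rV[R]_(k.+1)) : R * 'rV[R]_k :=
  ((v : 'rV[R]_(1 + k)) 0 (lshift k ord0), rsubmx (v : 'rV[R]_(1 + k))).

Let consrVK : cancel (@consrV k) unconsrV.
Proof.
move=> [a v]; rewrite /unconsrV; congr pair; first exact: consrV_head.
exact: row_mxKr.
Qed.

Let measurable_unconsrV : measurable_fun [set: 'rV[R]_(k.+1)] unconsrV.
Proof.
apply/measurable_fun_pairP; split; first exact: measurable_coord.
apply: measurable_fun_rVP => i /=.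
rewrite (_ : (fun x => _) = fun v : 'rV[R]_(k.+1) => v 0 (rshift 1 i)).
  exact: measurable_coord.
by apply/funext => v; rewrite mxE.
Qed.

Let unconsrVK : cancel unconsrV (@consrV k).
Proof.
move=> v; apply: etrans (@hsubmxK _ 1 1 k v); congr row_mx; apply/rowP => i.
by rewrite !mxE !ord1 eqxx mulr1n.
Qed.

Let lebS_sigma_finite : sigma_finite setT (lebesgue_rVS m).
Proof.
have /sigma_finiteP[F [TF ndF Foo]] := sigma_finiteT (@lebesgue_measure R).
have /sigma_finiteP[G [TG ndG Goo]] := sigma_finiteT m.
exists (fun i => unconsrV @^-1` (F i `*` G i)).
  rewrite -preimage_bigcup (_ : \bigcup_i _ = setT) ?preimage_setT//.
  rewrite -setXTT TF TG predeqE => -[x y]; split.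
    by move=> [i _ []/= ? ?]; split; exists i.
  move=> [/= [i _ Fix] [j _ Gjy]]; exists (maxn i j) => //; split.
  - by move: x Fix; exact/subsetPset/ndF/leq_maxl.
  - by move: y Gjy; exact/subsetPset/ndG/leq_maxr.
move=> i; have [mFi Fioo] := Foo i; have [mGi Gioo] := Goo i; split.
  rewrite -[X in measurable X]setTI; apply: measurable_unconsrV => //.
  exact: measurableX.
rewrite /lebesgue_rVS -comp_preimage (_ : _ \o _ = id); last first.
  by apply/funext => z /=; rewrite consrVK.
by rewrite preimage_id product_measure1E// lte_mul_pinfty// ge0_fin_numE.
Qed.

HB.instance Definition _ := Measure_isSigmaFinite.Build _ _ _ (lebesgue_rVS m)
  lebS_sigma_finite.

End step.

Fixpoint lebesgue_rV k : {sigma_finite_measure set 'rV[R]_k -> \bar R} :=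
  match k with
  | 0 => @dirac _ 'rV[R]_0 0 R
  | k'.+1 => lebesgue_rVS (lebesgue_rV k')
  end.

Lemma lebesgue_rV_box k (a b : 'I_k -> R) : (forall i, a i <= b i) ->
  lebesgue_rV k [set v : 'rV[R]_k | forall i, v 0 i \in `[a i, b i]] =
  (\prod_i (b i - a i))%:E.
Proof.
elim: k a b => [|k IH] a b ab.
  by rewrite big_ord0 /= /dirac indicE mem_set//= => -[]. 
rewrite big_ord_recl EFinM.
rewrite -(IH (fun i => a (lift ord0 i)) (fun i => b (lift ord0 i)))//.
rewrite [LHS]/= /lebesgue_rVS.
rewrite (_ : _ @^-1` _ = `[a ord0, b ord0] `*` [set v : 'rV[R]_k |
    forall i, v 0 i \in `[a (lift ord0 i), b (lift ord0 i)]]).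
  rewrite product_measure1E//.
  - congr (_ * _)%E; apply: etrans (lebesgue_measure_itv _) _; rewrite /= lte_fin.
    have := ab ord0; rewrite le_eqVlt => /predU1P[->|->//].
    by rewrite ltxx subrr.
  - rewrite (_ : [set v | _] = \big[setI/setT]_(i < k)
        ((fun v : 'rV[R]_k => v 0 i) @^-1` `[a (lift ord0 i), b (lift ord0 i)])).
      apply: big_ind => //; first exact: measurableI.
      by move=> i _; rewrite -[X in measurable X]setTI; exact: (measurable_coord).
    apply/seteqP; split => v /=.
      move=> H; rewrite -bigcap_seq/= => i _ /=; exact: H.
    by rewrite -bigcap_seq => H i; apply: H; rewrite /= mem_index_enum.
apply/seteqP; split => [[x v] /= H|[x v] /= [H1 H2] i].
  split.
    have := H ord0; rewrite (_ : ord0 = lshift k ord0 :> 'I_(1+k)) ?consrV_head//; exact: val_inj.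
  move=> i; have := H (lift ord0 i); rewrite {1}(_ : lift ord0 i = rshift 1 i :> 'I_(1+k)) ?consrV_tail//; exact: val_inj.
case: (unliftP ord0 i) => [j ->|->].
  rewrite {1}(_ : lift ord0 j = rshift 1 j :> 'I_(1+k)) ?consrV_tail//; exact: val_inj.
rewrite {1}(_ : ord0 = lshift k ord0 :> 'I_(1+k)) ?consrV_head//; exact: val_inj.
Qed.

End lebesgue_rV.

(* H^n is the space of row vectors (x, y, t) of size n + n + 1. *)
Notation heis R n := 'rV[R]_(n + n + 1).

Section heisenberg.
Context {R : realType} {n : nat}.
Implicit Types (p q v w : heis R n) (Omega A B : set (heis R n)).

Definition hx p : 'rV[R]_n := lsubmx (lsubmx p).
Definition hy p : 'rV[R]_n := rsubmx (lsubmx p).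
Definition ht p : R := p 0 (rshift (n + n) ord0).
Definition hpoint (x y : 'rV[R]_n) (t : R) : heis R n :=
  row_mx (row_mx x y) (t%:M : 'M[R]_1).
Definition hpart w : 'rV[R]_(n + n) := lsubmx w.

Definition dot k (u v : 'rV[R]_k) : R := \sum_(i < k) u 0 i * v 0 i.
(* The library norm on matrices is the sup norm, hence this definition. *)
Definition frobenius k l (M : 'M[R]_(k, l)) : R :=
  Num.sqrt (\sum_(i < k) \sum_(j < l) M i j ^+ 2).

Definition hmul p q : heis R n :=
  hpoint (hx p + hx q) (hy p + hy q)
    (ht p + ht q + 2 * \sum_(j < n) (hx q 0 j * hy p 0 j - hx p 0 j * hy q 0 j)).

Definition hdil (r : R) p : heis R n :=
  hpoint (r *: hx p) (r *: hy p) (r ^+ 2 * ht p).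

Definition Xfield (j : 'I_n) p : heis R n :=
  hpoint (delta_mx 0 j) 0 (2 * hy p 0 j).
Definition Yfield (j : 'I_n) p : heis R n :=
  hpoint 0 (delta_mx 0 j) (- (2 * hx p 0 j)).
Definition Tfield p : heis R n := hpoint 0 0 1.

Definition Zfield (k : 'I_(n + n + 1)) p : heis R n :=
  match fintype.split k with
  | inl i => match fintype.split i with
             | inl j => Xfield j p
             | inr j => Yfield j p
             end
  | inr _ => Tfield p
  end.

Definition hidx (i : 'I_(n + n)) : 'I_(n + n + 1) := lshift 1 i.
Definition tidx : 'I_(n + n + 1) := rshift (n + n) ord0.

Definition Zderive (k : 'I_(n + n + 1)) (phi : heis R n -> R) p : R :=
  'D_(Zfield k p) phi p.

Definition leb : {sigma_finite_measure set (heis R n) -> \bar R} :=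
  lebesgue_rV (n + n + 1).

Definition partial (i : 'I_(n + n + 1)) (g : heis R n -> R) p : R :=
  'D_(delta_mx 0 i) g p.

Definition smooth (phi : heis R n -> R) : Prop :=
  forall (l : seq 'I_(n + n + 1)) p, differentiable (foldr partial phi l) p.

Definition tsupport (phi : heis R n -> R) : set (heis R n) :=
  closure [set p | phi p != 0].

Definition test_function Omega (phi : heis R n -> R) : Prop :=
  [/\ smooth phi, compact (tsupport phi) & tsupport phi `<=` Omega].

Definition loc_integrable Omega (u : heis R n -> R) : Prop :=
  measurable_fun Omega u /\
  forall K, compact K -> K `<=` Omega -> leb.-integrable K (EFin \o u).

(* Integration by parts along Z_k: the coefficients of Z_k are divergence
   free, so its formal adjoint is - Z_k. *)
Definition is_weak_derivative Omega (k : 'I_(n + n + 1))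
    (u g : heis R n -> R) : Prop :=
  [/\ loc_integrable Omega u, loc_integrable Omega g &
    forall phi, test_function Omega phi ->
      \int[leb]_(p in Omega) (u p * Zderive k phi p) =
      - \int[leb]_(p in Omega) (g p * phi p)].

Definition weakly_derivable Omega k (u : heis R n -> R) : Prop :=
  exists g, is_weak_derivative Omega k u g.

(* A representative of the distributional derivative Z_k u, which is unique
   up to a.e. equality on Omega; 0 if there is none in L^1_loc(Omega). *)
Definition weakZ Omega k (u : heis R n -> R) : heis R n -> R :=
  xget (fun=> 0) [set g | is_weak_derivative Omega k u g].

Definition Lsnorm (s : R) A (u : heis R n -> R) : \bar R :=
  'N[leb]_(s%:E)[(EFin \o u) \_ A].

Definition in_Ls (s : R) A (u : heis R n -> R) : Prop :=
  measurable_fun A u /\ (Lsnorm s A u < +oo)%E.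

Definition cvg_Ls (s : R) A (F : R -> heis R n -> R) (l : set_system R)
    (u : heis R n -> R) : Prop :=
  [/\ in_Ls s A u, \forall e \near l, in_Ls s A (F e) &
    Lsnorm s A (F e \- u) @[e --> l] --> 0%E].

Definition hsobolev2 (s : R) Omega (u : heis R n -> R) : Prop :=
  [/\ in_Ls s Omega u,
    forall j, weakly_derivable Omega (hidx j) u /\
      in_Ls s Omega (weakZ Omega (hidx j) u) &
    forall i j, weakly_derivable Omega (hidx i) (weakZ Omega (hidx j) u) /\
      in_Ls s Omega (weakZ Omega (hidx i) (weakZ Omega (hidx j) u))].

Definition hgrad Omega (f : heis R n -> R) p : 'rV[R]_(n + n) :=
  \row_j weakZ Omega (hidx j) f p.
Definition hhess Omega (f : heis R n -> R) p : 'M[R]_(n + n) :=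
  \matrix_(i, j) weakZ Omega (hidx i) (weakZ Omega (hidx j) f) p.
Definition Tderive Omega (f : heis R n -> R) : heis R n -> R :=
  weakZ Omega tidx f.

(* v *m invmx (frame p) is the row of components of v in Z_1(p), ..., Z_N(p). *)
Definition frame p : 'M[R]_(n + n + 1) := \matrix_k Zfield k p.
Definition riem p v w : R := dot (v *m invmx (frame p)) (w *m invmx (frame p)).
Definition horizontal p v : Prop :=
  (v <= \matrix_(i < n + n) Zfield (hidx i) p)%MS.

Definition abs_continuous01 (gamma : R -> heis R n) : Prop :=
  forall e : R, 0 < e -> exists2 d : R, 0 < d &
    forall (m : nat) (a b : 'I_m -> R),
      (forall i, [/\ 0 <= a i, a i <= b i & b i <= 1]) ->
      trivIset [set: 'I_m] (fun i => [set` `]a i, b i[]) ->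
      \sum_(i < m) (b i - a i) < d ->
      \sum_(i < m) `|gamma (b i) - gamma (a i)| < e.

Definition horizontal_curve (gamma : R -> heis R n) : Prop :=
  abs_continuous01 gamma /\
  {ae (@lebesgue_measure R), forall t, t \in `[0, 1] ->
    derivable gamma t 1 /\ horizontal (gamma t) (derive1 gamma t)}.

Definition curve_length (gamma : R -> heis R n) : \bar R :=
  (\int[lebesgue_measure]_(t in `[0%R, 1%R])
    (Num.sqrt (riem (gamma t) (derive1 gamma t) (derive1 gamma t)))%:E)%E.

Definition ccdist p q : \bar R :=
  ereal_inf [set curve_length gamma | gamma in
    [set gamma | [/\ horizontal_curve gamma, gamma 0 = p & gamma 1 = q]]].

Definition set_ccdist A B : \bar R :=
  ereal_inf [set ccdist pq.1 pq.2 | pq in A `*` B].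

Definition boundary A : set (heis R n) := closure A `\` interior A.

End heisenberg.

(* Main.v *)
Require Import Defs.
From HB Require Import structures.
From mathcomp Require Import all_boot all_order all_algebra.
From mathcomp Require Import all_classical all_reals all_analysis.
From mathcomp Require Import measurable_realfun ring lra.

Set Implicit Arguments.
Unset Strict Implicit.
Unset Printing Implicit Defensive.

Import Order.TTheory GRing.Theory Num.Theory.
Import numFieldNormedType.Exports.

Local Open Scope classical_set_scope.
Local Open Scope ring_scope.

(* Write [V] for the left-invariant field with components [w_H], and [Phi^V],
   [Phi^T] for the flows of [V] and of [w_N T]. Then [p . delta_e(w)] is
   [Phi^T] at time [e^2] after [Phi^V] at time [e], and all these flows preserve
   Lebesgue measure. If [g] is the weak derivative of [u] along a field with flow
   [Phi], then [u (Phi_e p) - u p] is the integral of [g (Phi_t p)] over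
   [0 <= t <= e] for almost every [p]: test against bumps, transfer the flow to
   the bump by invariance, integrate by parts and apply Fubini. Minkowski's
   inequality turns this into the bounds [e^2 |V^2 f|] for the horizontal
   increment (applying it to [f] and to [V f]) and [e^2 |w_N| |T f|] for the
   vertical one; continuity of translations in [L^s] gives the limit. The points
   met along the way stay in [Omega] because they are joined to [p] by horizontal
   curves shorter than the distance from [A] to the boundary, a vertical segment
   of height [t] being the endpoint of a horizontal square of side
   [sqrt t / 2]. *)

(** * Boxes, Lebesgue measure and smooth bumps *)

(** A weak derivative is known only almost everywhere, so the formula along a flow is asserted for
    one fixed time, off a null set that depends on this time; everything after it is an estimate of
    norms. The hypothesis on [f] provides horizontal derivatives only. That [T f] exists and lies in
    [L^s] comes from [4 T = Y X - X Y], moved to the test functions, where it rests on the symmetry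
    of second derivatives of smooth functions. The vertical step starts from the image of [A] under
    the horizontal flow, a set that changes with [e]. For this reason the limits along flows have
    thresholds that are uniform in the set, and a third error appears, the difference of [w_N T f]
    at the moved point and at [p], which continuity of translations makes small. The lengths
    [e |w_H|] of the horizontal leg and [2 sqrt (e^2 |w_N|)] of the square add up to the left side
    of the smallness condition. The constant 1 before [|w_H|^2] arises because the first-order
    increment at time [t <= e] is bounded by its bound at time [e]; integrating in [t] would give
    1/2. *)

Section boxes.
Context {R : realType} {k : nat}.
Implicit Types (a b u v : 'rV[R]_k) (U : set 'rV[R]_k).

Definition obox a b := [set v : 'rV[R]_k | forall i, a 0 i < v 0 i < b 0 i].
Definition cbox a b := [set v : 'rV[R]_k | forall i, a 0 i <= v 0 i <= b 0 i].

Lemma obox_cbox a b : obox a b `<=` cbox a b.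
Proof. by move=> v abv i; have /andP[/ltW -> /ltW ->] := abv i. Qed.

Lemma measurable_coord_preimage (i : 'I_k) (Y : set R) :
  measurable Y -> measurable [set v : 'rV[R]_k | Y (v 0 i)].
Proof.
by move=> mY; rewrite -[X in measurable X]setTI; exact: measurable_coord.
Qed.

Lemma measurable_forall_coord (Y : 'I_k -> set R) :
  (forall i, measurable (Y i)) ->
  measurable [set v : 'rV[R]_k | forall i, Y i (v 0 i)].
Proof.
move=> mY; rewrite (_ : [set v | _] =
    \big[setI/setT]_(i < k) [set v : 'rV[R]_k | Y i (v 0 i)]).
  by apply: bigsetI_measurable => i _; exact: measurable_coord_preimage.
rewrite -bigcap_seq; apply/seteqP; split => v /= vY i.
  by move=> _; exact: vY.
by apply: vY; rewrite /= mem_index_enum.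
Qed.

Lemma measurable_obox a b : measurable (obox a b).
Proof.
rewrite (_ : obox a b = [set v | forall i, `]a 0 i, b 0 i[%classic (v 0 i)]).
  apply: (@measurable_forall_coord (fun i => `]a 0 i, b 0 i[%classic)) => i.
  exact: measurable_itv.
by apply/seteqP; split => v /= vab i; have := vab i; rewrite in_itv.
Qed.

Lemma cboxE a b :
  cbox a b = [set v | forall i, `[a 0 i, b 0 i]%classic (v 0 i)].
Proof. by apply/seteqP; split => v /= vab i; have := vab i; rewrite in_itv. Qed.

Lemma measurable_cbox a b : measurable (cbox a b).
Proof.
rewrite cboxE; apply: (@measurable_forall_coord (fun i => `[a 0 i, b 0 i]%classic)) => i.
exact: measurable_itv.
Qed.

Lemma compact_cbox a b : compact (cbox a b).
Proof.
rewrite cboxE; apply: (@rV_compact _ _ (fun i => `[a 0 i, b 0 i]%classic)) => i.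
exact: segment_compact.
Qed.

Lemma open_coord_preimage (i : 'I_k) (Y : set R) :
  open Y -> open [set v : 'rV[R]_k | Y (v 0 i)].
Proof.
by move=> oY; apply: (open_comp _ oY) => v _; exact: coord_continuous.
Qed.

Lemma obox_setI a b a' b' : obox a b `&` obox a' b' =
  obox (\row_i Num.max (a 0 i) (a' 0 i)) (\row_i Num.min (b 0 i) (b' 0 i)).
Proof.
apply/seteqP; split => v /=.
  move=> [ab ab'] i; rewrite !mxE gt_max lt_min.
  by have /andP[-> ->] := ab i; have /andP[-> ->] := ab' i.
move=> ab; split => i; have := ab i; rewrite !mxE gt_max lt_min.
  by case/andP=> /andP[-> _] /andP[->].
by case/andP=> /andP[_ ->] /andP[_ ->].
Qed.

Definition ratrV (q : {ffun 'I_k -> rat}) : 'rV[R]_k := \row_i ratr (q i).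

(** Rational corners make the family countable. The closed box is required to lie in [U] because it
    is compact, so that a function locally integrable on [U] is integrable on each box of the
    cover. *)
Lemma open_bigcup_obox U : open U ->
  U = \bigcup_(q in [set q : {ffun 'I_k -> rat} * {ffun 'I_k -> rat} |
         cbox (ratrV q.1) (ratrV q.2) `<=` U]) obox (ratrV q.1) (ratrV q.2).
Proof.
move=> oU; apply/seteqP; split => v; last first.
  by move=> [q qU] vq; apply: qU; exact: obox_cbox.
move=> Uv; have /nbhs_ballP[e /= e0 eU] := open_nbhs_nbhs (conj oU Uv).
have /choice[lo hlo] : forall i, exists r : rat, v 0 i - e < ratr r < v 0 i.
  move=> i; have : v 0 i - e < v 0 i by rewrite ltrBlDr ltrDl.
  by move=> /rat_in_itvoo[r]; rewrite in_itv /= => ?; exists r.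
have /choice[hi hhi] : forall i, exists r : rat, v 0 i < ratr r < v 0 i + e.
  move=> i; have : v 0 i < v 0 i + e by rewrite ltrDl.
  by move=> /rat_in_itvoo[r]; rewrite in_itv /= => ?; exists r.
exists (finfun lo, finfun hi) => /=.
  move=> w wq; apply: eU; split => // i j; rewrite (ord1 i) /ball/=.
  have /andP[] := wq j; rewrite !mxE !ffunE.
  have /andP[l1 l2] := hlo j; have /andP[h1 h2] := hhi j => w1 w2.
  by rewrite ltr_distlC (lt_le_trans l1 w1) (le_lt_trans w2 h2).
move=> i; rewrite !mxE !ffunE.
by have /andP[_ ->] := hlo i; have /andP[-> _] := hhi i.
Qed.

(** Preimages of open sets under a coordinate are open, hence countable unions of rational boxes.
    Unlike the coordinate preimages that define the sigma-algebra, open boxes are closed under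
    intersection, as Dynkin's lemma demands. *)
Lemma measurable_rVE :
  @measurable _ 'rV[R]_k = <<s [set obox x.1 x.2 | x in setT] >>.
Proof.
apply/seteqP; split.
- have opn U : open U -> (<<s [set obox x.1 x.2 | x in setT] >>) U.
    move=> oU; rewrite (open_bigcup_obox oU) bigcup_mkcond.
    pose G : set (set 'rV[R]_k) := [set obox x.1 x.2 | x in setT].
    apply: (@countable_bigcupT_measurable _ (g_sigma_algebraType G)).
      exact: countableP.
    move=> q; case: ifPn => _; last exact: sigma_algebra0.
    by apply: sub_sigma_algebra; exists (ratrV q.1, ratrV q.2).
  apply: smallest_sub; first exact: smallest_sigma_algebra.
  move=> A; rewrite -bigcup_seq /= => -[i _ [Y mY <-]]; rewrite setTI.
  have {}mY : (<<s @RGenOpens.G R >>) Y by rewrite -[X in X Y]RGenOpens.measurableE.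
  pose P : set (set R) := fun Y : set R =>
    (<<s [set obox x.1 x.2 | x in setT] >>) ((fun v : 'rV[R]_k => v 0 i) @^-1` Y).
  suff : <<s @RGenOpens.G R >> `<=` P by exact.
  apply: smallest_sub => /=.
    split => /= [|B PB|F PF].
    + by rewrite /P preimage_set0; exact: sigma_algebra0.
    + by rewrite /P setTD preimage_setC -setTD; exact: sigma_algebraCD.
    + by rewrite /P preimage_bigcup; exact: sigma_algebra_bigcup.
  move=> _ [x [y ->]]; apply: opn; apply: open_coord_preimage.
  exact: interval_open.
- apply: smallest_sub; first exact: sigma_algebra_measurable.
  by move=> _ [x _ <-]; exact: measurable_obox.
Qed.

Lemma rV_dynkin (P : set 'rV[R]_k -> Prop) :
  P setT -> (forall a b, P (obox a b)) ->
  (forall E, measurable E -> P E -> P (~` E)) ->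
  (forall F : (set 'rV[R]_k)^nat, (forall i, measurable (F i)) ->
    trivIset setT F -> (forall i, P (F i)) -> P (\bigcup_i F i)) ->
  forall E : set 'rV[R]_k, measurable E -> P E.
Proof.
move=> PT PB PC PU E mE.
apply: (dynkin_induction measurable_rVE _ PT _ PC PU).
- by move=> _ _ [x _ <-] [y _ <-]; rewrite obox_setI; eexists (_, _).
- by move=> _ [x _ <-].
- by rewrite -measurable_rVE.
Qed.

Lemma open_measurable_rV U : open U -> measurable U.
Proof.
move=> oU; rewrite (open_bigcup_obox oU) bigcup_mkcond.
apply: countable_bigcupT_measurable; first exact: countableP.
by move=> q; case: ifPn => _; [exact: measurable_obox|exact: measurable0].
Qed.

End boxes.

(** * Invariance of Lebesgue measure under triangular maps *)

Section translation.
Context {R : realType}.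

Lemma lebesgue_measure_translate (a : R) (Y : set R) : measurable Y ->
  lebesgue_measure ((fun x => x + a) @^-1` Y) = lebesgue_measure Y.
Proof.
move=> mY; apply/esym.
have mf : measurable_fun [set: R] (fun x : R => x + a) by exact: measurable_funD.
apply: (@lebesgue_measure_unique _ (pushforward lebesgue_measure (fun x : measurableTypeR R => x + a : measurableTypeR R))) => //.
move=> _ [[b c] _ <-] /=.
rewrite /pushforward /= (_ : _ @^-1` _ = `]b - a, c - a]%classic); last first.
  by apply/seteqP; split => x /=; rewrite !in_itv/= ltrBlDr lerBrDr.
rewrite !lebesgue_measure_itv/= !lte_fin ltrD2r; case: ifP => // _.
by rewrite -EFinB; congr EFin; lra.
Qed.

Lemma ge0_integral_translate (a : R) (h : R -> \bar R) :
  measurable_fun [set: R] h -> (forall x, 0 <= h x)%E ->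
  (\int[lebesgue_measure]_x h (x + a)%R = \int[lebesgue_measure]_x h x)%E.
Proof.
move=> mh h0; pose tr (x : measurableTypeR R) : measurableTypeR R := x + a.
have mtr : measurable_fun [set: measurableTypeR R] tr by exact: measurable_funD.
transitivity (\int[pushforward lebesgue_measure tr]_x h x)%E; last first.
  apply: eq_measure_integral => A mA _ /=.
  exact: lebesgue_measure_translate.
by rewrite ge0_integral_pushforward.
Qed.

Lemma lebesgue_rVS_xsection k (A : set 'rV[R]_k.+1) :
  lebesgue_rV k.+1 A =
  (\int[lebesgue_measure]_x lebesgue_rV k [set v | A (consrV (x, v))])%E.
Proof.
rewrite /= /lebesgue_rVS /product_measure1; apply: eq_integral => x _ /=.
by congr (lebesgue_rV k _); apply/seteqP; split => v; rewrite /xsection/= inE.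
Qed.

Lemma consrV_ord0 k (z : R * 'rV[R]_k) : consrV z 0 ord0 = z.1.
Proof. by rewrite -(consrV_head z ord0); congr (consrV z 0 _); exact: val_inj. Qed.

Lemma consrV_lift k (z : R * 'rV[R]_k) (j : 'I_k) :
  consrV z 0 (lift ord0 j) = z.2 0 j.
Proof. by rewrite -(consrV_tail z j); congr (consrV z 0 _); exact: val_inj. Qed.

(* Triangular maps with unit diagonal: Fubini reduces their invariance to that
   of one-dimensional translations, one coordinate at a time. *)
Lemma lebesgue_rV_triangular k (F : 'rV[R]_k -> 'rV[R]_k)
    (G : 'I_k -> 'rV[R]_k -> R) (A : set 'rV[R]_k) :
  measurable_fun setT F ->
  (forall i v, F v 0 i = v 0 i + G i v) ->
  (forall (i : 'I_k) (u v : 'rV[R]_k), (forall j : 'I_k, (j < i)%N -> u 0 j = v 0 j) ->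
    G i u = G i v) ->
  measurable A -> lebesgue_rV k (F @^-1` A) = lebesgue_rV k A.
Proof.
elim: k F G A => [|k IH] F G A mF FE GE mA.
  congr (lebesgue_rV 0 _); apply/seteqP; split => v /=;
  by rewrite (_ : F v = v) //; apply/rowP => -[].
pose c := G ord0 0.
have Gc v : G ord0 v = c by apply: GE => j; rewrite ltn0.
pose tl (v : 'rV[R]_k.+1) : 'rV[R]_k := \row_i v 0 (lift ord0 i).
have Fcons x v : F (consrV (x, v)) = consrV (x + c, tl (F (consrV (x, v)))).
  apply/rowP => i; case: (unliftP ord0 i) => [j ->|->].
    by rewrite consrV_lift mxE.
  by rewrite FE Gc !consrV_ord0.
rewrite !lebesgue_rVS_xsection.
have mA' : measurable (@consrV R k @^-1` A).
  by rewrite -[X in measurable X]setTI; exact: measurable_consrV.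
transitivity (\int[lebesgue_measure]_x
    lebesgue_rV k [set v | A (consrV (x + c, v)%R)])%E; last first.
  apply: (@ge0_integral_translate c (fun x => lebesgue_rV k [set v | A (consrV (x, v))])) => //.
  rewrite (_ : (fun _ => _) = lebesgue_rV k \o xsection (@consrV R k @^-1` A)).
    exact: measurable_fun_xsection.
  apply/funext => x /=.
  by congr (lebesgue_rV k _); apply/seteqP; split => v; rewrite /xsection/= inE.
apply: eq_integral => x _.
have mcons : measurable_fun [set: 'rV[R]_k] (fun v => consrV (x, v)).
  by apply: (measurableT_comp (@measurable_consrV R k)); exact: pair1_measurable.
apply: (etrans _ (IH (fun v => tl (F (consrV (x, v))))
  (fun i v => G (lift ord0 i) (consrV (x, v))) [set v | A (consrV (x + c, v))] _ _ _ _)).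
- by congr (lebesgue_rV k _); apply/seteqP; split => v /=; rewrite -Fcons.
- apply: measurable_fun_rVP => i; under eq_fun do rewrite mxE.
  apply: (measurableT_comp (measurable_coord (lift ord0 i))).
  exact: measurableT_comp.
- by move=> i v; rewrite mxE FE consrV_lift.
- move=> i u v uv; apply: GE => j; case: (unliftP ord0 j) => [j' ->|->] ji.
    by rewrite !consrV_lift; exact: uv.
  by rewrite !consrV_ord0.
- rewrite -[X in measurable X]setTI.
  have mcons' : measurable_fun [set: 'rV[R]_k] (fun v => consrV (x + c, v)).
    by apply: (measurableT_comp (@measurable_consrV R k)); exact: pair1_measurable.
  exact: mcons'.
Qed.

End translation.

Section flat.
Context {R : realType}.

(** [flat 0] is the classical smooth function [exp (-1/x)] extended by 0. The negative powers are
    included because the derivative of [flat k] is a combination of [flat k.+2] and [flat k.+1], so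
    that the family is stable under differentiation. *)
Definition flat (k : nat) (x : R) : R :=
  if 0 < x then x ^- k * expR (- x^-1) else 0.

Lemma flat_le0 k x : x <= 0 -> flat k x = 0.
Proof. by rewrite /flat; case: ltP. Qed.

Lemma flat_gt0E k x : 0 < x -> flat k x = x ^- k * expR (- x^-1).
Proof. by rewrite /flat => ->. Qed.

Lemma flat_ge0 k x : 0 <= flat k x.
Proof.
rewrite /flat; case: ifP => // x0.
by rewrite mulr_ge0 ?expR_ge0 // invr_ge0 exprn_ge0 // ltW.
Qed.

Lemma flat0_le1 x : flat 0 x <= 1.
Proof.
rewrite /flat; case: ifP => // x0.
by rewrite expr0 invr1 mul1r -expR0 ler_expR oppr_le0 invr_ge0 ltW.
Qed.

(* [expR y] dominates every power of [y := x^-1]. *)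
Lemma flat_bound k x : `|flat k x| <= (k.+1)`!%:R * `|x|.
Proof.
have [x0|x0] := leP x 0; first by rewrite flat_le0 // normr0 mulr_ge0.
rewrite ger0_norm ?flat_ge0 // flat_gt0E // gtr0_norm // expRN.
have y0 : 0 < x^-1 by rewrite invr_gt0.
have yk : x^-1 ^+ k.+1 / (k.+1)`!%:R <= expR x^-1.
  by apply: le_trans (expR_ge1Dxn k (ltW y0)); rewrite lerDr.
rewrite ler_pdivrMr ?expR_gt0 //.
have f0 : 0 < (k.+1)`!%:R :> R by rewrite ltr0n fact_gt0.
rewrite (_ : x ^- k = (k.+1)`!%:R * x * (x^-1 ^+ k.+1 / (k.+1)`!%:R)).
  by rewrite ler_wpM2l // mulr_ge0 // ltW.
by rewrite exprS exprVn; field; rewrite !gt_eqF ?exprn_gt0.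
Qed.

Lemma flat_is_derive k (x : R) :
  is_derive x 1 (flat k) (flat k.+2 x - k%:R * flat k.+1 x).
Proof.
have [x0|x0|->] := ltgtP x 0.
- rewrite !flat_le0 ?ltW // mulr0 subr0.
  apply: (near_eq_is_derive (f := cst 0)).
  by near=> y; rewrite flat_le0 // ltW //; near: y; exact: lt_nbhsl.
- rewrite !flat_gt0E //.
  have x0' : x != 0 by rewrite gt_eqF.
  have dV : is_derive x 1 (fun y : R => y^-1) (- x ^- 2 *: 1).
    exact: (@realfun.is_deriveV R id x 1 1).
  have dE : is_derive x 1 (expR \o (- (fun y : R => y^-1)))
      (expR (- x^-1) * - (- x ^- 2 *: 1)).
    apply: is_derive1_comp; exact: is_deriveN.
  apply: (near_eq_is_derive
    (f := (fun y : R => y^-1) ^+ k * (expR \o (- (fun y : R => y^-1))))).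
    near=> y; rewrite flat_gt0E; last by near: y; exact: lt_nbhsr.
    by rewrite /GRing.mul/= exprfctE exprVn.
  apply: (is_derive_eq (is_deriveM (is_deriveX k dV) dE)).
  rewrite exprfctE /= /GRing.scale/= exprVn.
  case: k => [|k] /=; first by rewrite mulr0n !mul0r /=; field.
  rewrite !exprVn -(natr1 k) (_ : (- [eta GRing.inv]) x = - x^-1) // !exprS expr0.
  by have := expf_neq0 k x0'; move: (x ^+ k) => z z0; field; rewrite z0 x0'.
- rewrite !flat_le0 // mulr0 subr0.
  (* At 0 the difference quotient of [flat k] is [flat k.+1] itself, which tends to 0 by
     [flat_bound]. *)
  have H : h^-1 *: ((flat k \o shift (0:R)) (h *: (1:R)) - flat k 0) @[h --> 0^'] --> (0 : R).
    apply: (@cvg_trans _ (flat k.+1 h @[h --> 0^'])).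
      apply: near_eq_cvg; near=> h => /=.
      have h0 : h != 0 by near: h; exact: nbhs_dnbhs_neq.
      rewrite addr0 /GRing.scale/= mulr1 (flat_le0 k (lexx 0)) subr0.
      have [hn|hp] := leP h 0; first by rewrite !flat_le0 // mulr0.
      by rewrite !flat_gt0E // exprS invfM mulrA.
    apply/cvgr0Pnorm_le => e e0; near=> h.
    apply: le_trans (flat_bound _ _) _.
    rewrite -ler_pdivlMl ?ltr0n ?fact_gt0 //.
    near: h; apply: dnbhs0_le; rewrite mulr_gt0 // invr_gt0 ltr0n fact_gt0 //.
  apply: DeriveDef; first by apply/cvg_ex; exists 0.
  exact: (cvg_lim _ H).
Unshelve. all: by end_near. Qed.

End flat.

(** * Expressions that stay smooth under differentiation *)

Section smooth_class.
Context {R : realType} {n : nat}.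
Notation H := (heis R n).
Implicit Types (u v : H -> R) (p w : H).

(* Closed under partial derivatives, so its members are smooth as soon as the
   functions in [B] are. *)
Inductive smooth_expr (B : (H -> R) -> Prop) : (H -> R) -> Prop :=
| SmBase u : B u -> smooth_expr B u
| SmCst c : smooth_expr B (fun=> c)
| SmCoord i : smooth_expr B (fun p => p 0 i)
| SmAdd u v : smooth_expr B u -> smooth_expr B v ->
    smooth_expr B (fun p => u p + v p)
| SmMul u v : smooth_expr B u -> smooth_expr B v ->
    smooth_expr B (fun p => u p * v p)
| SmFlat k u : smooth_expr B u -> smooth_expr B (fun p => flat k (u p)).

Lemma differentiable_flat k (x : R) : differentiable (flat k) x.
Proof. by apply/derivable1_diffP; have [] := flat_is_derive k x. Qed.

Lemma derive_flat_comp k u p w : differentiable u p ->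
  'D_w (fun q => flat k (u q)) p =
  (flat k.+2 (u p) - k%:R * flat k.+1 (u p)) * 'D_w u p.
Proof.
move=> du; have df := differentiable_flat k (u p).
rewrite deriveE; last exact: (differentiable_comp du df).
rewrite (_ : (fun q => _) = flat k \o u) // diff_comp //=.
rewrite deriv1E; last by have [] := flat_is_derive k (u p).
rewrite derive1E; have [_ ->] := flat_is_derive k (u p).
by rewrite /GRing.scale/= mulrC deriveE.
Qed.

Lemma is_derive_coord (i : 'I_(n + n + 1)) p w :
  is_derive p w (fun q : H => q 0 i) (w 0 i).
Proof.
have H : h^-1 *: (((fun q : H => q 0 i) \o shift p) (h *: w) - p 0 i)
    @[h --> 0^'] --> w 0 i.
  apply: (@cvg_trans _ ((fun=> w 0 i) h @[h --> 0^'])); last exact: cvg_cst.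
  apply: near_eq_cvg; near=> h => /=.
  have h0 : h != 0 by near: h; exact: nbhs_dnbhs_neq.
  by rewrite !mxE addrK /GRing.scale/= mulKf.
by apply: DeriveDef; [apply/cvg_ex; exists (w 0 i)|exact: (cvg_lim _ H)].
Unshelve. all: by end_near. Qed.

Lemma smooth_expr_differentiable B u p :
  (forall v, B v -> differentiable v p) ->
  smooth_expr B u -> differentiable u p.
Proof.
move=> BD; elim => {u} [u /BD //|c|i|u v _ du _ dv|u v _ du _ dv|k u _ du].
- exact: differentiable_cst.
- exact: differentiable_coord.
- exact: differentiableD.
- exact: differentiableM.
- exact: differentiable_comp du (differentiable_flat k _).
Qed.

Lemma smooth_expr_opp B u : smooth_expr B u -> smooth_expr B (fun p => - u p).
Proof.
move=> su; rewrite (_ : (fun p => - u p) = (fun p => (-1) * u p)).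
  by apply: SmMul => //; exact: SmCst.
by apply/funext => p; rewrite mulN1r.
Qed.

Lemma smooth_expr_sum B I (s : seq I) (F : I -> H -> R) :
  (forall i, smooth_expr B (F i)) ->
  smooth_expr B (fun p => \sum_(i <- s) F i p).
Proof.
move=> sF; elim: s => [|a s IH].
  by under eq_fun do rewrite big_nil; exact: SmCst.
by under eq_fun do rewrite big_cons; exact: SmAdd.
Qed.

Lemma smooth_expr_prod B I (s : seq I) (F : I -> H -> R) :
  (forall i, smooth_expr B (F i)) ->
  smooth_expr B (fun p => \prod_(i <- s) F i p).
Proof.
move=> sF; elim: s => [|a s IH].
  by under eq_fun do rewrite big_nil; exact: SmCst.
by under eq_fun do rewrite big_cons; exact: SmMul.
Qed.

Lemma smooth_expr_partial B i u :
  (forall v, B v -> (forall p, differentiable v p) /\ B (partial i v)) ->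
  smooth_expr B u -> smooth_expr B (partial i u).
Proof.
move=> BB; have D v p : smooth_expr B v -> differentiable v p.
  by apply: smooth_expr_differentiable => {}v /BB[+ _]; exact.
elim => {u} [u Bu|c|j|u v su Du sv Dv|u v su Du sv Dv|k u su Du].
- by apply: SmBase; have [] := BB _ Bu.
- rewrite (_ : partial i _ = (fun=> 0)); first exact: SmCst.
  by apply/funext => p; exact: derive_cst.
- rewrite (_ : partial i _ = (fun=> (delta_mx 0 i : H) 0 j)); first exact: SmCst.
  by apply/funext => p; have [_ <-] := is_derive_coord j p (delta_mx 0 i).
- rewrite (_ : partial i _ = (fun p => partial i u p + partial i v p)).
    exact: SmAdd.
  by apply/funext => p; apply: deriveD; exact/diff_derivable/D.
- rewrite (_ : partial i _ = (fun p => u p * partial i v p + v p * partial i u p)).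
    by apply: SmAdd; exact: SmMul.
  by apply/funext => p; apply: deriveM; exact/diff_derivable/D.
- rewrite (_ : partial i _ = (fun p =>
    (flat k.+2 (u p) + - (k%:R * flat k.+1 (u p))) * partial i u p)).
    apply: SmMul => //; apply: SmAdd; first exact: SmFlat.
    by apply: smooth_expr_opp; apply: SmMul; [exact: SmCst|exact: SmFlat].
  by apply/funext => p; apply: derive_flat_comp; exact: D.
Qed.

Lemma smooth_partial i u : smooth u -> smooth (partial i u).
Proof. by move=> su l p; have := su (rcons l i) p; rewrite foldr_rcons. Qed.

Lemma smooth_differentiable u p : smooth u -> differentiable u p.
Proof. by move=> /(_ [::]). Qed.

(** The base is enlarged to all smooth functions. That base is stable under [partial], so
    [smooth_expr_partial] can be iterated along any list of indices. *)
Lemma smooth_exprW B u : (forall v, B v -> smooth v) ->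
  smooth_expr B u -> smooth u.
Proof.
move=> BS su.
have {}su : smooth_expr smooth u.
  elim: su => {u} *; [|exact: SmCst|exact: SmCoord|exact: SmAdd|exact: SmMul|exact: SmFlat].
  by apply: SmBase; exact: BS.
suff su' l : smooth_expr smooth (foldr partial u l).
  move=> l p; apply: smooth_expr_differentiable (su' l) => v /smooth_differentiable; exact.
elim: l => //= i l IH; apply: smooth_expr_partial => // v sv; split.
  by move=> p; exact: smooth_differentiable.
exact: smooth_partial.
Qed.

Lemma smooth_expr_comp B u (F : H -> H) : 
  (forall i, smooth_expr B (fun p => F p 0 i)) ->
  (forall v, B v -> smooth_expr B (v \o F)) ->
  smooth_expr B u -> smooth_expr B (u \o F).
Proof.
move=> sF BF; elim => {u} [u /BF //|c|i|u v _ du _ dv|u v _ du _ dv|k u _ du].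
- exact: SmCst.
- exact: sF.
- exact: SmAdd.
- exact: SmMul.
- exact: SmFlat.
Qed.

End smooth_class.

Section bump.
Context {R : realType} {k : nat}.
Notation mu := (lebesgue_rV k : {measure set 'rV[R]_k -> \bar R}).
Implicit Types (a b v : 'rV[R]_k) (m : nat).

Lemma continuous_measurable_rV (f : 'rV[R]_k -> R) (D : set 'rV[R]_k) :
  measurable D -> continuous f -> measurable_fun D f.
Proof.
move=> mD cf; apply: measurable_funTS.
apply: (measurability _ (RGenOpens.measurableE R)) => _ [_ [x [y ->]] <-].
rewrite setTI; apply: open_measurable_rV; apply: open_comp => // z _; exact: cf.
Qed.

(** [m] is the steepness. The support stays in the closed box for every [m], and since
    [exp (-1/((m+1) y))] tends to 1 for [y > 0], the bumps tend pointwise to the indicator of the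
    open box. *)
Definition bump m a b v : R :=
  \prod_i (flat 0 (m.+1%:R * (v 0 i - a 0 i)) * flat 0 (m.+1%:R * (b 0 i - v 0 i))).

Lemma bump_ge0 m a b v : 0 <= bump m a b v.
Proof. by apply: prodr_ge0 => i _; rewrite mulr_ge0 // flat_ge0. Qed.

Lemma bump_le1 m a b v : bump m a b v <= 1.
Proof.
by apply: prodr_ile1 => i _; rewrite mulr_ge0 ?flat_ge0//= mulr_ile1 ?flat_ge0 ?flat0_le1.
Qed.

Lemma bump_obox m a b v : bump m a b v != 0 -> obox a b v.
Proof.
move=> /prodf_neq0 H i; have := H i isT; rewrite mulf_eq0 negb_or => /andP[Ha Hb].
apply/andP; split.
  rewrite -subr_gt0 ltNge; apply: contra Ha => ai.
  by rewrite flat_le0 // mulr_ge0_le0.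
rewrite -subr_gt0 ltNge; apply: contra Hb => ai.
by rewrite flat_le0 // mulr_ge0_le0.
Qed.

Lemma flat0_cvg (y : R) : flat 0 (m.+1%:R * y) @[m --> \oo] --> ((0 < y)%R%:R : R).
Proof.
have [y0|y0] := leP y 0.
  apply: (@cvg_trans _ ((fun=> 0 : R) m @[m --> \oo])); last exact: cvg_cst.
  by apply: near_eq_cvg; near=> m; rewrite flat_le0 // mulr_ge0_le0.
apply: (@cvg_trans _ (expR (- y^-1 * m.+1%:R^-1) @[m --> \oo])).
  apply: near_eq_cvg; near=> m.
  by rewrite flat_gt0E ?mulr_gt0// expr0 invr1 mul1r invfM mulNr [in RHS]mulrC.
have -> : true%:R = expR (- y^-1 * 0) :> R by rewrite mulr0 expR0.
apply: (cvg_comp (fun m : nat => - y^-1 * m.+1%:R^-1) expR); last exact: continuous_expR.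
apply: cvgM; first exact: cvg_cst.
exact: (@cvg_harmonic R).
Unshelve. all: by end_near. Qed.

Lemma bump_cvg a b v : bump m a b v @[m --> \oo] --> (\1_(obox a b) v : R).
Proof.
have -> : \1_(obox a b) v =
    \prod_i ((0 < v 0 i - a 0 i)%R%:R * (0 < b 0 i - v 0 i)%R%:R) :> R.
  rewrite indicE; have [|vab] := boolP (v \in obox a b).
    rewrite inE => vab; rewrite big1 // => i _.
    by have /andP[] := vab i; rewrite !subr_gt0 => -> ->; rewrite mulr1.
  have [i /negP abi] : exists i, ~ (a 0 i < v 0 i < b 0 i).
    by move: vab; rewrite notin_setE => /existsNP.
  rewrite (bigD1 i) //=.
  by move: abi; rewrite !subr_gt0 negb_and => /orP[]/negbTE ->; rewrite ?mulr0 !mul0r.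
rewrite /bump; apply: cvg_big => [|i _]; last by apply: cvgM; exact: flat0_cvg.
exact: mul_continuous.
Qed.

Lemma continuous_bump m a b : continuous (bump m a b).
Proof.
move=> v; apply: (@cvg_big R _ _ _ _ (@mul_continuous R) _ (nbhs v)) => i _.
have cflat (y : R) : {for y, continuous (flat 0)}.
  by apply/differentiable_continuous/derivable1_diffP; have [] := flat_is_derive 0 y.
have ci : {for v, continuous (fun x : 'rV[R]_k => x 0 i)} by exact: coord_continuous.
have c1 (y d : R) : {for y, continuous (fun z : R => m.+1%:R * (z - d))}.
  by apply: cvgM; [exact: cvg_cst|apply: cvgB; [exact: cvg_id|exact: cvg_cst]].
have c2 (y d : R) : {for y, continuous (fun z : R => m.+1%:R * (d - z))}.
  by apply: cvgM; [exact: cvg_cst|apply: cvgB; [exact: cvg_cst|exact: cvg_id]].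
by apply: cvgM;
  [exact: (cvg_comp _ _ (cvg_comp _ _ ci (c1 _ _)) (cflat _))|
   exact: (cvg_comp _ _ (cvg_comp _ _ ci (c2 _ _)) (cflat _))].
Qed.

Lemma measurable_bump D m a b : measurable D -> measurable_fun D (bump m a b).
Proof. by move=> mD; apply: continuous_measurable_rV => //; exact: continuous_bump. Qed.

(* Bumps approximate the indicators of boxes, which form a pi-system. *)
Lemma bump_ae0 a b (g : 'rV[R]_k -> R) : mu.-integrable (obox a b) (EFin \o g) ->
  (forall m a' b', cbox a' b' `<=` cbox a b -> obox a' b' `<=` obox a b ->
    (\int[mu]_(v in obox a b) (g v * bump m a' b' v)%:E = 0)%E) ->
  {ae mu, forall v, obox a b v -> g v = 0}.
Proof.
move=> ig g0; have mB := measurable_obox a b.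
have mg : measurable_fun (obox a b) g by apply/measurable_EFinP; exact: measurable_int ig.
(* Bumps take values in [0, 1], so [|g|] dominates and the limit in [m] replaces bumps by indicators
   of boxes. *)
have box0 a' b' : cbox a' b' `<=` cbox a b -> obox a' b' `<=` obox a b ->
    (\int[mu]_(v in obox a b `&` obox a' b') (g v)%:E = 0)%E.
  move=> ab' oab'.
  have [] := @dominated_convergence _ _ _ mu _ mB
    (fun m v => (g v * bump m a' b' v)%:E) (fun v => (g v * \1_(obox a' b') v)%:E)
    (fun v => `|g v|%:E).
  - move=> m; apply/measurable_EFinP; apply: measurable_funM => //.
    exact: measurable_bump.
  - apply/measurable_EFinP; apply: measurable_funM => //.
    by apply: measurable_indic; exact: measurable_obox.
  - apply: aeW => v _; apply: cvg_EFin; first by near=> m.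
    by apply: cvgM; [exact: cvg_cst|exact: bump_cvg].
  - exact: integrable_norm.
  - apply: aeW => v m _; rewrite abse_EFin lee_fin normrM ler_piMr //.
    by rewrite ger0_norm ?bump_ge0 ?bump_le1.
  move=> _ _ lim0.
  rewrite setIC integral_mkcondl.
  transitivity (\int[mu]_(v in obox a b) (g v * \1_(obox a' b') v)%:E)%E.
    apply: eq_integral => v _; rewrite patchE indicE.
    by case: ifPn => _; rewrite ?mulr1 ?mulr0.
  move: lim0; rewrite (_ : [sequence _]_ _ = (fun=> 0%E)); last first.
    by apply/funext => m /=; rewrite g0.
  by move/(cvg_unique (@ereal_hausdorff R)); apply; exact: cvg_cst.
have all0 E : measurable E -> (\int[mu]_(v in obox a b `&` E) (g v)%:E = 0)%E.
  move: E; apply: rV_dynkin => /=.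
  - by rewrite setIT -[obox a b]setIid; apply: box0.
  - move=> x y; rewrite -[obox a b]setIid -setIA obox_setI; apply: box0.
      move=> v vx i; have := vx i; rewrite !mxE ge_max le_min.
      by case/andP=> /andP[-> _] /andP[-> _].
    by rewrite -obox_setI => v [].
  - move=> E mE E0; have mBE := measurableI _ _ mB mE.
    have mBEC := measurableI _ _ mB (measurableC mE).
    have : (\int[mu]_(v in obox a b) (g v)%:E = 0)%E.
      by rewrite -[obox a b]setIid; apply: box0.
    rewrite -{1}[obox a b]setIT -(setUv E) setIUr integral_setU //=.
    + by rewrite E0 add0e.
    + by rewrite -setIUr setUv setIT; exact: measurable_int ig.
    + by apply/disj_setPS => v [[_ Ev] [_ nEv]]; exact: nEv.
  - move=> F mF tF F0; rewrite setI_bigcupr integral_bigcup.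
    + by under eq_eseriesr do rewrite F0; rewrite eseries0.
    + exact: trivIset_setIl.
    + by move=> i; exact: measurableI.
    + apply: (integrableS _ _ _ ig) => //; last by move=> x [i _ []].
      by apply: bigcupT_measurable => i; exact: measurableI.
have := integral_ae_eq mB (g := cst 0%E) ig (measurable_cst _).
case.
  by move=> E EB mE; rewrite integral0 -(setIidr EB) all0.
move=> N [mN N0 sN]; exists N; split => // v /= Hv; apply: sN => /= h.
by apply: Hv => /h [].
Unshelve. all: by end_near. Qed.

End bump.

(** * Left-invariant flows *)

Section heisenberg_algebra.
Context {R : realType} {n : nat}.
Notation H := (heis R n).
Implicit Types (p q c w : H) (r s t : R).

Lemma hxE p j : hx p 0 j = p 0 (lshift 1 (lshift n j)).
Proof. by rewrite !mxE. Qed.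

Lemma hyE p j : hy p 0 j = p 0 (lshift 1 (rshift n j)).
Proof. by rewrite !mxE. Qed.

Lemma hx_hpoint (x y : 'rV[R]_n) t : hx (hpoint x y t) = x.
Proof. by rewrite /hx /hpoint row_mxKl row_mxKl. Qed.

Lemma hy_hpoint (x y : 'rV[R]_n) t : hy (hpoint x y t) = y.
Proof. by rewrite /hy /hpoint row_mxKl row_mxKr. Qed.

Lemma ht_hpoint (x y : 'rV[R]_n) t : ht (hpoint x y t) = t.
Proof. by rewrite /ht /hpoint row_mxEr mxE eqxx mulr1n. Qed.

Lemma hpointK p : hpoint (hx p) (hy p) (ht p) = p.
Proof.
rewrite /hpoint /hx /hy hsubmxK -[RHS](@hsubmxK _ 1 (n + n) 1 p); congr row_mx.
by apply/matrixP => i j; rewrite /ht !mxE !ord1 eqxx mulr1n.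
Qed.

Lemma heis_ext p q : hx p = hx q -> hy p = hy q -> ht p = ht q -> p = q.
Proof. by move=> ex ey et; rewrite -(hpointK p) -(hpointK q) ex ey et. Qed.

Lemma hxD p q : hx (p + q) = hx p + hx q.
Proof. by apply/rowP => j; rewrite !mxE. Qed.
Lemma hyD p q : hy (p + q) = hy p + hy q.
Proof. by apply/rowP => j; rewrite !mxE. Qed.
Lemma htD p q : ht (p + q) = ht p + ht q.
Proof. by rewrite /ht !mxE. Qed.
Lemma hxZ r p : hx (r *: p) = r *: hx p.
Proof. by apply/rowP => j; rewrite !mxE. Qed.
Lemma hyZ r p : hy (r *: p) = r *: hy p.
Proof. by apply/rowP => j; rewrite !mxE. Qed.
Lemma htZ r p : ht (r *: p) = r * ht p.
Proof. by rewrite /ht !mxE. Qed.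

(** The standard symplectic form of the horizontal parts; twice it is the twist in the group law. *)
Definition symp p c : R := \sum_(j < n) (hx c 0 j * hy p 0 j - hx p 0 j * hy c 0 j).

Lemma sympDl p q c : symp (p + q) c = symp p c + symp q c.
Proof.
rewrite /symp -big_split /=; apply: eq_bigr => j _.
by rewrite hxD hyD !mxE; ring.
Qed.

Lemma sympZl r p c : symp (r *: p) c = r * symp p c.
Proof.
rewrite /symp mulr_sumr; apply: eq_bigr => j _.
by rewrite hxZ hyZ !mxE; ring.
Qed.

Lemma sympZr r p c : symp p (r *: c) = r * symp p c.
Proof.
rewrite /symp mulr_sumr; apply: eq_bigr => j _.
by rewrite hxZ hyZ !mxE; ring.
Qed.

Lemma symp_scale r (x y : 'rV[R]_n) p :
  \sum_(j < n) ((r *: x) 0 j * hy p 0 j - hx p 0 j * (r *: y) 0 j) =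
  r * symp p (hpoint x y 0).
Proof.
rewrite /symp mulr_sumr hx_hpoint hy_hpoint; apply: eq_bigr => j _.
have -> : (r *: x) 0 j = r * x 0 j by rewrite mxE.
have -> : (r *: y) 0 j = r * y 0 j by rewrite mxE.
ring.
Qed.

Lemma symp_eq p q c c' : hx p = hx q -> hy p = hy q -> hx c = hx c' ->
  hy c = hy c' -> symp p c = symp q c'.
Proof. by rewrite /symp => -> -> -> ->. Qed.

Lemma sympxx c : symp c c = 0.
Proof. by rewrite /symp big1 // => j _; rewrite subrr. Qed.

(* The value at [p] of the left-invariant field with components [c]; its
   integral curves are straight lines. *)
Definition hfield c p : H := hpoint (hx c) (hy c) (ht c + 2 * symp p c).

Definition hflow c r p : H := p + r *: hfield c p.

(** Moving along the field changes [symp p c] by a multiple of [symp c c = 0]. The field is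
    therefore constant on its own lines, which makes [hflow c] a one-parameter group. *)
Lemma hfield_hflow c r p : hfield c (hflow c r p) = hfield c p.
Proof.
rewrite /hfield /hflow sympDl sympZl.
rewrite (@symp_eq (hfield c p) c c c) ?sympxx ?mulr0 ?addr0 //.
  by rewrite hx_hpoint.
by rewrite hy_hpoint.
Qed.

Lemma hflowD c r s p : hflow c r (hflow c s p) = hflow c (s + r) p.
Proof. by rewrite {1}/hflow hfield_hflow /hflow -addrA -scalerDl. Qed.

Lemma hflow0 c p : hflow c 0 p = p.
Proof. by rewrite /hflow scale0r addr0. Qed.

Lemma hflowK c r : cancel (hflow c r) (hflow c (- r)).
Proof. by move=> p; rewrite hflowD subrr hflow0. Qed.

Lemma hflowNK c r : cancel (hflow c (- r)) (hflow c r).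
Proof. by move=> p; rewrite hflowD addNr hflow0. Qed.

Definition hhor w : H := hpoint (hx w) (hy w) 0.
Definition hver w : H := hpoint 0 0 (ht w).

(** [symp] vanishes against [hver w], so the vertical flow merely adds [e ^+ 2 * ht w] to the
    height, and the twist of the group law is produced by the horizontal flow alone. *)
Lemma hmul_hdil p (e : R) w :
  hmul p (hdil e w) = hflow (hver w) (e ^+ 2) (hflow (hhor w) e p).
Proof.
apply: heis_ext; rewrite /hmul /hdil /hflow /hfield;
  rewrite ?(hx_hpoint, hy_hpoint, ht_hpoint, hxD, hyD, htD, hxZ, hyZ, htZ) //.
- by rewrite scaler0 addr0.
- by rewrite scaler0 addr0.
have symp0 q : symp q (hver w) = 0.
  by rewrite /symp big1 // => j _; rewrite hx_hpoint hy_hpoint !mxE; ring.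
rewrite symp0 symp_scale; ring.
Qed.

Lemma hfieldE c p : hfield c p = \sum_k c 0 k *: Zfield k p.
Proof.
rewrite big_split_ord /= big_split_ord /= big_ord1.
have -> : Zfield (rshift (n + n) ord0) p = Tfield p.
  by rewrite /Zfield (unsplitK (inr _)).
under eq_bigr => j _.
  rewrite /Zfield (unsplitK (inl _)) (unsplitK (inl _)) -hxE. over.
under [X in _ + X + _]eq_bigr => j _.
  rewrite /Zfield (unsplitK (inl _)) (unsplitK (inr _)) -hyE. over.
rewrite -/(ht c).
have hxs (s : seq 'I_n) (F : 'I_n -> H) : hx (\sum_(j <- s) F j) = \sum_(j <- s) hx (F j).
  elim: s => [|a s IH]; last by rewrite !big_cons hxD IH.
  by rewrite !big_nil; apply/rowP => j; rewrite !mxE.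
have hys (s : seq 'I_n) (F : 'I_n -> H) : hy (\sum_(j <- s) F j) = \sum_(j <- s) hy (F j).
  elim: s => [|a s IH]; last by rewrite !big_cons hyD IH.
  by rewrite !big_nil; apply/rowP => j; rewrite !mxE.
have hts (s : seq 'I_n) (F : 'I_n -> H) : ht (\sum_(j <- s) F j) = \sum_(j <- s) ht (F j).
  elim: s => [|a s IH]; last by rewrite !big_cons htD IH.
  by rewrite !big_nil /ht !mxE.
have row_delta (x : 'rV[R]_n) : \sum_j x 0 j *: delta_mx 0 j = x.
  by rewrite [RHS]row_sum_delta.
apply: heis_ext; rewrite ?(hxD, hyD, htD, hxs, hys, hts).
- rewrite hxZ /Tfield hx_hpoint scaler0 addr0.
  rewrite [X in _ + X]big1 => [|j _]; last by rewrite hxZ hx_hpoint scaler0.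
  rewrite addr0 hx_hpoint -[LHS]row_delta; apply: eq_bigr => j _.
  by rewrite hxZ hx_hpoint.
- rewrite hyZ /Tfield hy_hpoint scaler0 addr0.
  rewrite big1 => [|j _]; last by rewrite hyZ hy_hpoint scaler0.
  rewrite add0r hy_hpoint -[LHS]row_delta; apply: eq_bigr => j _.
  by rewrite hyZ hy_hpoint.
- rewrite htZ /Tfield !ht_hpoint mulr1 addrC; congr (_ + _).
  rewrite -big_split /= mulr_sumr; apply: eq_bigr => j _.
  by rewrite !htZ !ht_hpoint; ring.
Qed.

End heisenberg_algebra.

Section flow_regularity.
Context {R : realType} {n : nat}.
Notation H := (heis R n).
Implicit Types (p q c w : H) (r s t : R) (phi u : H -> R).

(** Only the last coordinate of the field depends on [p], and linearly so. Smoothness, continuity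
    and the triangular shape of the flow are all read off this form. *)
Lemma hfield_affine c p : hfield c p = c + (2 * symp p c) *: delta_mx 0 tidx.
Proof.
have tE : delta_mx 0 tidx = hpoint 0 0 1 :> H.
  rewrite -(hpointK (delta_mx 0 tidx)) /ht !mxE !eqxx; congr hpoint.
    by apply/rowP => j; rewrite hxE !mxE /= [_ == _]eq_lrshift.
  by apply/rowP => j; rewrite hyE !mxE /= [_ == _]eq_lrshift.
rewrite tE; apply: heis_ext; rewrite /hfield;
  rewrite ?(hx_hpoint, hy_hpoint, ht_hpoint, hxD, hyD, htD, hxZ, hyZ, htZ) //.
- by rewrite scaler0 addr0.
- by rewrite scaler0 addr0.
- by rewrite mulr1.
Qed.

Lemma smooth_expr_symp B c : smooth_expr B (fun p => symp p c).
Proof.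
rewrite /symp; apply: smooth_expr_sum => j.
rewrite (_ : (fun p => _) = (fun p => hx c 0 j * p 0 (lshift 1 (rshift n j)) +
    - (p 0 (lshift 1 (lshift n j)) * hy c 0 j))); last first.
  by apply/funext => p; rewrite (hxE p) (hyE p).
apply: SmAdd; first by apply: SmMul; [exact: SmCst|exact: SmCoord].
by apply: smooth_expr_opp; apply: SmMul; [exact: SmCoord|exact: SmCst].
Qed.

Lemma smooth_expr_hfield B c i : smooth_expr B (fun p => hfield c p 0 i).
Proof.
under eq_fun do rewrite hfield_affine !mxE.
apply: SmAdd; first exact: SmCst.
apply: SmMul; last exact: SmCst.
by apply: SmMul; [exact: SmCst|exact: smooth_expr_symp].
Qed.

Lemma hflow_coord c r p i : hflow c r p 0 i = p 0 i + r * hfield c p 0 i.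
Proof. by rewrite /hflow mxE; congr (_ + _); rewrite mxE. Qed.

Lemma smooth_expr_hflow B c r i : smooth_expr B (fun p => hflow c r p 0 i).
Proof.
under eq_fun do rewrite hflow_coord.
apply: SmAdd; first exact: SmCoord.
by apply: SmMul; [exact: SmCst|exact: smooth_expr_hfield].
Qed.

Lemma smooth_exprN0 u : smooth_expr (fun=> False) u -> smooth u.
Proof. exact: smooth_exprW. Qed.

Lemma smooth_continuous u : smooth u -> continuous u.
Proof. by move=> su p; exact/differentiable_continuous/smooth_differentiable. Qed.

Lemma continuous_symp c : continuous (fun p => symp p c).
Proof. exact/smooth_continuous/smooth_exprN0/smooth_expr_symp. Qed.

Lemma continuous_hflow2 c : continuous (fun rp : R * H => hflow c rp.1 rp.2).
Proof.
move=> [r p]; rewrite /hflow /=.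
under eq_fun do rewrite hfield_affine.
have c1 : rp.1 @[rp --> (r, p)] --> r by exact: cvg_fst.
have c2 : rp.2 @[rp --> (r, p)] --> p by exact: cvg_snd.
apply: cvgD; first exact: c2.
apply: cvgZ; first exact: c1.
apply: cvgD; first exact: cvg_cst.
apply: cvgZ; last exact: cvg_cst.
apply: cvgM; first exact: cvg_cst.
exact: (cvg_comp _ _ c2 (@continuous_symp c p)).
Qed.

Lemma continuous_hflow c r : continuous (hflow c r).
Proof.
move=> p; apply: (@cvg_comp _ _ _ (fun q => (r, q)) (fun rp => hflow c rp.1 rp.2)
  (nbhs p) (nbhs (r, p))); last first.
  exact: (@continuous_hflow2 c (r, p)).
by move=> A [[B C] /= [Br Cp] BC]; apply: filterS Cp => q Cq; apply: BC; split => //;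
  exact: nbhs_singleton.
Qed.

Lemma measurable_hflow2 c :
  measurable_fun [set: R * H] (fun rp : R * H => hflow c rp.1 rp.2).
Proof.
apply: measurable_fun_rVP => i.
under eq_fun do rewrite hflow_coord hfield_affine !mxE.
have mc j : measurable_fun [set: R * H] (fun rp : R * H => rp.2 0 j).
  exact: (measurableT_comp (@measurable_coord R _ j) measurable_snd).
apply: measurable_funD => //; apply: measurable_funM => //.
apply: measurable_funD => //; apply: measurable_funM => //; apply: measurable_funM => //.
apply: (@measurableT_comp _ _ _ _ _ _ (fun p : H => symp p c) _ snd) => //.
by apply: continuous_measurable_rV => //; exact: continuous_symp.
Qed.

Lemma measurable_hflow c r : measurable_fun setT (hflow c r).
Proof.
exact: (measurableT_comp (measurable_hflow2 c) (pair1_measurable r)).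
Qed.

(** Horizontal coordinates are shifted by constants and the last one by a function of the horizontal
    ones, so the flow is triangular with unit diagonal. *)
Lemma leb_hflow c r (A : set H) : measurable A -> leb (hflow c r @^-1` A) = leb A.
Proof.
move=> mA; apply: (@lebesgue_rV_triangular _ _ _ (fun i p => r * hfield c p 0 i)) => //.
- exact: measurable_hflow.
- by move=> i p; rewrite hflow_coord.
move=> i p q pq; rewrite !hfield_affine !mxE.
have [it|it] := eqVneq i tidx; last first.
  by rewrite !andbF !mulr0.
rewrite (@symp_eq _ _ p q c c) //.
  by apply/rowP => j; rewrite !hxE; apply: pq; rewrite it /= ltn_addr // ltn_addr.
by apply/rowP => j; rewrite !hyE; apply: pq; rewrite it /= addn0 ltn_add2l.
Qed.

Lemma ge0_integral_hflow c r (h : H -> \bar R) : measurable_fun setT h ->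
  (forall p, 0 <= h p)%E ->
  (\int[leb]_p h (hflow c r p) = \int[leb]_p h p)%E.
Proof.
move=> mh h0.
transitivity (\int[pushforward leb (hflow c r)]_p h p)%E; last first.
  apply: eq_measure_integral; first exact: measurable_hflow.
  by move=> ? A mA _; exact: leb_hflow.
by rewrite ge0_integral_pushforward //; exact: measurable_hflow.
Qed.

Lemma integrable_hflow c r (h : H -> \bar R) : leb.-integrable setT h ->
  leb.-integrable setT (h \o hflow c r).
Proof.
move=> /integrableP[mh ih]; apply/integrableP; split.
  by apply: measurableT_comp => //; exact: measurable_hflow.
rewrite (ge0_integral_hflow c r (h := fun p => `|h p|%E)) //.
exact: measurableT_comp.
Qed.

Lemma integral_hflow c r (h : H -> \bar R) : leb.-integrable setT h ->
  (\int[leb]_p h (hflow c r p) = \int[leb]_p h p)%E.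
Proof.
move=> ih.
transitivity (\int[pushforward leb (hflow c r)]_p h p)%E; last first.
  apply: eq_measure_integral; first exact: measurable_hflow.
  by move=> ? A mA _; exact: leb_hflow.
rewrite integral_pushforward //; first exact: measurable_hflow.
- exact: measurable_int ih.
- by rewrite preimage_setT; exact: integrable_hflow.
Qed.

Lemma is_derive_line u p w r : differentiable u (p + r *: w) ->
  is_derive r 1 (fun s => u (p + s *: w)) ('D_w u (p + r *: w)).
Proof.
move=> du; apply: DeriveDef.
  apply/derivable1P; have /derivable1P := @diff_derivable _ _ _ _ _ w du.
  rewrite (_ : (fun h : R => u (h *: w + (p + r *: w))) =
    (fun h : R => u (p + (h *: (1 : R) + r) *: w))) //.
  by apply/funext => h; rewrite /= [h *: 1]mulr1 scalerDl addrCA.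
apply: (congr1 (fun f : R -> R => lim (f h @[h --> 0^']))).
by apply/funext => h /=; rewrite [h *: 1]mulr1 scalerDl addrCA.
Qed.

Definition hderive c u p : R := 'D_(hfield c p) u p.

Lemma hderive_partial c u p : differentiable u p ->
  hderive c u p = \sum_i hfield c p 0 i * partial i u p.
Proof.
move=> du; rewrite /hderive deriveE // {1}[hfield c p]row_sum_delta linear_sum /=.
by apply: eq_bigr => i _; rewrite linearZ /= /partial deriveE.
Qed.

Lemma hderive_Zderive c u p : differentiable u p ->
  hderive c u p = \sum_k c 0 k * Zderive k u p.
Proof.
move=> du; rewrite /hderive deriveE // hfieldE linear_sum /=.
by apply: eq_bigr => k _; rewrite linearZ /= /Zderive deriveE.
Qed.

Lemma Zderive_hderive k u : Zderive k u = hderive (delta_mx 0 k) u.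
Proof.
apply/funext => p; rewrite /Zderive /hderive hfieldE; congr ('D__ u p).
rewrite (bigD1 k) //= big1 => [|j jk]; first by rewrite mxE !eqxx scale1r addr0.
by rewrite mxE (negbTE jk) andbF scale0r.
Qed.

Lemma smooth_hderive c u : smooth u -> smooth (hderive c u).
Proof.
move=> su; apply: (@smooth_exprW _ _ smooth) => //.
rewrite (_ : hderive c u = fun p => \sum_i hfield c p 0 i * partial i u p).
  apply: smooth_expr_sum => i; apply: SmMul; first exact: smooth_expr_hfield.
  by apply: SmBase; exact: smooth_partial.
by apply/funext => p; apply: hderive_partial; exact: smooth_differentiable.
Qed.

Lemma near_eq_hderive c u p : (\near p, u p = 0) -> hderive c u p = 0.
Proof.
move=> u0; rewrite /hderive (near_eq_derive (g := cst 0)) ?derive_cst //.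
Qed.

Lemma tsupport_hderive c u : tsupport (hderive c u) `<=` tsupport u.
Proof.
rewrite {1}/tsupport closureE; apply: smallest_sub; first exact: closed_closure.
move=> p /= /eqP hu; apply: contrapT => /= np; apply: hu; apply: near_eq_hderive.
have : open (~` tsupport u) by apply: closed_openC; exact: closed_closure.
move=> /(_ _ np); rewrite /= => H; apply: filterS H => q nq.
by apply: contrapT => /eqP uq; apply: nq; exact: subset_closure.
Qed.

Lemma test_function_hderive (Omega : set H) c u :
  test_function Omega u -> test_function Omega (hderive c u).
Proof.
move=> [su cu uO]; split; first exact: smooth_hderive.
  by apply: subclosed_compact cu _; [exact: closed_closure|exact: tsupport_hderive].
by apply: subset_trans uO; exact: tsupport_hderive.
Qed.

(** Flowing for time [h] and for time [r] commute, so the two difference quotients coincide. This is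
    what lets a test function be carried along the flow inside the weak formulation. *)
Lemma hderive_hflow c r u p :
  hderive c (u \o hflow c r) p = hderive c u (hflow c r p).
Proof.
rewrite /hderive hfield_hflow.
apply: (congr1 (fun f : R -> R => lim (f h @[h --> 0^']))).
apply/funext => h /=; congr (_ *: (u _ - _)).
rewrite -[h *: _ + p]addrC -/(hflow c h p) hflowD addrC -hflowD {1}/hflow.
by rewrite hfield_hflow addrC.
Qed.

End flow_regularity.

(** * Symmetry of second derivatives and the commutator of two fields *)

Section commutator.
Context {R : realType} {n : nat}.
Notation H := (heis R n).
Implicit Types (p q c w a b : H) (r s : R) (u : H -> R).

Lemma is_derive_symp p w c : is_derive p w (fun q => symp q c) (symp w c).
Proof.
have H0 : h^-1 *: (((fun q : H => symp q c) \o shift p) (h *: w) - symp p c)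
    @[h --> 0^'] --> symp w c.
  apply: (@cvg_trans _ ((fun=> symp w c) h @[h --> 0^'])); last exact: cvg_cst.
  apply: near_eq_cvg; near=> h => /=.
  have h0 : h != 0 by near: h; exact: nbhs_dnbhs_neq.
  by rewrite sympDl sympZl addrK /GRing.scale/= mulKf.
by apply: DeriveDef; [apply/cvg_ex; exists (symp w c)|exact: (cvg_lim _ H0)].
Unshelve. all: by end_near. Qed.

Local Opaque derive.

Lemma derive_row u p w : differentiable u p ->
  'D_w u p = \sum_i w 0 i * partial i u p.
Proof.
move=> du; rewrite deriveE // {1}[w]row_sum_delta linear_sum /=.
by apply: eq_bigr => i _; rewrite linearZ /= /partial deriveE.
Qed.

Lemma smooth_derive u w : smooth u -> smooth ('D_w u).
Proof.
move=> su; apply: (@smooth_exprW _ _ smooth) => //.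
rewrite (_ : 'D_w u = fun p => \sum_i w 0 i * partial i u p).
  apply: smooth_expr_sum => i; apply: SmMul; first exact: SmCst.
  by apply: SmBase; exact: smooth_partial.
by apply/funext => p; apply: derive_row; exact: smooth_differentiable.
Qed.

(** The mean value theorem twice: in direction [a] for the increment of [u] along [s *: b], then in
    direction [b] for ['D_a u]. *)
Lemma second_difference u p a b s : smooth u -> 0 < s ->
  exists ra rb, [/\ 0 <= ra <= s, 0 <= rb <= s &
    u (p + s *: a + s *: b) - u (p + s *: a) - (u (p + s *: b) - u p) =
    s ^+ 2 * 'D_b ('D_a u) (p + ra *: a + rb *: b)].
Proof.
move=> su s0; have su' := smooth_derive a su.
pose g r := u ((p + s *: b) + r *: a) - u (p + r *: a).
have dg r : is_derive r 1 g ('D_a u ((p + s *: b) + r *: a) - 'D_a u (p + r *: a)).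
  by apply: is_deriveB; apply: is_derive_line; exact: smooth_differentiable.
have [] := @MVT_segment R g _ 0 s (ltW s0) (fun r _ => dg r).
  by apply: derivable_within_continuous => r _; have [] := dg r.
move=> ra; rewrite in_itv /= => ras gs.
pose k r := 'D_a u ((p + ra *: a) + r *: b).
have dk r : is_derive r 1 k ('D_b ('D_a u) ((p + ra *: a) + r *: b)).
  by apply: is_derive_line; exact: smooth_differentiable.
have [] := @MVT_segment R k _ 0 s (ltW s0) (fun r _ => dk r).
  by apply: derivable_within_continuous => r _; have [] := dk r.
move=> rb; rewrite in_itv /= => rbs ks.
exists ra, rb; split => //.
rewrite expr2 -mulrA [s * 'D_b _ _]mulrC -[X in _ * X]/( _ * s).
move: ks gs; rewrite !subr0 /k /g scale0r !addr0 => <-.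
by rewrite !scale0r !addr0 !(addrAC p (s *: b)) => ->; rewrite mulrC.
Qed.

(** If [F p] and [G p] differed, continuity would keep the values of [F] and [G] apart near [p]; yet
    for small [s] both take the value of the second difference divided by [s ^+ 2] at points near
    [p]. *)
Lemma eq_second_difference u (F G : H -> R) p a b :
  {for p, continuous F} -> {for p, continuous G} ->
  (forall s, 0 < s -> exists ra rb, [/\ 0 <= ra <= s, 0 <= rb <= s &
    u (p + s *: a + s *: b) - u (p + s *: a) - (u (p + s *: b) - u p) =
    s ^+ 2 * F (p + ra *: a + rb *: b)]) ->
  (forall s, 0 < s -> exists ra rb, [/\ 0 <= ra <= s, 0 <= rb <= s &
    u (p + s *: a + s *: b) - u (p + s *: a) - (u (p + s *: b) - u p) =
    s ^+ 2 * G (p + ra *: a + rb *: b)]) ->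
  F p = G p.
Proof.
move=> cF cG uF uG; apply/eqP/negPn/negP => neq.
pose e := `|F p - G p| / 2.
have e0 : 0 < e by rewrite divr_gt0 // normr_gt0 subr_eq0.
have /nbhs_ballP[d /= d0 dP] : nbhs p [set q | `|F p - F q| < e /\ `|G p - G q| < e].
  by apply: filterI; [move/cvgrPdist_lt : cF|move/cvgrPdist_lt : cG]; apply.
(* All evaluation points are then within [s * (|a| + |b|) < d] of [p]; the added 1 keeps the
   denominator positive. *)
pose s := d / (`|a| + `|b| + 1).
have ab0 : 0 < `|a| + `|b| + 1 by rewrite ltr_wpDl // addr_ge0.
have s0 : 0 < s by rewrite divr_gt0.
have near_p ra rb : 0 <= ra <= s -> 0 <= rb <= s -> ball p d (p + ra *: a + rb *: b).
  move=> /andP[ra0 ras] /andP[rb0 rbs].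
  rewrite -ball_normE /= -addrA opprD addrA subrr add0r normrN.
  apply: (le_lt_trans (ler_normD _ _)); rewrite !normrZ !ger0_norm //.
  apply: (@le_lt_trans _ _ (s * (`|a| + `|b|))).
    by rewrite mulrDr lerD // ler_wpM2r.
  by rewrite /s mulrAC ltr_pdivrMr // ltr_pM2l // ltrDl.
have [ra [rb [ras rbs E1]]] := uF s s0.
have [ra' [rb' [ras' rbs' E2]]] := uG s s0.
have [h1 _] := dP _ (near_p _ _ ras rbs).
have [_ h2] := dP _ (near_p _ _ ras' rbs').
have E : F (p + ra *: a + rb *: b) = G (p + ra' *: a + rb' *: b).
  by apply: (@mulfI _ (s ^+ 2)); rewrite ?expf_neq0 ?gt_eqF // -E1 -E2.
rewrite E in h1.
suff : `|F p - G p| < e + e by rewrite -splitr ltxx.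
apply: le_lt_trans (ler_distD _ _ _) (ltrD h1 _).
by rewrite distrC.
Qed.

(** The second difference is symmetric in [a] and [b], so both mixed derivatives represent it. *)
Lemma schwarz u p a b : smooth u -> 'D_b ('D_a u) p = 'D_a ('D_b u) p.
Proof.
move=> su; apply: (@eq_second_difference u ('D_b ('D_a u)) ('D_a ('D_b u)) p a b).
- exact/smooth_continuous/smooth_derive/smooth_derive.
- exact/smooth_continuous/smooth_derive/smooth_derive.
- by move=> s; exact: second_difference.
move=> s s0; have [rb [ra [hrb hra E]]] := second_difference p b a su s0.
exists ra, rb; split; [exact: hra|exact: hrb|].
have swap (x y z t : R) : x - y - (z - t) = x - z - (y - t) by ring.
have E1 : p + s *: a + s *: b = p + s *: b + s *: a by exact: addrAC.
have E2 : p + ra *: a + rb *: b = p + rb *: b + ra *: a by exact: addrAC.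
by rewrite E1 E2; apply: etrans E; exact: swap.
Qed.

Lemma hderiveE c u p : differentiable u p ->
  hderive c u p = 'D_c u p + 2 * symp p c * 'D_(delta_mx 0 tidx) u p.
Proof.
by move=> du; rewrite /hderive !deriveE // hfield_affine linearD linearZ.
Qed.

Lemma symp_delta_tidx c : symp (delta_mx 0 tidx) c = 0.
Proof.
rewrite /symp big1 // => j _; rewrite (hxE (delta_mx 0 tidx)) (hyE (delta_mx 0 tidx)).
by rewrite !mxE /= ![_ == tidx]eq_lrshift mulr0 mul0r subr0.
Qed.

Lemma symp_delta_tidxr p : symp p (delta_mx 0 tidx) = 0.
Proof.
rewrite /symp big1 // => j _; rewrite (hxE (delta_mx 0 tidx)) (hyE (delta_mx 0 tidx)).
by rewrite !mxE /= ![_ == tidx]eq_lrshift mulr0 mul0r subr0.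
Qed.

Lemma is_derive_add_mul2 (f g k : H -> R) p w (f' g' k' : R) :
  is_derive p w f f' -> is_derive p w g g' -> is_derive p w k k' ->
  is_derive p w (fun q => f q + 2 * g q * k q)
    (f' + (2 * g' * k p + 2 * g p * k')).
Proof.
move=> df dg dk.
rewrite (_ : (fun q => _) = f + (2 *: (g * k))); last first.
  by apply/funext => q; rewrite -mulrA.
apply: (is_derive_eq (is_deriveD df (is_deriveZ 2 (is_deriveM dg dk)))).
by rewrite -![_ *: _]/(_ * _) mulrDr addrC (mulrC (k p)) !mulrA [RHS]addrC [in RHS](addrC (_ * k p)).
Qed.

Lemma derive_hderive c w u p : smooth u ->
  'D_w (hderive c u) p = 'D_w ('D_c u) p +
    (2 * symp w c * 'D_(delta_mx 0 tidx) u p +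
     2 * symp p c * 'D_w ('D_(delta_mx 0 tidx) u) p).
Proof.
move=> su.
have d v : is_derive p w ('D_v u) ('D_w ('D_v u) p).
  by apply/derivableP/diff_derivable/smooth_differentiable/smooth_derive.
have [_ <-] := is_derive_add_mul2 (d c) (is_derive_symp p w c) (d (delta_mx 0 tidx)).
have E : hderive c u = (fun q => 'D_c u q + 2 * symp q c * 'D_(delta_mx 0 tidx) u q).
  apply/funext => q.
  apply: hderiveE.
  exact: smooth_differentiable.
exact: (congr1 (fun g : H -> R => 'D_w g p) E).
Qed.

Local Opaque hderive.

(* [Y_j, X_j] = 4 T in invariant form. *)
Lemma hderive_commutator c c' u p : smooth u ->
  hderive c (hderive c' u) p - hderive c' (hderive c u) p =
  4 * symp c c' * Zderive tidx u p.
Proof.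
move=> su; pose e : H := delta_mx 0 tidx.
have dh k : differentiable (hderive k u) p.
  exact/smooth_differentiable/smooth_hderive.
have sympC : symp c' c = - symp c c'.
  by rewrite /symp -sumrN; apply: eq_bigr => j _; ring.
have de : Zderive tidx u p = 'D_e u p.
  rewrite Zderive_hderive hderiveE; last exact: smooth_differentiable.
  by rewrite symp_delta_tidxr mulr0 mul0r addr0.
(* The second-order terms cancel in the difference by [schwarz]. What remains is
   [2 * symp k k' * 'D_e u], from differentiating the coefficient of the inner field, and
   antisymmetry of [symp] doubles it. *)
have E k k' : hderive k (hderive k' u) p = 'D_k ('D_k' u) p +
    (2 * symp k k' * 'D_e u p + 2 * symp p k' * 'D_k ('D_e u) p) +
    2 * symp p k * ('D_e ('D_k' u) p + 2 * symp p k' * 'D_e ('D_e u) p).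
  rewrite (hderiveE _ (dh _)) (derive_hderive k' k p su) (derive_hderive k' e p su).
  by rewrite symp_delta_tidx mulr0 mul0r add0r.
rewrite de (E c c') (E c' c) sympC (schwarz p c c' su) (schwarz p e c su) (schwarz p e c' su).
move: ('D_c ('D_c' u) p) ('D_e ('D_c u) p) ('D_e ('D_c' u) p) ('D_e ('D_e u) p) ('D_e u p).
by move=> x1 x2 x3 x4 x5; ring.
Qed.

End commutator.

(** * Weak derivatives along left-invariant fields *)

Section weak_derivatives.
Context {R : realType} {n : nat}.
Notation H := (heis R n).
Notation N := (n + n + 1)%N.
Variable Omega : set H.
Hypothesis Omega_open : open Omega.
Implicit Types (p q c w : H) (u g phi : H -> R).

Local Opaque derive hderive.

Let mOmega : measurable Omega. Proof. exact: open_measurable_rV. Qed.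

Lemma hausdorff_heis : hausdorff_space H.
Proof. exact: norm_hausdorff. Qed.

Lemma measurable_compact_rV (K : set H) : compact K -> measurable K.
Proof.
move=> /(compact_closed hausdorff_heis) cK; rewrite -(setCK K).
by apply: measurableC; apply: open_measurable_rV; exact: closed_openC.
Qed.

Lemma bounded_supported phi : continuous phi -> compact (tsupport phi) ->
  exists2 M, 0 <= M & forall p, `|phi p| <= M.
Proof.
move=> cphi cs.
have /compact_bounded[M [Mr HM]] : compact (phi @` tsupport phi).
  by apply: continuous_compact => //; exact: continuous_subspaceT.
exists (`|M| + 1); first by rewrite addr_ge0.
move=> p; have [->|np] := eqVneq (phi p) 0; first by rewrite normr0 addr_ge0.
apply: HM; first by rewrite (le_lt_trans (ler_norm _)) // ltrDl.
by exists p => //; exact: subset_closure.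
Qed.

(* A product against a compactly supported continuous function only sees [u]
   on a compact set. *)
Lemma integrable_mul_supported u phi (K : set H) : measurable_fun Omega u ->
  leb.-integrable K (EFin \o u) -> measurable K -> K `<=` Omega ->
  continuous phi -> (exists M, forall p, `|phi p| <= M) ->
  (forall p, phi p != 0 -> K p) ->
  leb.-integrable Omega (fun p => (u p * phi p)%:E).
Proof.
move=> mu iu mK KO cphi [M HM] phiK.
have M0 : 0 <= M by apply: le_trans (HM 0).
apply: (@le_integrable _ _ _ _ _ mOmega _ (fun p => (M%:E * ((EFin \o u) \_ K) p)%E)).
- apply/measurable_EFinP; apply: measurable_funM => //.
  exact: continuous_measurable_rV.
- move=> p _; rewrite patchE /=; case: ifPn => [pK|].
    by rewrite -EFinM abse_EFin lee_fin !normrM mulrC ler_wpM2r // (ger0_norm M0).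
  rewrite notin_setE => nK.
  have -> : phi p = 0 by apply/eqP/negPn/negP => /phiK.
  by rewrite mulr0 normr0 abse_ge0.
- apply: integrableZl => //.
  by apply/integrable_restrict => //; rewrite setIidr.
Qed.

Lemma integrable_mul_test u phi : loc_integrable Omega u -> test_function Omega phi ->
  leb.-integrable Omega (fun p => (u p * phi p)%:E).
Proof.
move=> [mu iu] [sphi cphi phiO].
have cont := smooth_continuous sphi.
have [M _ HM] := bounded_supported cont cphi.
apply: (@integrable_mul_supported _ _ (tsupport phi)) => //.
- exact: iu.
- exact: measurable_compact_rV.
- by exists M.
- by move=> p pn; apply: subset_closure.
Qed.

(** The notion is extended from the frame to every left-invariant field, because the flows in use
    belong to [hhor w] and [hver w], not to single frame fields. *)
Definition weak_along c u g : Prop :=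
  [/\ loc_integrable Omega u, loc_integrable Omega g &
    forall phi, test_function Omega phi ->
      \int[leb]_(p in Omega) (u p * hderive c phi p) =
      - \int[leb]_(p in Omega) (g p * phi p)].

Lemma weak_along_delta k u g :
  is_weak_derivative Omega k u g <-> weak_along (delta_mx 0 k) u g.
Proof.
split => -[lu lg H0]; split; [exact: lu|exact: lg| |exact: lu|exact: lg|] => phi tphi.
  apply: etrans (H0 phi tphi); apply: eq_Rintegral => p _.
  by rewrite (Zderive_hderive k phi).
apply: etrans (H0 phi tphi); apply: eq_Rintegral => p _.
by rewrite (Zderive_hderive k phi).
Qed.

Lemma loc_integrable0 : loc_integrable Omega (fun=> 0).
Proof. by split => // K _ _; exact: integrable0. Qed.

Lemma loc_integrableD u g : loc_integrable Omega u -> loc_integrable Omega g ->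
  loc_integrable Omega (fun p => u p + g p).
Proof.
move=> [mu iu] [mg ig]; split; first exact: measurable_funD.
move=> K cK KO; have mK := measurable_compact_rV cK.
exact: (integrableD mK (iu K cK KO) (ig K cK KO)).
Qed.

Lemma loc_integrableZ a u : loc_integrable Omega u ->
  loc_integrable Omega (fun p => a * u p).
Proof.
move=> [mu iu]; split; first exact: measurable_funM.
move=> K cK KO; have mK := measurable_compact_rV cK.
exact: (integrableZl mK a (iu K cK KO)).
Qed.

Lemma loc_integrable_sum I (s : seq I) (u : I -> H -> R) :
  (forall i, loc_integrable Omega (u i)) ->
  loc_integrable Omega (fun p => \sum_(i <- s) u i p).
Proof.
move=> lu; elim: s => [|i s IH].
  by under eq_fun do rewrite big_nil; exact: loc_integrable0.
by under eq_fun do rewrite big_cons; exact: loc_integrableD.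
Qed.

Lemma Rintegral_mul_sum I (s : seq I) (a : I -> R) (u : I -> H -> R) phi :
  (forall i, loc_integrable Omega (u i)) -> test_function Omega phi ->
  \int[leb]_(p in Omega) ((\sum_(i <- s) a i * u i p) * phi p) =
  \sum_(i <- s) a i * \int[leb]_(p in Omega) (u i p * phi p).
Proof.
move=> lu tphi; elim: s => [|i s IH].
  rewrite big_nil /Rintegral; under eq_integral do rewrite big_nil mul0r.
  by rewrite integral0.
rewrite big_cons -IH -RintegralZl //; last exact: integrable_mul_test.
rewrite -RintegralD //.
- by apply: eq_Rintegral => p _; rewrite big_cons mulrDl mulrA.
- exact: (integrableZl mOmega (a i) (integrable_mul_test (lu i) tphi)).
- apply: integrable_mul_test => //; apply: loc_integrable_sum => j.
  exact: loc_integrableZ.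
Qed.

Lemma weak_along_suml I (s : seq I) (a : I -> R) (u g : I -> H -> R) c :
  (forall i, weak_along c (u i) (g i)) ->
  weak_along c (fun p => \sum_(i <- s) a i * u i p)
    (fun p => \sum_(i <- s) a i * g i p).
Proof.
move=> H0; have lu i : loc_integrable Omega (u i) by have [] := H0 i.
have lg i : loc_integrable Omega (g i) by have [] := H0 i.
split; [by apply: loc_integrable_sum => i; exact: loc_integrableZ..|].
move=> phi tphi; rewrite !Rintegral_mul_sum //; last exact: test_function_hderive.
rewrite -sumrN; apply: eq_bigr => i _; have [_ _ ->] := H0 i => //.
by rewrite mulrN.
Qed.

(** Linearity in the field. Left-invariant fields have constant coefficients [a] in the frame, which
    pass through the integral from the test function to the weak derivative. *)
Lemma weak_along_sumr I (s : seq I) (a : I -> R) (g : I -> H -> R) u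
    (c : I -> H) (d : H) :
  loc_integrable Omega u ->
  (forall phi p, smooth phi -> hderive d phi p = \sum_(i <- s) a i * hderive (c i) phi p) ->
  (forall i, weak_along (c i) u (g i)) ->
  weak_along d u (fun p => \sum_(i <- s) a i * g i p).
Proof.
move=> lu dE H0; have lg i : loc_integrable Omega (g i) by have [] := H0 i.
split => //; first by apply: loc_integrable_sum => i; exact: loc_integrableZ.
move=> phi tphi; rewrite Rintegral_mul_sum //.
have [sphi _ _] := tphi.
transitivity (\int[leb]_(p in Omega) (\sum_(i <- s) a i * (u p * hderive (c i) phi p))).
  apply: eq_Rintegral => p _; rewrite dE // mulr_sumr; apply: eq_bigr => i _.
  by rewrite mulrCA.
rewrite -sumrN.
have : \sum_(i <- s) - (a i * \int[leb]_(p in Omega) (g i p * phi p)) =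
  \sum_(i <- s) a i * \int[leb]_(p in Omega) (u p * hderive (c i) phi p).
  by apply: eq_bigr => i _; have [_ _ ->] := H0 i => //; rewrite mulrN.
move=> ->.
have iu i : leb.-integrable Omega (fun p => (u p * hderive (c i) phi p)%:E).
  by apply: integrable_mul_test => //; exact: test_function_hderive.
have is_ t : leb.-integrable Omega (fun p => (\sum_(i <- t) a i * (u p * hderive (c i) phi p))%:E).
  elim: t => [|i t IH].
    by under eq_fun do rewrite big_nil; exact: integrable0.
  under eq_fun do rewrite big_cons EFinD.
  by apply: integrableD => //; exact: (integrableZl mOmega (a i) (iu i)).
elim: s {dE} => [|i s IH].
  rewrite big_nil /Rintegral; under eq_integral do rewrite big_nil.
  by rewrite integral0.
rewrite big_cons -IH -(RintegralZl (a i) mOmega (iu i)).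
apply: etrans (RintegralD (f1 := fun p => a i * (u p * hderive (c i) phi p))
  (f2 := fun p => \sum_(j <- s) a j * (u p * hderive (c j) phi p))
  mOmega (integrableZl mOmega (a i) (iu i)) (is_ s)).
by apply: eq_Rintegral => p _; rewrite big_cons.
Qed.

Lemma weakZP k u : weakly_derivable Omega k u ->
  is_weak_derivative Omega k u (weakZ Omega k u).
Proof. by move=> [g Hg]; rewrite /weakZ; apply: xgetPex; exists g. Qed.

Lemma hderive_hor c phi p : ht c = 0 -> smooth phi ->
  hderive c phi p = \sum_(j < n + n) c 0 (hidx j) * hderive (delta_mx 0 (hidx j)) phi p.
Proof.
move=> c0 sphi; rewrite hderive_Zderive; last exact: smooth_differentiable.
rewrite big_split_ord /= big_ord1 [X in _ + X * _]c0 mul0r addr0.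
by apply: eq_bigr => j _; rewrite Zderive_hderive.
Qed.

Lemma weak_along_hor c u (g : 'I_(n + n) -> H -> R) : ht c = 0 ->
  loc_integrable Omega u ->
  (forall j, is_weak_derivative Omega (hidx j) u (g j)) ->
  weak_along c u (fun p => \sum_j c 0 (hidx j) * g j p).
Proof.
move=> c0 lu H0.
apply: (@weak_along_sumr _ _ (fun j => c 0 (hidx j)) g u (fun j => delta_mx 0 (hidx j)) c lu).
  by move=> phi p sphi; exact: hderive_hor.
by move=> j; exact: (proj1 (weak_along_delta _ _ _)).
Qed.

Lemma weak_along_ver w u g : is_weak_derivative Omega tidx u g ->
  weak_along (hver w) u (fun p => ht w * g p).
Proof.
move=> H0; have [lu _ _] := H0.
have := @weak_along_sumr _ [:: tt] (fun=> ht w) (fun=> g) u (fun=> delta_mx 0 tidx) (hver w) lu.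
under eq_fun do rewrite big_seq1; apply; last first.
  by move=> _; exact: (proj1 (weak_along_delta _ _ _)).
move=> phi p sphi; rewrite big_seq1 -Zderive_hderive hderive_Zderive; last first.
  exact: smooth_differentiable.
rewrite big_split_ord /= big_ord1 big1 => [|j _]; first by rewrite add0r -[hver w 0 _]/(ht (hver w)) ht_hpoint.
by rewrite /hver /hpoint row_mxEl row_mx0 mxE mul0r.
Qed.

End weak_derivatives.

Section ae_cover.
Context {R : realType} {k : nat}.
Notation mu := (lebesgue_rV k : {measure set 'rV[R]_k -> \bar R}).

(** Countably many rational boxes cover [U], so their exceptional sets together form a null set. [Q]
    enumerates the boxes through [unpickle] and is trivially true at codes that denote none. *)
Lemma ae_boxes (U : set 'rV[R]_k) (P : 'rV[R]_k -> Prop) : open U ->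
  (forall a b, cbox a b `<=` U -> {ae mu, forall v, obox a b v -> P v}) ->
  {ae mu, forall v, U v -> P v}.
Proof.
move=> oU H0.
pose Q (i : nat) (v : 'rV[R]_k) : Prop :=
  match @unpickle ({ffun 'I_k -> rat} * {ffun 'I_k -> rat})%type i with
  | Some q => cbox (ratrV q.1) (ratrV q.2) `<=` U ->
      obox (ratrV q.1) (ratrV q.2) v -> P v
  | None => True
  end.
have QP i : \forall v \ae mu, Q i v.
  rewrite /Q; case: unpickle => [q|]; last exact: aeW.
  have [qU|qU] := pselect (cbox (@ratrV R k q.1) (ratrV q.2) `<=` U).
    by apply: filterS (H0 _ _ qU) => v Pv _.
  by apply: aeW => v /qU.
have : \forall v \ae mu, forall i, Q i v by exact/ae_foralln.
apply: filterS => v Qv; rewrite {1}(open_bigcup_obox oU) => -[q /= qU qv].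
by have := Qv (pickle q); rewrite /Q pickleK; apply.
Qed.

End ae_cover.

(** * Uniqueness of weak derivatives; the derivative along [T] *)

Section uniqueness.
Context {R : realType} {n : nat}.
Notation H := (heis R n).
Variable Omega : set H.
Hypothesis Omega_open : open Omega.
Implicit Types (p q c w a b : H) (u g phi : H -> R).
Local Opaque derive hderive.

Let mOmega : measurable Omega. Proof. exact: open_measurable_rV. Qed.

Lemma smooth_expr_bump B m a b : smooth_expr B (bump m a b : H -> R).
Proof.
apply: smooth_expr_prod => i; apply: SmMul; apply: SmFlat; apply: SmMul;
  first [exact: SmCst|apply: SmAdd].
- exact: SmCoord.
- exact: SmCst.
- exact: SmCst.
- by apply: smooth_expr_opp; exact: SmCoord.
Qed.

Lemma tsupport_bump m a b : tsupport (bump m a b : H -> R) `<=` cbox a b.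
Proof.
rewrite /tsupport closureE; apply: smallest_sub.
  by apply: compact_closed; [exact: hausdorff_heis|exact: compact_cbox].
by move=> p /= /bump_obox; exact: obox_cbox.
Qed.

Lemma test_function_bump (U : set H) m a b : cbox a b `<=` U ->
  test_function U (bump m a b).
Proof.
move=> abU; split.
- exact/smooth_exprN0/smooth_expr_bump.
- apply: subclosed_compact (@compact_cbox _ _ a b) _; first exact: closed_closure.
  exact: tsupport_bump.
- by apply: subset_trans abU; exact: tsupport_bump.
Qed.

(** The fundamental lemma of the calculus of variations. On a box whose closed version lies in
    [Omega], [g] is integrable and smaller bumps are test functions, so [bump_ae0] applies. *)
Lemma loc_integrable_ae0 g : loc_integrable Omega g ->
  (forall phi, test_function Omega phi -> \int[leb]_(p in Omega) (g p * phi p) = 0) ->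
  {ae leb, forall p, Omega p -> g p = 0}.
Proof.
move=> lg g0; apply: ae_boxes => // a b abO.
have [mg ig] := lg.
have iab : leb.-integrable (obox a b) (EFin \o g).
  apply: (integrableS _ _ _ (ig _ (@compact_cbox _ _ a b) abO)).
  - exact: measurable_cbox.
  - exact: measurable_obox.
  - exact: obox_cbox.
apply: bump_ae0 => // m a' b' ab' oab'.
have tphi := @test_function_bump Omega m a' b' (subset_trans ab' abO).
have /(_ mOmega) fin := integrable_fin_num _ (integrable_mul_test Omega_open lg tphi).
transitivity (\int[leb]_(v in Omega) (g v * bump m a' b' v)%:E)%E; last first.
  by rewrite -(fineK fin) -[X in _ = X%:E](g0 _ tphi).
rewrite integral_mkcond [RHS]integral_mkcond; apply: eq_integral => v _.
rewrite !patchE; have [->|/bump_obox bv] := eqVneq (bump m a' b' v) 0.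
  by rewrite mulr0; do 2 case: ifP.
have vO : Omega v by exact/abO/ab'/obox_cbox.
have vB := oab' _ bv.
by rewrite !mem_set.
Qed.

Lemma weak_derivative_unique k u g g' : is_weak_derivative Omega k u g ->
  is_weak_derivative Omega k u g' -> {ae leb, forall p, Omega p -> g p = g' p}.
Proof.
move=> [lu lg Hg] [_ lg' Hg'].
have lN : loc_integrable Omega (fun p => -1 * g' p) by exact: loc_integrableZ.
have : {ae leb, forall p, Omega p -> g p + -1 * g' p = 0}.
  apply: loc_integrable_ae0; first exact: loc_integrableD.
  move=> phi tphi.
  have i1 := integrable_mul_test Omega_open lg tphi.
  have i2 := integrable_mul_test Omega_open lN tphi.
  transitivity (\int[leb]_(p in Omega) (g p * phi p + (-1 * g' p) * phi p)).
    by apply: eq_Rintegral => p _; rewrite mulrDl.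
  rewrite RintegralD //.
  have i3 := integrable_mul_test Omega_open lg' tphi.
  have -> : \int[leb]_(p in Omega) (-1 * g' p * phi p) = -1 * \int[leb]_(p in Omega) (g' p * phi p).
    by rewrite -RintegralZl //; apply: eq_Rintegral => p _; rewrite mulrA.
  by rewrite mulN1r -(opprK (\int[_]_(p in _) (g p * _))) -Hg // -Hg' // addNr.
by apply: filterS => p gp /gp /eqP; rewrite mulN1r subr_eq0 => /eqP.
Qed.

Definition hX (j : 'I_n) : 'I_(n + n) := lshift n j.
Definition hY (j : 'I_n) : 'I_(n + n) := rshift n j.

Lemma symp_YX (j : 'I_n) :
  symp (delta_mx 0 (hidx (hY j)) : H) (delta_mx 0 (hidx (hX j))) = 1.
Proof.
rewrite /symp (bigD1 j) //= big1 => [|i ij]; rewrite !hxE !hyE !mxE /=.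
  by rewrite !eq_lshift !eq_rshift !eq_lrshift !eq_rlshift !eqxx !mulr1 mul0r subr0 addr0.
by rewrite !eq_lshift !eq_rshift !eq_lrshift !eq_rlshift (negbTE ij) !mul0r subr0.
Qed.

(** Integration by parts removes the outer field of the test function first, so [Y X phi] against
    [u] becomes [phi] against [gXY], that is [X Y u]. This reversal of order supplies the minus sign
    of the weak formulation. *)
Lemma is_weak_derivative_T (j : 'I_n) u gX gY gXY gYX :
  is_weak_derivative Omega (hidx (hX j)) u gX ->
  is_weak_derivative Omega (hidx (hY j)) u gY ->
  is_weak_derivative Omega (hidx (hX j)) gY gXY ->
  is_weak_derivative Omega (hidx (hY j)) gX gYX ->
  is_weak_derivative Omega tidx u (fun p => 4^-1 * (gYX p - gXY p)).
Proof.
move=> [lu lX HX] [_ lY HY] [_ lXY HXY] [_ lYX HYX].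
have lg : loc_integrable Omega (fun p => 4^-1 * (gYX p + -1 * gXY p)).
  by apply/loc_integrableZ/loc_integrableD => //; exact: loc_integrableZ.
have lg' : loc_integrable Omega (fun p => 4^-1 * (gYX p - gXY p)).
  by under eq_fun do rewrite -mulN1r.
split => //.
move=> phi tphi; have [sphi _ _] := tphi.
pose cX : H := delta_mx 0 (hidx (hX j)).
pose cY : H := delta_mx 0 (hidx (hY j)).
have tX : test_function Omega (hderive cX phi) by exact: test_function_hderive.
have tY : test_function Omega (hderive cY phi) by exact: test_function_hderive.
have tYX : test_function Omega (hderive cY (hderive cX phi)) by exact: test_function_hderive.
have tXY : test_function Omega (hderive cX (hderive cY phi)) by exact: test_function_hderive.
transitivity (\int[leb]_(p in Omega) (4^-1 * (u p * hderive cY (hderive cX phi) p -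
    u p * hderive cX (hderive cY phi) p))).
  apply: eq_Rintegral => p _; rewrite -mulrBr hderive_commutator // symp_YX.
  by field.
have iYX := integrable_mul_test Omega_open lu tYX.
have iXY := integrable_mul_test Omega_open lu tXY.
have twice a b u1 u2 (k l : 'I_(n + n + 1)) : test_function Omega (hderive a phi) ->
    a = delta_mx 0 k -> b = delta_mx 0 l ->
    (forall psi, test_function Omega psi -> \int[leb]_(p in Omega) (u p * Zderive l psi p) =
      - \int[leb]_(p in Omega) (u1 p * psi p)) ->
    (forall psi, test_function Omega psi -> \int[leb]_(p in Omega) (u1 p * Zderive k psi p) =
      - \int[leb]_(p in Omega) (u2 p * psi p)) ->
    \int[leb]_(p in Omega) (u p * hderive b (hderive a phi) p) =
    \int[leb]_(p in Omega) (u2 p * phi p).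
  move=> ta aE bE H1 H2.
  transitivity (\int[leb]_(p in Omega) (u p * Zderive l (hderive a phi) p)).
    by apply: eq_Rintegral => p _; rewrite bE (Zderive_hderive l).
  apply: (etrans (H1 _ ta)).
  apply: (etrans (congr1 -%R (etrans _ (H2 _ tphi))) (opprK _)).
  by apply: eq_Rintegral => p _; rewrite aE (Zderive_hderive k).
rewrite (RintegralZl _ mOmega (integrableB mOmega iYX iXY)) (RintegralB mOmega iYX iXY).
have E1 := twice cX cY gY gXY (hidx (hX j)) (hidx (hY j)) tX erefl erefl HY HXY.
have E2 := twice cY cX gX gYX (hidx (hY j)) (hidx (hX j)) tY erefl erefl HX HYX.
apply: (etrans (congr1 (fun x => 4^-1 * x) (congr2 (fun x y => x - y) E1 E2))).
have jYX := integrable_mul_test Omega_open lYX tphi.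
have jXY := integrable_mul_test Omega_open lXY tphi.
rewrite -(RintegralB mOmega jXY jYX) -(RintegralZl _ mOmega (integrableB mOmega jXY jYX)).
have jB := integrable_mul_test Omega_open lg' tphi.
rewrite -[RHS]mulN1r -(RintegralZl _ mOmega jB).
by apply: eq_Rintegral => p _; ring.
Qed.

End uniqueness.

(** * The fundamental theorem of calculus along flows *)

Section flow_formula.
Context {R : realType} {n : nat}.
Notation H := (heis R n).
Notation mu1 := (@lebesgue_measure R).
Implicit Types (p q c w a b : H) (u g phi : H -> R).

Lemma derive_oppr (f : H -> R) p w : differentiable f p -> 'D_(- w) f p = - 'D_w f p.
Proof. by move=> df; rewrite !deriveE // linearN. Qed.

Lemma hderive_at_hflow c phi r q :
  hderive c phi (hflow c r q) = 'D_(hfield c q) phi (hflow c r q).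
Proof. by rewrite /hderive hfield_hflow. Qed.

Local Opaque derive hderive.

Lemma FTC2_is_derive (F f : R -> R) (a b : R) : a < b ->
  (forall x : R, is_derive x 1 F (f x)) -> continuous f ->
  (\int[mu1]_(x in `[a, b]) (f x)%:E = (F b - F a)%:E)%E.
Proof.
move=> ab dF cf.
have cF x : {for x, continuous F}.
  by apply: differentiable_continuous; apply/derivable1_diffP; have [] := dF x.
apply: continuous_FTC2 => //.
- exact: continuous_subspaceT.
- split=> [x _| |]; first by have [] := dF x.
    by apply: cvg_at_right_filter; exact: cF.
  by apply: cvg_at_left_filter; exact: cF.
- by move=> x _; rewrite derive1E; have [_ ->] := dF x.
Qed.

Lemma is_derive_flowN c phi q (r : R) : smooth phi ->
  is_derive r 1 (fun s => - phi (hflow c (- s) q)) (hderive c phi (hflow c (- r) q)).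
Proof.
move=> sphi.
have dphi p : differentiable phi p by exact: smooth_differentiable.
have E s : hflow c (- s) q = q + s *: - hfield c q by rewrite /hflow scaleNr scalerN.
have := is_deriveN (@is_derive_line _ _ phi q (- hfield c q) r (dphi _)).
rewrite -E derive_oppr // opprK -hderive_at_hflow.
rewrite (_ : - (fun s => phi (q + s *: - hfield c q)) =
  (fun s => - phi (hflow c (- s) q))) //; by apply/funext => s; rewrite E.
Qed.

Variables (c : H) (e : R).
Hypothesis e0 : 0 < e.
Notation I := (`[0, e]%classic : set R).

Let mI : measurable (I : set R). Proof. exact: measurable_itv. Qed.

Lemma continuous_hflowN q : continuous (fun t : R => hflow c (- t) q).
Proof.
move=> t; apply: cvgD; first exact: cvg_cst.
by apply: cvgZ; [apply: cvgN; exact: cvg_id|exact: cvg_cst].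
Qed.

Lemma measurable_flow2 (a : R) :
  measurable_fun [set: H * R] (fun z : H * R => hflow c (a * z.2) z.1).
Proof.
apply: (@measurableT_comp _ _ _ _ _ _ (fun rp : R * H => hflow c rp.1 rp.2) _
  (fun z : H * R => (a * z.2, z.1))); first exact: measurable_hflow2.
by apply/measurable_fun_pairP; split; [exact: measurable_funM|exact: measurable_fst].
Qed.

(** Tonelli with time outside: by invariance each time slice has integral at most [M] times that of
    [|g|], and the interval is finite. The factor [a] is 0 or 1, for a function at rest or moved by
    the flow. *)
Lemma integrable_flow2 (a M : R) g (k : H * R -> R) :
  leb.-integrable setT (EFin \o g) -> measurable_fun setT k ->
  (forall z, `|k z| <= M) ->
  (leb \x mu1)%E.-integrable setT
    (fun z : H * R => (\1_I z.2 * g (hflow c (a * z.2) z.1) * k z)%:E).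
Proof.
move=> /integrableP[/measurable_EFinP mg ig] mk kM.
have M0 : 0 <= M by apply: le_trans (kM (0, 0)).
have mgf : measurable_fun setT (fun z : H * R => g (hflow c (a * z.2) z.1)).
  by apply: (@measurableT_comp _ _ _ _ _ _ g) => //; exact: measurable_flow2.
have m1 : measurable_fun setT (fun z : H * R => \1_I z.2 : R).
  by apply: (@measurableT_comp _ _ _ _ _ _ (\1_I : R -> R) _ snd) => //; exact: measurable_indic.
have mf : measurable_fun setT (fun z : H * R => (\1_I z.2 * g (hflow c (a * z.2) z.1) * k z)%:E).
  by apply/measurable_EFinP; apply: measurable_funM => //; exact: measurable_funM.
apply/integrable21ltyP => //.
apply: (@le_lt_trans _ _ (\int[mu1]_(t in I) (M%:E * \int[leb]_p `|(g p)%:E|))%E).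
  rewrite [leRHS]integral_mkcond; apply: ge0_le_integral => //.
  - by move=> t _; exact: integral_ge0.
  - apply: (measurable_fun_fubini_tonelli_G (fun z => `|(\1_I z.2 * g (hflow c (a * z.2) z.1) * k z)%:E|%E)) => //.
    exact: measurableT_comp.
  - by apply/(measurable_restrictT _ _).1 => //.
  - move=> t _; rewrite patchE; case: ifPn => tI; last first.
      rewrite integral0_eq // => p _ /=.
      by rewrite indicE (negbTE tI) !mul0r normr0.
    have mgt : measurable_fun setT (fun p => g (hflow c (a * t) p)).
      by apply: measurableT_comp => //; exact: measurable_hflow.
    rewrite -(ge0_integral_hflow c (a * t) (h := fun p => `|(g p)%:E|%E)) //; last first.
      by apply: measurableT_comp => //; exact/measurable_EFinP.
    rewrite -ge0_integralZl //; last first.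
      by apply: measurableT_comp => //; exact/measurable_EFinP.
    apply: ge0_le_integral => //.
    + apply: measurableT_comp => //.
      exact: (measurableT_comp mf (pair2_measurable t)).
    + apply: measurable_funeM; apply: measurableT_comp => //; exact/measurable_EFinP.
    + move=> p _ /=; rewrite indicE tI mul1r -EFinM lee_fin normrM mulrC.
      by rewrite ler_wpM2r.
rewrite integral_cst //= lebesgue_measure_itv /= lte_fin e0 -EFinB subr0.
apply: lte_mul_pinfty => //; last by rewrite ltry.
  by rewrite mule_ge0 // integral_ge0.
by rewrite fin_numM // ge0_fin_numE // integral_ge0.
Qed.

(** Here [g] is minus the weak derivative. Both sides equal the integral over time and space of [u]
    against [hderive c phi] moved back by time [t]. Integrating in time first gives the left side,
    once invariance has shifted the flow at time [e] from [phi] to [u]. Integrating in space first,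
    [weak] and the same shift at each time [t] give the right side. *)
Lemma flow_duality u g phi : smooth phi ->
  (exists M, forall p, `|phi p| <= M) -> (exists M, forall p, `|hderive c phi p| <= M) ->
  leb.-integrable setT (EFin \o u) -> leb.-integrable setT (EFin \o g) ->
  (forall t, I t ->
    (\int[leb]_q (u q * hderive c phi (hflow c (- t) q))%:E =
     \int[leb]_q (g q * phi (hflow c (- t) q))%:E)%E) ->
  (\int[leb]_p ((u p - u (hflow c e p)) * phi p)%:E =
   \int[leb]_p \int[mu1]_t (\1_I t * g (hflow c t p) * phi p)%:E)%E.
Proof.
move=> sphi [M phiM] [M' psiM] iu ig weak.
have cphi := smooth_continuous sphi.
have cpsi := smooth_continuous (smooth_hderive c sphi).
have mphi : measurable_fun setT phi by exact: continuous_measurable_rV.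
have mpsi : measurable_fun setT (hderive c phi) by exact: continuous_measurable_rV.
have ibdd (h k : H -> R) (B : R) : leb.-integrable setT (EFin \o h) ->
    measurable_fun setT k -> (forall p, `|k p| <= B) ->
    leb.-integrable setT (fun p => (h p * k p)%:E).
  move=> ih mk kB; have B0 : 0 <= B by apply: le_trans (kB 0).
  apply: (@le_integrable _ _ _ _ _ _ _ (fun p => (B%:E * (h p)%:E)%E)) => //.
  - apply/measurable_EFinP; apply: measurable_funM => //; apply/measurable_EFinP.
    exact: measurable_int ih.
  - move=> p _; rewrite -EFinM !abse_EFin lee_fin !normrM mulrC (ger0_norm B0).
    by rewrite ler_wpM2r.
  - exact: integrableZl.
have mflow1 k : measurable_fun setT k ->
    measurable_fun setT (fun z : H * R => k (hflow c (- z.2) z.1) : R).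
  move=> mk; apply: (@measurableT_comp _ _ _ _ _ _ k) => //.
  by under eq_fun do rewrite -mulN1r; exact: measurable_flow2.
transitivity (\int[leb]_q \int[mu1]_t (\1_I t * u q * hderive c phi (hflow c (- t) q))%:E)%E.
- have inner q : (\int[mu1]_t (\1_I t * u q * hderive c phi (hflow c (- t) q))%:E =
      (u q * phi q - u q * phi (hflow c (- e) q))%:E)%E.
    have dF (t : R) : is_derive t 1 (u q *: (fun s => - phi (hflow c (- s) q)))
        (u q * hderive c phi (hflow c (- t) q)).
      by apply: is_deriveZ; exact: is_derive_flowN.
    have cf : continuous (fun t => u q * hderive c phi (hflow c (- t) q)).
      move=> t; apply: cvgM; first exact: cvg_cst.
      exact: (cvg_comp _ _ (@continuous_hflowN q t) (cpsi _)).
    have := FTC2_is_derive e0 dF cf.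
    rewrite -[X in _ = X%:E -> _]/(u q * - phi (hflow c (- e) q) - u q * - phi (hflow c (- 0) q)).
    rewrite oppr0 hflow0 integral_mkcond => E.
    transitivity ((u q * - phi (hflow c (- e) q) - u q * - phi q)%:E).
      rewrite -E; apply: eq_integral => t _; rewrite patchE indicE.
      by case: ifPn => _; rewrite ?mul1r ?mul0r.
    by congr EFin; ring.
  under [RHS]eq_integral do rewrite inner EFinB.
  have i1 := ibdd _ _ M iu mphi phiM.
  have i2 : leb.-integrable setT (fun q => (u q * phi (hflow c (- e) q))%:E).
    by apply: (ibdd _ _ M iu) => //; apply: measurableT_comp => //; exact: measurable_hflow.
  rewrite (integralB _ i1 i2) //.
  have i3 : leb.-integrable setT (fun p => (u (hflow c e p) * phi p)%:E).
    by apply: (ibdd (u \o hflow c e) phi M) => //; exact: (integrable_hflow _ _ iu).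
  transitivity (\int[leb]_p ((u p * phi p)%:E - (u (hflow c e p) * phi p)%:E))%E.
    by apply: eq_integral => p _; rewrite -EFinB mulrBl.
  rewrite (integralB _ i1 i3) //; congr (_ - _)%E.
  rewrite -(integral_hflow c e i2); apply: eq_integral => p _.
  by rewrite hflowK.
- have /Fubini /= -> : (leb \x mu1)%E.-integrable setT (fun z : H * R =>
      (\1_I z.2 * u z.1 * hderive c phi (hflow c (- z.2) z.1))%:E).
    rewrite (_ : (fun z => _) = (fun z : H * R => (\1_I z.2 *
      u (hflow c (0 * z.2) z.1) * hderive c phi (hflow c (- z.2) z.1))%:E)).
      exact: (integrable_flow2 0 iu (mflow1 _ mpsi) (fun z => psiM _)).
    by apply/funext => z; rewrite mul0r hflow0.
  have /Fubini /= -> : (leb \x mu1)%E.-integrable setT (fun z : H * R =>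
      (\1_I z.2 * g (hflow c z.2 z.1) * phi z.1)%:E).
    rewrite (_ : (fun z => _) = (fun z : H * R => (\1_I z.2 *
      g (hflow c (1 * z.2) z.1) * phi z.1)%:E)).
      exact: (integrable_flow2 1 ig (measurableT_comp mphi measurable_fst)
        (fun z => phiM _)).
    by apply/funext => z; rewrite mul1r.
  apply: eq_integral => t _; rewrite indicE.
  have [tI|tI] := boolP (t \in I); last first.
    by rewrite !integral0_eq // => p _; rewrite !mul0r.
  have it : leb.-integrable setT (fun q => (g q * phi (hflow c (- t) q))%:E).
    by apply: (ibdd _ _ M ig) => //; apply: measurableT_comp => //; exact: measurable_hflow.
  under eq_integral do rewrite mul1r.
  rewrite weak; last by rewrite inE in tI.
  rewrite -(integral_hflow c t it); apply: eq_integral => p _.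
  by rewrite hflowK mul1r.
Qed.

End flow_formula.

(** * From duality with bumps to a formula almost everywhere *)

Section flow_formula_ae.
Context {R : realType} {n : nat}.
Notation H := (heis R n).
Notation mu1 := (@lebesgue_measure R).
Implicit Types (p q c w a b : H) (u g phi : H -> R).
Local Opaque derive hderive.
Variables (c : H) (e : R).
Hypothesis e0 : 0 < e.
Notation I := (`[0, e]%classic : set R).

Let mI : measurable (I : set R). Proof. exact: measurable_itv. Qed.

Lemma bounded_bump m a b : exists M, forall p, `|bump m a b p : R| <= M.
Proof. by exists 1 => p; rewrite ger0_norm ?bump_ge0 ?bump_le1. Qed.

Lemma bounded_hderive_bump m a b : exists M, forall p, `|hderive c (bump m a b) p : R| <= M.
Proof.
have tb : test_function setT (bump m a b : H -> R) by exact: test_function_bump.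
have [sb cb _] := test_function_hderive c tb.
by have [M _ HM] := bounded_supported (smooth_continuous sb) cb; exists M.
Qed.

(** The defect [h] of the formula is integrable, and by [flow_duality] orthogonal to all bumps in
    the box, hence zero almost everywhere by [bump_ae0]. It contains [fine (F p)] because the time
    integral [F] is finite only almost everywhere. *)
Lemma flow_formula_box u g a b :
  leb.-integrable setT (EFin \o u) -> leb.-integrable setT (EFin \o g) ->
  (forall m a' b' t, cbox a' b' `<=` cbox a b -> I t ->
    (\int[leb]_q (u q * hderive c (bump m a' b') (hflow c (- t) q))%:E =
     \int[leb]_q (- g q * bump m a' b' (hflow c (- t) q))%:E)%E) ->
  {ae leb, forall p, obox a b p ->
    mu1.-integrable I (fun t => (g (hflow c t p))%:E) /\
    u (hflow c e p) - u p = \int[mu1]_(t in I) g (hflow c t p)}.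
Proof.
move=> iu ig weak.
pose f (z : H * R) := (\1_I z.2 * g (hflow c z.2 z.1))%:E.
have if_ : (leb \x mu1)%E.-integrable setT f.
  rewrite (_ : f = (fun z : H * R => (\1_I z.2 * g (hflow c (1 * z.2) z.1) * 1)%:E)).
    by apply: (@integrable_flow2 _ _ c e e0 1 1 g (fun=> 1)) => // z; rewrite normr1.
  by apply/funext => z; rewrite mul1r mulr1.
pose F p := (\int[mu1]_t f (p, t))%E.
have iF : leb.-integrable setT F by exact: integrable_fubini_F if_.
have aef := ae_integrable1 if_.
have aeF := integrable_ae measurableT iF.
have mF : measurable_fun setT F by exact: measurable_int iF.
have iu' : leb.-integrable setT (fun p => (u (hflow c e p))%:E).
  exact: (integrable_hflow c e iu).
pose h p := u p - u (hflow c e p) + fine (F p).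
have ifF : leb.-integrable setT (EFin \o (fine \o F)).
  apply: (le_integrable measurableT _ _ iF).
    by apply/measurable_EFinP; exact: measurableT_comp.
  by move=> p _ /=; case: (F p) => [r| |] //=; rewrite ?normr0 ?leey.
have ih : leb.-integrable setT (EFin \o h).
  exact: (integrableD measurableT (integrableB measurableT iu iu') ifF).
have : {ae leb, forall p, obox a b p -> h p = 0}.
  apply: bump_ae0.
    by apply: (integrableS _ _ _ ih) => //; exact: measurable_obox.
  move=> m a' b' ab' oab'; set phi := bump m a' b'.
  transitivity (\int[leb]_p (h p * phi p)%:E)%E.
    rewrite integral_mkcond; apply: eq_integral => v _; rewrite patchE.
    case: ifPn => //; rewrite notin_setE => nv.
    have -> : phi v = 0 by apply/eqP/negPn/negP => /bump_obox /oab'.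
    by rewrite mulr0.
  have sphi : smooth phi by exact/smooth_exprN0/smooth_expr_bump.
  have mphi : measurable_fun setT phi by exact: measurable_bump.
  have phi1 p : `|phi p| <= 1 by rewrite ger0_norm ?bump_ge0 ?bump_le1.
  have iNg : leb.-integrable setT (EFin \o (fun p => - g p)).
    rewrite (_ : EFin \o _ = -%E \o (EFin \o g)); last by apply/funext.
    exact: integrableN.
  have dual := flow_duality e0 sphi (bounded_bump m a' b') (bounded_hderive_bump m a' b')
    iu iNg (fun t It => weak m a' b' t ab' It).
  have imul k : leb.-integrable setT (EFin \o k) -> leb.-integrable setT (fun p => (k p * phi p)%:E).
    move=> ik; apply: (le_integrable measurableT _ _ ik).
      apply/measurable_EFinP; apply: measurable_funM => //.
      by apply/measurable_EFinP; exact: measurable_int ik.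
    move=> p _; rewrite !abse_EFin lee_fin normrM ler_piMr //.
  have iA := imul _ (integrableB measurableT iu iu').
  have iB := imul _ ifF.
  have -> : (\int[leb]_p (h p * phi p)%:E = \int[leb]_p
      (((u p - u (hflow c e p)) * phi p)%:E + (fine (F p) * phi p)%:E))%E.
    by apply: eq_integral => p _; rewrite -EFinD -mulrDl.
  rewrite (integralD measurableT iA iB) dual.
  suff -> : (\int[leb]_p \int[mu1]_t (\1_I t * - g (hflow c t p) * phi p)%:E =
      \int[leb]_p (- (fine (F p) * phi p)%:E))%E.
    rewrite integralN; last exact: integrable_add_def iB.
    by rewrite addeC subee //; exact: integrable_fin_num iB.
  have if2 : (leb \x mu1)%E.-integrable setT (fun z : H * R =>
      (\1_I z.2 * - g (hflow c z.2 z.1) * phi z.1)%:E).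
    rewrite (_ : (fun z => _) = (fun z : H * R =>
        (\1_I z.2 * - g (hflow c (1 * z.2) z.1) * phi z.1)%:E)).
      exact: (@integrable_flow2 _ _ c e e0 1 1 (fun p => - g p) (fun z => phi z.1) iNg
        (measurableT_comp mphi measurable_fst) (fun z : H * R => phi1 z.1)).
    by apply/funext => z; rewrite mul1r.
  apply: ae_eq_integral => //.
  - exact: measurable_fubini_F if2.
  - apply: measurableT_comp => //; exact: measurable_int iB.
  - move: aef aeF; apply: filterS2 => p ifp Fp _.
    transitivity (\int[mu1]_t ((- phi p)%:E * f (p, t)))%E.
      by apply: eq_integral => t _; rewrite -EFinM; congr EFin; rewrite /f /=; ring.
    rewrite integralZl // -/(F p) -[in LHS](fineK (Fp Logic.I)) -EFinM.
    by congr EFin; ring.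
move=> h0.
have : {ae leb, forall p, mu1.-integrable setT (fun t => f (p, t)) /\ (obox a b p -> h p = 0)}.
  by move: aef h0; apply: filterS2 => p; split.
apply: filterS => p [ifp hp] /hp {}hp.
have iI : mu1.-integrable I (fun t => (g (hflow c t p))%:E).
  have ifI : mu1.-integrable I (fun t => f (p, t)).
    by apply: (integrableS _ _ _ ifp) => //.
  apply: eq_integrable ifI => // t tI.
  by rewrite /f /= indicE tI mul1r.
split => //.
have -> : \int[mu1]_(t in I) g (hflow c t p) = fine (F p).
  rewrite /Rintegral integral_mkcond; congr fine; apply: eq_integral => t _.
  by rewrite patchE /f /= indicE; case: ifPn; rewrite ?mul1r ?mul0r.
move: hp; rewrite /h; lra.
Qed.

Lemma compact_flow_image (K : set H) : compact K ->
  compact [set hflow c z.1 z.2 | z in I `*` K].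
Proof.
move=> cK; apply: (@continuous_compact _ _ (fun z : R * H => hflow c z.1 z.2)).
  by apply: continuous_subspaceT; exact: continuous_hflow2.
by apply: compact_setX => //; exact: segment_compact.
Qed.

(** [u] and [g] are only locally integrable, so they are cut off to the compact set [K] swept out by
    the box up to time [e]. A bump carried along by the flow is supported in [K], and the weak
    formulation does not see the cut. *)
Lemma flow_formula (Omega A : set H) u g : open Omega -> open A ->
  weak_along Omega c u g ->
  (forall t p, I t -> A p -> Omega (hflow c t p)) ->
  {ae leb, forall p, A p ->
    mu1.-integrable I (fun t => (g (hflow c t p))%:E) /\
    u (hflow c e p) - u p = \int[mu1]_(t in I) g (hflow c t p)}.
Proof.
move=> oO oA [[mu iu] [mg ig] weak] AO; apply: ae_boxes => // a b abA.
have mO : measurable Omega by exact: open_measurable_rV.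
pose K := [set hflow c z.1 z.2 | z in I `*` cbox a b].
have cK : compact K by apply: compact_flow_image; exact: compact_cbox.
have KO : K `<=` Omega by move=> _ [[t p] /= [It abp] <-]; apply: AO => //; exact: abA.
have mK := measurable_compact_rV cK.
have Kflow t p : I t -> cbox a b p -> K (hflow c t p).
  by move=> It abp; exists (t, p).
pose cut (h : H -> R) p := h p * \1_K p.
have cutE h p : K p -> cut h p = h p.
  by move=> Kp; rewrite /cut indicE mem_set // mulr1.
have icut h : leb.-integrable K (EFin \o h) -> leb.-integrable setT (EFin \o cut h).
  move=> ih; rewrite (_ : EFin \o cut h = (EFin \o h) \_ K).
    by apply/integrable_restrict => //; rewrite setTI.
  apply/funext => p; rewrite patchE /cut /= indicE.
  by case: ifPn; rewrite ?mulr1 ?mulr0.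
have H0 : forall m a' b' t, cbox a' b' `<=` cbox a b -> I t ->
    (\int[leb]_q (cut u q * hderive c (bump m a' b') (hflow c (- t) q))%:E =
     \int[leb]_q (- cut g q * bump m a' b' (hflow c (- t) q))%:E)%E.
  move=> m a' b' t ab' It; set phi := bump m a' b'.
  pose phit := phi \o hflow c (- t).
  have phiK q : ~ K q -> ~ tsupport phi (hflow c (- t) q).
    move=> nK /tsupport_bump/ab' abq; apply: nK.
    by rewrite -(hflowNK c t q); exact: Kflow.
  have tphit : test_function Omega phit.
    have sK : tsupport phit `<=` K.
      rewrite /tsupport closureE; apply: smallest_sub.
        by apply: compact_closed => //; exact: hausdorff_heis.
      move=> q /= phiq; apply: contrapT => /phiK; apply.
      exact: subset_closure.
    split; last exact: subset_trans sK KO.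
      apply: smooth_exprN0; apply: smooth_expr_comp; last exact: smooth_expr_bump.
        by move=> i; exact: smooth_expr_hflow.
      by [].
    by apply: subclosed_compact cK sK; exact: closed_closure.
  have it1 : leb.-integrable Omega (fun p => (u p * hderive c phit p)%:E).
    by apply: integrable_mul_test => //; exact: test_function_hderive.
  have it2 : leb.-integrable Omega (fun p => (g p * phit p)%:E).
    exact: integrable_mul_test.
  transitivity (\int[leb]_(p in Omega) (u p * hderive c phit p)%:E)%E.
    rewrite [RHS]integral_mkcond; apply: eq_integral => q _; rewrite patchE.
    have [Kq|nKq] := pselect (K q).
      by rewrite cutE // mem_set; [rewrite hderive_hflow|exact: KO].
    have -> : hderive c phi (hflow c (- t) q) = 0.
      apply/eqP/negPn/negP => hq; apply: (phiK _ nKq).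
      by apply: (@tsupport_hderive _ _ c); exact: subset_closure.
    rewrite mulr0; case: ifPn => // _; rewrite hderive_hflow.
    have -> : hderive c phi (hflow c (- t) q) = 0.
      apply/eqP/negPn/negP => hq; apply: (phiK _ nKq).
      by apply: (@tsupport_hderive _ _ c); exact: subset_closure.
    by rewrite mulr0.
  transitivity (- \int[leb]_(p in Omega) (g p * phit p)%:E)%E.
    rewrite -(fineK (integrable_fin_num mO it1)) -(fineK (integrable_fin_num mO it2)).
    by rewrite -EFinN; congr EFin; exact: weak.
  rewrite -integralN; last exact: integrable_add_def it2.
  rewrite integral_mkcond; apply: eq_integral => q _; rewrite patchE.
  have [Kq|nKq] := pselect (K q).
    by rewrite cutE // mem_set; [rewrite -EFinN mulNr|exact: KO].
  have -> : phi (hflow c (- t) q) = 0.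
    apply/eqP/negPn/negP => hq; apply: (phiK _ nKq); exact: subset_closure.
  rewrite mulr0 /phit /=; case: ifPn => // _.
  have -> : phi (hflow c (- t) q) = 0.
    apply/eqP/negPn/negP => hq; apply: (phiK _ nKq); exact: subset_closure.
  by rewrite mulr0 oppr0.
have := flow_formula_box (icut _ (iu _ cK KO)) (icut _ (ig _ cK KO)) H0.
apply: filterS => p Hp abp; have [i1 E1] := Hp abp.
have abp' := obox_cbox abp.
have It t : t \in I -> K (hflow c t p) by rewrite inE => It; exact: Kflow.
split.
  by apply: eq_integrable i1 => // t tI; rewrite cutE //; exact: It.
have Ie : I e by rewrite /= in_itv /= lexx ltW.
have I0 : I 0 by rewrite /= in_itv /= lexx ltW.
have Kp : K p by rewrite -(hflow0 c p); exact: Kflow.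
move: E1; rewrite (cutE u p Kp) (cutE u _ (Kflow _ _ Ie abp')) => ->.
by apply: eq_Rintegral => t tI; rewrite cutE //; exact: It.
Qed.

End flow_formula_ae.

(** * Norm inequalities and continuity of translations *)

Section integral_inequalities.
Context {R : realType} {n : nat}.
Notation H := (heis R n).
Notation mu1 := (@lebesgue_measure R).
Local Open Scope ereal_scope.

Lemma measurable_normr_powR d (T : measurableType d) (D : set T) (f : T -> R) (s : R) :
  measurable_fun D f -> measurable_fun D (fun x => (`|f x| `^ s)%R).
Proof.
move=> mf; apply: (@measurableT_comp _ _ _ _ _ _ (fun x : R => (x `^ s)%R)).
  exact: measurable_powR.
exact: measurableT_comp.
Qed.

Lemma lee_poweR2 (s : R) (x y : \bar R) : (0 < s)%R -> 0 <= x -> 0 <= y ->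
  x `^ s <= y `^ s -> x <= y.
Proof.
move=> s0 x0 y0 xy; rewrite -(poweRe1 x0) -(poweRe1 y0) -(mulfV (lt0r_neq0 s0)).
rewrite !poweRrM; apply: gt0_ler_poweR => //; last 2 first.
- by rewrite in_itv /= poweR_ge0 leey.
- by rewrite in_itv /= poweR_ge0 leey.
by rewrite invr_ge0 ltW.
Qed.

Lemma lee_poweR (s : R) (x y : \bar R) : (0 <= s)%R -> 0 <= x ->
  x <= y -> x `^ s <= y `^ s.
Proof.
move=> s0 x0 xy; apply: gt0_ler_poweR => //; rewrite in_itv /= leey ?andbT //.
exact: le_trans xy.
Qed.

Lemma Lsnorm_pow (s : R) (A : set H) (u : H -> R) : (0 < s)%R ->
  Lsnorm s A u `^ s = \int[leb]_(p in A) (`|u p| `^ s)%:E.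
Proof.
move=> s0; rewrite /Lsnorm poweR_Lnorm ?gt_eqF // [RHS]integral_mkcond.
apply: eq_integral => p _; rewrite !patchE; case: ifPn => // _.
by rewrite /= normr0 powR0 // gt_eqF.
Qed.

Lemma Lsnorm_ge0 (s : R) (A : set H) (u : H -> R) : 0 <= Lsnorm s A u.
Proof. exact: Lnorm_ge0. Qed.

Lemma lebesgue_measure_itv0 (e : R) : (0 < e)%R -> mu1 `[0%R, e]%classic = e%:E.
Proof. by move=> e0; rewrite lebesgue_measure_itv /= lte_fin e0 sube0. Qed.

(** Hölder's inequality against the indicator of the interval, whose norm for the conjugate exponent
    [q = s / (s - 1)] is [e ^ (1/q)]; its power [s] is [e ^ (s - 1)]. The case [s = 1], where [q]
    would be infinite, is treated apart. *)
Lemma jensen_itv (e s : R) (G : R -> R) : (0 < e)%R -> (1 <= s)%R ->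
  mu1.-integrable `[0%R, e] (EFin \o G) ->
  (`|\int[mu1]_(t in `[0%R, e]) G t|%R `^ s)%:E <=
  (e `^ (s - 1))%:E * \int[mu1]_(t in `[0%R, e]) (`|G t| `^ s)%:E.
Proof.
move=> e0 s1 iG; have s0 : (0 < s)%R by exact: lt_le_trans s1.
set I := `[0%R, e]%classic; have mI : measurable (I : set (measurableTypeR R)) by exact: measurable_itv.
have mG : measurable_fun I G by apply/measurable_EFinP; exact: measurable_int iG.
have le1 : (`|\int[mu1]_(t in I) G t|%R)%:E <= \int[mu1]_(t in I) `|(G t)%:E|.
  have := le_normr_Rintegral mI iG; rewrite -lee_fin => /le_trans; apply.
  rewrite /Rintegral fineK //.
  exact: (integrable_fin_num mI (integrable_abse iG)).
have [s1E|s_gt1] := eqVneq s 1%R.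
  rewrite s1E subrr powRr0 mul1e powRr1 //.
  by under eq_integral do rewrite powRr1 //.
have {}s1 : (1 < s)%R by rewrite lt_neqAle eq_sym s_gt1.
have s10 : (0 < s - 1)%R by rewrite subr_gt0.
pose q : R := (s / (s - 1))%R.
have q0 : (0 < q)%R by rewrite divr_gt0.
pose f : R -> R := (G \_ I).
have mf : measurable_fun setT f by apply/(measurable_restrictT _ mI).
have m1 : measurable_fun setT (\1_I : R -> R) by exact: measurable_indic.
have sq : (s^-1 + q^-1 = 1)%R by rewrite /q invf_div mulrBl divff ?gt_eqF // div1r subrKC.
have := hoelder mu1 mf m1 s0 q0 sq; rewrite Lnorm1.
have -> : \int[mu1]_x `|(EFin \o (f \* \1_I)%R) x| = \int[mu1]_(t in I) `|(G t)%:E|.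
  rewrite [RHS]integral_mkcond; apply: eq_integral => t _.
  rewrite patchE /= /f patchE indicE; case: ifPn => _; first by rewrite mulr1.
  by rewrite mulr0 normr0.
move=> hold; apply: (@le_trans _ _ (('N[mu1]_s%:E[EFin \o f] * 'N[mu1]_q%:E[EFin \o \1_I]) `^ s)).
  rewrite -poweR_EFin; apply: lee_poweR; first exact: ltW.
    by rewrite lee_fin.
  exact: le_trans hold.
rewrite poweRM ?Lnorm_ge0 // poweR_Lnorm ?gt_eqF // muleC.
have -> : 'N[mu1]_q%:E[EFin \o \1_I] = (e `^ q^-1)%:E.
  rewrite unlock /Lnorm -poweR_EFin; congr (_ `^ _).
  transitivity (\int[mu1]_(t in I) cst 1 t).
    rewrite [RHS]integral_mkcond; apply: eq_integral => t _.
    rewrite patchE /= indicE; case: ifPn => _; first by rewrite normr1 powR1.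
    by rewrite normr0 powR0 // gt_eqF.
  by rewrite integral_cst // mul1e; exact: lebesgue_measure_itv0.
rewrite poweR_EFin -powRrM (_ : (q^-1 * s = s - 1)%R); last first.
  by rewrite /q invf_div divfK // gt_eqF.
apply: lee_wpmul2l; first by rewrite lee_fin powR_ge0.
rewrite [leRHS]integral_mkcond le_eqVlt; apply/orP; left; apply/eqP.
apply: eq_integral => t _; rewrite patchE /= /f patchE; case: ifPn => // _.
by rewrite normr0 powR0 // gt_eqF.
Qed.

(* Minkowski's integral inequality, with the supremum of the norms of the
   slices in place of their integral. *)
Lemma Lsnorm_integral_le (e s : R) (A : set H) (G : H * R -> R) (D : H -> R) (M : \bar R) :
  (0 < e)%R -> (1 <= s)%R -> measurable A -> 0 <= M ->
  measurable_fun setT G -> measurable_fun A D ->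
  {ae leb, forall p, A p -> mu1.-integrable `[0%R, e] (fun t => (G (p, t))%:E) /\
    D p = (\int[mu1]_(t in `[0%R, e]) G (p, t))%R} ->
  (forall t, `[0%R, e]%classic t -> Lsnorm s A (fun p => G (p, t)) <= M) ->
  Lsnorm s A D <= e%:E * M.
Proof.
move=> e0 s1 mA M0 mG mD DG GM; have s0 : (0 < s)%R by exact: lt_le_trans s1.
set I := `[0%R, e]%classic; have mI : measurable (I : set (measurableTypeR R)) by exact: measurable_itv.
apply: (@lee_poweR2 s) => //; first exact: Lsnorm_ge0.
  by rewrite mule_ge0 // lee_fin ltW.
have e0' : 0 <= e%:E by rewrite lee_fin ltW.
rewrite Lsnorm_pow // poweRM //.
(* The indicators turn integrals over [A] and the interval into integrals over the whole product, to
   which Tonelli's theorem is applied. *)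
pose K (z : H * R) : \bar R := (\1_A z.1 * \1_I z.2 * `|G z| `^ s)%:E.
have K0 z : 0 <= K z.
  by rewrite lee_fin !mulr_ge0 // ?powR_ge0 // indicE.
have mK : measurable_fun setT K.
  apply/measurable_EFinP; apply: measurable_funM; last first.
    by apply: measurable_normr_powR.
  apply: measurable_funM.
    by apply: (@measurableT_comp _ _ _ _ _ _ (\1_A : H -> R) _ fst) => //; exact: measurable_indic.
  by apply: (@measurableT_comp _ _ _ _ _ _ (\1_I : R -> R) _ snd) => //; exact: measurable_indic.
have KI p : A p -> \int[mu1]_t K (p, t) = \int[mu1]_(t in I) (`|G (p, t)| `^ s)%:E.
  move=> Ap; rewrite [RHS]integral_mkcond; apply: eq_integral => t _.
  rewrite patchE /K /= indicE mem_set // mul1r indicE.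
  by case: ifPn => _; rewrite ?mul1r ?mul0r.
have KA t : I t -> \int[leb]_p K (p, t) = \int[leb]_(p in A) (`|G (p, t)| `^ s)%:E.
  move=> It; rewrite [RHS]integral_mkcond; apply: eq_integral => p _.
  rewrite patchE /K /= [in \1_I _]indicE mem_set // mulr1 indicE.
  by case: ifPn => _; rewrite ?mul1r ?mul0r.
have mKF : measurable_fun A (fun p => \int[mu1]_t K (p, t)).
  by apply: measurable_funTS; exact: measurable_fun_fubini_tonelli_F.
apply: (@le_trans _ _ (\int[leb]_(p in A) ((e `^ (s - 1))%:E * \int[mu1]_t K (p, t)))).
  apply: ae_ge0_le_integral => //.
  - by apply/measurable_EFinP; exact: measurable_normr_powR.
  - by move=> p _; rewrite mule_ge0 ?lee_fin ?powR_ge0 // integral_ge0.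
  - exact: measurable_funeM.
  - apply: filterS DG => p H0 Ap; have [iG ->] := H0 Ap.
    by rewrite KI //; exact: jensen_itv.
rewrite ge0_integralZl // ?lee_fin ?powR_ge0 //; last first.
  by move=> p _; exact: integral_ge0.
have -> : \int[leb]_(p in A) \int[mu1]_t K (p, t) = \int[leb]_p \int[mu1]_t K (p, t).
  rewrite integral_mkcond; apply: eq_integral => p _; rewrite patchE.
  case: ifPn => // pA; rewrite integral0_eq // => t _.
  by rewrite /K /= indicE (negbTE pA) !mul0r.
rewrite fubini_tonelli //.
have -> : \int[mu1]_t \int[leb]_p K (p, t) = \int[mu1]_(t in I) \int[leb]_p K (p, t).
  rewrite [RHS]integral_mkcond; apply: eq_integral => t _; rewrite patchE.
  case: ifPn => // tI; rewrite integral0_eq // => p _.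
  by rewrite /K /= [in \1_I _]indicE (negbTE tI) mulr0 mul0r.
apply: (@le_trans _ _ ((e `^ (s - 1))%:E * \int[mu1]_(t in I) cst (M `^ s) t)).
  apply: lee_wpmul2l; first by rewrite lee_fin powR_ge0.
  apply: ge0_le_integral => //.
  - by move=> t _; exact: integral_ge0.
  - by apply: measurable_funTS; exact: (measurable_fun_fubini_tonelli_G K).
  - move=> t It; rewrite KA // -Lsnorm_pow //.
    by apply: lee_poweR; [exact: ltW|exact: Lsnorm_ge0|exact: GM].
have -> : \int[mu1]_(t in I) cst (M `^ s) t = M `^ s * e%:E.
  by rewrite integral_cst //; congr (_ * _); exact: lebesgue_measure_itv0.
(* The factor [e ^ (s - 1)] of Jensen's inequality and the length [e] of the interval recombine to
   [e ^ s]. *)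
rewrite muleCA -EFinM muleC poweR_EFin mulrC.
by rewrite -(mulr_powRB1 (ltW e0) s0).
Qed.

End integral_inequalities.

Section Ls_norms.
Context {R : realType} {n : nat}.
Notation H := (heis R n).
Implicit Types (p q c w a b : H) (u g f : H -> R) (A B : set H).
Variable s : R.
Hypothesis s1 : 1 <= s.

Let s0 : 0 < s. Proof. exact: lt_le_trans s1. Qed.

Lemma LsnormD A u g : measurable A -> measurable_fun A u -> measurable_fun A g ->
  (Lsnorm s A (fun p => (u p + g p)%R) <= Lsnorm s A u + Lsnorm s A g)%E.
Proof.
move=> mA mu mg; rewrite /Lsnorm.
have E f : (EFin \o f) \_ A = EFin \o (f \_ A).
  by apply/funext => p; rewrite /= !patchE; case: ifP.
rewrite !E; have -> : (fun p => u p + g p) \_ A = (u \_ A \+ g \_ A)%R.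
  by apply/funext => p; rewrite /= !patchE; case: ifP; rewrite ?addr0.
by apply: minkowski_EFin => //; apply/(measurable_restrictT _ mA).
Qed.

Lemma eq_Lsnorm A u g : (forall p, A p -> u p = g p) -> Lsnorm s A u = Lsnorm s A g.
Proof.
move=> ug; rewrite /Lsnorm; congr Lnorm; apply/funext => p; rewrite !patchE.
by case: ifPn => //; rewrite inE => Ap; rewrite /= ug.
Qed.

Lemma le_Lsnorm A u g : measurable A -> measurable_fun A u -> measurable_fun A g ->
  (forall p, A p -> `|u p| <= `|g p|) -> (Lsnorm s A u <= Lsnorm s A g)%E.
Proof.
move=> mA mu mg ug; apply: (@lee_poweR2 _ s) => //; try exact: Lsnorm_ge0.
rewrite (Lsnorm_pow A u s0) (Lsnorm_pow A g s0); apply: ge0_le_integral => //.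
- by apply/measurable_EFinP; exact: measurable_normr_powR.
- by apply/measurable_EFinP; exact: measurable_normr_powR.
- move=> p Ap; rewrite lee_fin; apply: ge0_ler_powR; rewrite ?nnegrE //.
    exact: ltW.
  exact: ug.
Qed.

Lemma Lsnorm_subset A B u : measurable A -> measurable B -> measurable_fun B u ->
  A `<=` B -> (Lsnorm s A u <= Lsnorm s B u)%E.
Proof.
move=> mA mB mu AB; apply: (@lee_poweR2 _ s) => //; try exact: Lsnorm_ge0.
rewrite (Lsnorm_pow A u s0) (Lsnorm_pow B u s0); apply: ge0_subset_integral => //.
by apply/measurable_EFinP; exact: measurable_normr_powR.
Qed.

Lemma LsnormZ A (r : R) u : measurable A -> measurable_fun A u ->
  Lsnorm s A (fun p => r * u p) = (`|r|%:E * Lsnorm s A u)%E.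
Proof.
move=> mA mu.
have E : (Lsnorm s A (fun p => (r * u p)%R) `^ s = (`|r|%:E * Lsnorm s A u) `^ s)%E.
  rewrite poweRM ?lee_fin ?Lsnorm_ge0 // (Lsnorm_pow A _ s0) (Lsnorm_pow A _ s0) poweR_EFin.
  rewrite -ge0_integralZl ?lee_fin ?powR_ge0 //; last first.
    by apply/measurable_EFinP; exact: measurable_normr_powR.
  by apply: eq_integral => p _; rewrite -EFinM normrM powRM.
apply/eqP; rewrite eq_le; apply/andP; split; apply: (@lee_poweR2 _ s) => //;
  rewrite ?E ?Lsnorm_ge0 // mule_ge0 ?lee_fin ?Lsnorm_ge0 //.
Qed.

Lemma Lsnorm_hflow c t u : measurable_fun setT u ->
  Lsnorm s setT (u \o hflow c t) = Lsnorm s setT u.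
Proof.
move=> mu.
have E : (Lsnorm s setT (u \o hflow c t) `^ s = Lsnorm s setT u `^ s)%E.
  rewrite (Lsnorm_pow setT _ s0) (Lsnorm_pow setT _ s0).
  rewrite -[RHS](ge0_integral_hflow c t (h := fun p => (`|u p| `^ s)%:E)) //.
  by apply/measurable_EFinP; exact: measurable_normr_powR.
by apply/eqP; rewrite eq_le; apply/andP; split; apply: (@lee_poweR2 _ s) => //;
  rewrite ?E // Lsnorm_ge0.
Qed.

Lemma Lsnorm_indic A u : Lsnorm s A u = Lsnorm s setT (fun p => u p * \1_A p).
Proof.
rewrite /Lsnorm; congr Lnorm; apply/funext => p; rewrite !patchE in_setT /= indicE.
by case: ifPn; rewrite /= ?mulr1 ?mulr0.
Qed.

Lemma Lsnorm_image c t A u : measurable A -> measurable_fun setT u ->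
  Lsnorm s A (u \o hflow c t) = Lsnorm s (hflow c (- t) @^-1` A) u.
Proof.
move=> mA mu; have mA' : measurable (hflow c (- t) @^-1` A).
  by rewrite -[X in measurable X]setTI; exact: measurable_hflow.
rewrite Lsnorm_indic [RHS]Lsnorm_indic -[RHS](Lsnorm_hflow c t); last first.
  by apply: measurable_funM => //; exact: measurable_indic.
apply: eq_Lsnorm => p _ /=; congr (_ * _); rewrite !indicE; congr (_%:R).
by congr asbool; rewrite /preimage /= hflowK.
Qed.

Lemma in_Ls_pow A u : measurable_fun A u ->
  (Lsnorm s A u < +oo <-> \int[leb]_(p in A) (`|u p| `^ s)%:E < +oo)%E.
Proof.
move=> mu; rewrite -Lsnorm_pow //; split; first exact: poweR_lty.
by apply: lty_poweRy; rewrite gt_eqF.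
Qed.

(** As [s >= 1], [|x| ^ s <= |x|] once [|x| <= 1]. *)
Lemma cvg_normr_powR (x_ : nat -> R) : x_ m @[m --> \oo] --> 0 ->
  `|x_ m| `^ s @[m --> \oo] --> (0 : R).
Proof.
move=> x0; have nx0 : `|x_ m| @[m --> \oo] --> (0 : R) by apply/norm_cvg0P.
apply: (@squeeze_cvgr _ _ _ _ (fun=> 0) (fun m => `|x_ m|)) => //; last exact: cvg_cst.
have : \forall m \near \oo, `|x_ m| <= 1.
  by move/cvgr0Pnorm_le : x0; apply.
apply: filterS => m xm; rewrite powR_ge0 /=.
have [->|x0'] := eqVneq (x_ m) 0; first by rewrite normr0 powR0 // gt_eqF.
by apply: ge1r_powR => //; rewrite normr_gt0 x0'.
Qed.

Lemma Lsnorm_dct (f_ : nat -> H -> R) f g :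
  (forall m, measurable_fun setT (f_ m)) -> measurable_fun setT f ->
  measurable_fun setT g -> (Lsnorm s setT g < +oo)%E ->
  (forall p, f_ m p @[m --> \oo] --> f p) ->
  (forall m p, `|f_ m p| <= g p) -> (forall p, `|f p| <= g p) ->
  forall e : R, 0 < e -> exists m, (Lsnorm s setT (fun p => (f p - f_ m p)%R) <= e%:E)%E.
Proof.
move=> mf_ mf mg /(in_Ls_pow mg) ig cvg_f fg_ fg e e0.
have mF m : measurable_fun setT (fun p => (`|f p - f_ m p| `^ s)%:E).
  by apply/measurable_EFinP; apply: measurable_normr_powR; exact: measurable_funB.
have g0 p : 0 <= g p by apply: le_trans (fg p).
have [] := @dominated_convergence _ _ _ leb setT measurableT
    (fun m p => (`|f p - f_ m p| `^ s)%:E) (cst 0%E) (fun p => ((2 * g p) `^ s)%:E) mF.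
- exact: measurable_cst.
- apply: aeW => p _; apply: cvg_EFin; first by near=> m.
  apply: cvg_normr_powR; rewrite -(subrr (f p)); apply: cvgB => //; exact: cvg_cst.
- apply/integrableP; split.
    apply/measurable_EFinP; apply: (@measurableT_comp _ _ _ _ _ _ (fun x : R => x `^ s)).
      exact: measurable_powR.
    exact: measurable_funM.
  rewrite (_ : (\int[leb]_p _ = \int[leb]_p ((2 `^ s)%:E * (`|g p| `^ s)%:E))%E); last first.
    apply: eq_integral => p _.
    by rewrite abse_EFin ger0_norm ?powR_ge0 // powRM // -EFinM ger0_norm.
  rewrite ge0_integralZl ?lee_fin ?powR_ge0 //; last first.
    by apply/measurable_EFinP; exact: measurable_normr_powR.
  apply: lte_mul_pinfty => //; rewrite ?lee_fin ?powR_ge0 //.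
- apply: aeW => p m _; rewrite abse_EFin ger0_norm ?powR_ge0 // lee_fin.
  apply: ge0_ler_powR; rewrite ?nnegrE ?mulr_ge0 //; first exact: ltW.
  by rewrite mulr2n mulrDl mul1r (le_trans (ler_normB _ _)) // lerD.
move=> _ _; rewrite integral0 => cvg0.
have es0 : (0 < (e `^ s)%:E)%E by rewrite lte_fin powR_gt0.
have [m _ /(_ m (leqnn m)) Em] := cvg0 _ (open_ereal_lt' es0).
exists m; apply: (@lee_poweR2 _ s) => //; first exact: Lsnorm_ge0.
  by rewrite lee_fin ltW.
by rewrite (Lsnorm_pow setT _ s0) poweR_EFin; exact: ltW.
Unshelve. all: by end_near. Qed.
End Ls_norms.

Lemma ler_coord_norm {R : realType} k (v : 'rV[R]_k) i : `|v 0 i| <= `|v|.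
Proof.
rewrite [leRHS]mx_normrE.
exact: (le_bigmax_cond _ (fun ij : 'I_1 * 'I_k => `|v ij.1 ij.2|) (j := (0, i))).
Qed.

(** * Continuity in [L^s] of translation along a flow *)

Section translation_continuity.
Context {R : realType} {n : nat}.
Notation H := (heis R n).
Implicit Types (p q c w a b : H) (u g f h : H -> R) (A B E : set H).
Variables (s : R) (c : H).
Hypothesis s1 : 1 <= s.
Local Opaque derive hderive.

Let s0 : 0 < s. Proof. exact: lt_le_trans s1. Qed.

(** The class is closed under linear combinations and limits in [L^s]. It is climbed from bumps to
    boxes, to measurable subsets of boxes, to simple functions, and so to all of [L^s]. *)
Definition Ls_continuous u : Prop := measurable_fun setT u /\
  forall e : R, 0 < e -> exists2 d : R, 0 < d & forall t : R, `|t| < d ->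
    (Lsnorm s setT (fun p => (u (hflow c t p) - u p)%R) <= e%:E)%E.

Let measurable_comp_hflow u t : measurable_fun setT u ->
  measurable_fun setT (fun p => u (hflow c t p)).
Proof. by move=> mu; apply: measurableT_comp => //; exact: measurable_hflow. Qed.

Lemma Ls_continuousD u g : Ls_continuous u -> Ls_continuous g ->
  Ls_continuous (fun p => u p + g p).
Proof.
move=> [mu cu] [mg cg]; split; first exact: measurable_funD.
move=> e e0; have e20 : 0 < e / 2 by rewrite divr_gt0.
have [d1 d10 H1] := cu _ e20; have [d2 d20 H2] := cg _ e20.
exists (Num.min d1 d2); first by rewrite lt_min d10.
move=> t; rewrite lt_min => /andP[t1 t2].
have -> : (fun p => u (hflow c t p) + g (hflow c t p) - (u p + g p)) =
  (fun p => (u (hflow c t p) - u p) + (g (hflow c t p) - g p)).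
  by apply/funext => p; ring.
apply: le_trans (LsnormD s1 _ _ _) _ => //.
- by apply: measurable_funB => //; exact: measurable_comp_hflow.
- by apply: measurable_funB => //; exact: measurable_comp_hflow.
by rewrite [e in leRHS]splitr EFinD leeD ?H1 ?H2.
Qed.

Lemma Ls_continuousZ (r : R) u : Ls_continuous u -> Ls_continuous (fun p => r * u p).
Proof.
move=> [mu cu]; split; first exact: measurable_funM.
move=> e e0; have r0 : 0 < `|r| + 1 by rewrite ltr_wpDl.
have [d d0 Hd] := cu (e / (`|r| + 1)) (divr_gt0 e0 r0).
exists d => // t td; under [X in Lsnorm s setT X]eq_fun do rewrite -mulrBr.
rewrite LsnormZ //; last by apply: measurable_funB => //; exact: measurable_comp_hflow.
apply: le_trans (lee_wpmul2l _ (Hd t td)) _; first by rewrite lee_fin.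
rewrite -EFinM lee_fin mulrCA ler_piMr //; first exact: ltW.
by rewrite ler_pdivrMr // mul1r lerDl.
Qed.

Lemma Ls_continuous0 : Ls_continuous (fun=> 0).
Proof.
split; first exact: measurable_cst.
move=> e e0; exists 1 => // t _; rewrite subrr.
rewrite (_ : (fun=> 0) = (fun p => 0 * (0 : R))); last by apply/funext => p; rewrite mulr0.
by rewrite LsnormZ // normr0 mul0e lee_fin ltW.
Qed.

Lemma Ls_continuous_sum (I : Type) (r : seq I) (u_ : I -> H -> R) :
  (forall i, Ls_continuous (u_ i)) -> Ls_continuous (fun p => \sum_(i <- r) u_ i p).
Proof.
move=> cu; elim: r => [|i r IH].
  by under eq_fun do rewrite big_nil; exact: Ls_continuous0.
by under eq_fun do rewrite big_cons; exact: Ls_continuousD.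
Qed.

(** The flow is an isometry of [L^s], so replacing [u] by [h] costs the same third of [e] before and
    after the translation. *)
Lemma Ls_continuous_approx u : measurable_fun setT u ->
  (forall e : R, 0 < e -> exists2 h, Ls_continuous h &
    (Lsnorm s setT (fun p => (u p - h p)%R) <= e%:E)%E) ->
  Ls_continuous u.
Proof.
move=> mu Hu; split => // e e0; have e30 : 0 < e / 3 by rewrite divr_gt0.
have [h [mh ch] uh] := Hu _ e30; have [d d0 Hd] := ch _ e30.
exists d => // t td.
have muh : measurable_fun setT (fun p => u p - h p) by exact: measurable_funB.
have -> : (fun p => u (hflow c t p) - u p) = (fun p =>
    ((u (hflow c t p) - h (hflow c t p)) + (h (hflow c t p) - h p))
    + (-1) * (u p - h p)).
  by apply/funext => p; ring.
have m1 := measurable_comp_hflow t muh.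
have m2 : measurable_fun setT (fun p => h (hflow c t p) - h p).
  by apply: measurable_funB => //; exact: measurable_comp_hflow.
apply: le_trans (LsnormD s1 _ _ _) _ => //; first exact: measurable_funD.
  exact: measurable_funM.
rewrite LsnormZ // normrN1 mul1e.
have -> : e = e / 3 + e / 3 + e / 3 by field.
rewrite 2!EFinD leeD //; apply: le_trans (LsnormD s1 _ _ _) _ => //.
by rewrite leeD ?Hd // (Lsnorm_hflow s1 c t muh).
Qed.

Lemma lipschitz_hflow u M t p : smooth u -> (forall p, `|hderive c u p| <= M) ->
  `|u (hflow c t p) - u p| <= `|t| * M.
Proof.
move=> su uM.
(* For a negative time the two endpoints exchange roles. *)
wlog t0 : t p / 0 <= t.
  move=> wl; have [t0|t0] := leP 0 t; first exact: wl.
  have := wl (- t) (hflow c t p); rewrite oppr_ge0 normrN hflowK distrC; apply.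
  exact: ltW.
have D r : is_derive r (1 : R) (fun r => u (p + r *: hfield c p)) ('D_(hfield c p) u (p + r *: hfield c p)).
  by apply: is_derive_line; exact: smooth_differentiable.
have [|r _ E] := @MVT_segment R _ _ 0 t t0 (fun r _ => D r).
  apply: continuous_subspaceT => r; apply/differentiable_continuous/derivable1_diffP.
  exact: (@ex_derive _ _ _ _ _ _ _ (D r)).
move: E; rewrite scale0r addr0 subr0 /hflow => ->.
rewrite normrM mulrC ler_wpM2l //.
by have := uM (hflow c r p); rewrite hderive_at_hflow.
Qed.

Lemma Ls_finite_cbox a b : (Lsnorm s setT (\1_(cbox a b) : H -> R) < +oo)%E.
Proof.
have mB := measurable_cbox a b.
have mI : measurable_fun setT (\1_(cbox a b) : H -> R) by exact: measurable_indic.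
apply/(in_Ls_pow s1 mI).
have -> : (\int[leb]_p (`|\1_(cbox a b) p : R| `^ s)%:E = leb (cbox a b))%E.
  rewrite -[cbox a b]setIT -(integral_indic leb measurableT mB) setIT; apply: eq_integral => p _.
  by rewrite indicE; case: (_ \in _); rewrite ?normr1 ?powR1 // normr0 powR0 // gt_eqF.
have [ab|ab] := pselect (forall i, a 0 i <= b 0 i).
  rewrite (_ : cbox a b = [set v | forall i, v 0 i \in `[a 0 i, b 0 i]]).
    by rewrite lebesgue_rV_box // ltry.
  by apply/seteqP; split => v /= H i; have := H i; rewrite in_itv.
rewrite (_ : cbox a b = set0) ?measure0 // -subset0 => v abv; apply: ab => i.
by have /andP[+ vb] := abv i; move=> /le_trans; apply.
Qed.

Lemma Ls_continuous_bump m a b : Ls_continuous (bump m a b).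
Proof.
set phi := bump m a b.
have mphi : measurable_fun setT phi by exact: measurable_bump.
have [sphi cs _] : test_function setT phi by exact: test_function_bump.
have [M M0 HM] : exists2 M : R, 0 <= M & forall p, `|hderive c phi p| <= M.
  have [sd cd _] : test_function setT (hderive c phi).
    by apply: test_function_hderive; exact: test_function_bump.
  exact: bounded_supported (smooth_continuous sd) cd.
have [a' [b' sub]] : exists a' b' : H, forall t p, `|t| <= 1 ->
    cbox a b (hflow c t p) -> cbox a' b' p.
  (* [compact_flow_image] covers nonnegative times only: the box is moved back by time 1, then
     forward by [1 - t], which lies in [0, 2]. *)
  have cK0 : compact (hflow c (-1) @` cbox a b).
    apply: continuous_compact; last exact: compact_cbox.
    by apply: continuous_subspaceT; exact: continuous_hflow.
  have [N [Nr HN]] := compact_bounded (@compact_flow_image _ _ c 2 _ cK0).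
  exists (const_mx (- (N + 1))), (const_mx (N + 1)) => t p t1 tp i.
  rewrite !mxE -ler_norml; apply: le_trans (ler_coord_norm p i) _.
  apply: HN; first by rewrite ltrDl.
  exists (1 - t, hflow c (-1) (hflow c t p)) => /=.
    split; last by exists (hflow c t p).
    by rewrite /= in_itv /=; move: t1; rewrite ler_norml; lra.
  by rewrite !hflowD (_ : _ + _ = 0) ?hflow0 //; ring.
have [L HL] : exists L : R, (Lsnorm s setT (\1_(cbox a' b') : H -> R) = L%:E)%E.
  have := Ls_finite_cbox a' b'; have := Lsnorm_ge0 s setT (\1_(cbox a' b') : H -> R).
  by case: (Lsnorm _ _ _) => // r _ _; exists r.
have L0 : 0 <= L by rewrite -lee_fin -HL Lsnorm_ge0.
split => // e e0; have C0 : 0 < M * L + 1 by rewrite ltr_wpDl // mulr_ge0.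
(* The bound 1 keeps the moved supports in the common box [cbox a' b']; there the increment is at
   most [|t| * M], with norm at most [|t| * M * L]. *)
exists (Num.min 1 (e / (M * L + 1))); first by rewrite lt_min ltr01 divr_gt0.
move=> t; rewrite lt_min => /andP[/ltW t1 te].
apply: (@le_trans _ _ (Lsnorm s setT (fun p => (`|t| * M * \1_(cbox a' b') p)%R))%E).
  apply: le_Lsnorm => //.
  - by apply: measurable_funB => //; exact: measurable_comp_hflow.
  - by apply: measurable_funM => //; apply: measurable_indic; exact: measurable_cbox.
  move=> p _; rewrite [leRHS]ger0_norm ?mulr_ge0 //.
  have [p0|] := eqVneq (phi (hflow c t p) - phi p) 0.
    by rewrite p0 normr0 !mulr_ge0.
  move=> pn0; rewrite indicE mem_set ?mulr1; first exact: lipschitz_hflow.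
  have [z|nz] := eqVneq (phi (hflow c t p)) 0.
    apply: (sub 0 p); first by rewrite normr0.
    rewrite hflow0; apply/obox_cbox/(@bump_obox _ _ m).
    by apply: contra_neq pn0; rewrite -/phi z => ->; rewrite subrr.
  by apply: (sub t p) => //; apply/obox_cbox/(@bump_obox _ _ m).
rewrite LsnormZ //; last by apply: measurable_indic; exact: measurable_cbox.
rewrite HL -EFinM lee_fin ger0_norm ?mulr_ge0 //.
move: te; rewrite ltr_pdivlMr // mulrDr mulr1 mulrA => /ltW; apply: le_trans.
by rewrite lerDl.
Qed.

Lemma Ls_continuous_dct (f_ : nat -> H -> R) f g :
  (forall m, Ls_continuous (f_ m)) -> measurable_fun setT f ->
  measurable_fun setT g -> (Lsnorm s setT g < +oo)%E ->
  (forall p, f_ m p @[m --> \oo] --> f p) ->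
  (forall m p, `|f_ m p| <= g p) -> (forall p, `|f p| <= g p) ->
  Ls_continuous f.
Proof.
move=> cf_ mf mg gs f_f f_g fg; apply: Ls_continuous_approx => // e e0.
have [|m Hm] := Lsnorm_dct s1 _ mf mg gs f_f f_g fg e0.
  by move=> m; exact: (cf_ m).1.
by exists (f_ m).
Qed.

Lemma Ls_continuous_obox a b : Ls_continuous (\1_(obox a b) : H -> R).
Proof.
have mo := measurable_obox a b; have mc := measurable_cbox a b.
apply: (@Ls_continuous_dct (fun m => bump m a b) _ (\1_(cbox a b))).
- by move=> m; exact: Ls_continuous_bump.
- exact: measurable_indic.
- exact: measurable_indic.
- exact: Ls_finite_cbox.
- by move=> p; exact: bump_cvg.
- move=> m p; rewrite ger0_norm ?bump_ge0 //.
  have [->|/bump_obox/obox_cbox pc] := eqVneq (bump m a b p) 0; first by rewrite indicE.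
  by rewrite indicE mem_set // bump_le1.
- move=> p; rewrite ger0_norm ?indicE //.
  have [/set_mem/obox_cbox pc|_] := boolP (p \in obox a b) => //.
  by rewrite mem_set.
Qed.

(** Intersecting with a fixed box keeps every indicator under one majorant in [L^s], so that
    complements and countable disjoint unions, the closure properties of Dynkin's lemma, stay within
    the class. *)
Lemma Ls_continuous_indicI a b E : measurable E ->
  Ls_continuous (\1_(E `&` obox a b) : H -> R).
Proof.
have mo := measurable_obox a b.
have oc : (Lsnorm s setT (\1_(obox a b) : H -> R) < +oo)%E.
  apply: le_lt_trans (Ls_finite_cbox a b); apply: le_Lsnorm => //.
    by apply: measurable_indic; exact: measurable_cbox.
  move=> p _; rewrite !indicE.
  have [/set_mem/obox_cbox pc|_] := boolP (p \in obox a b); last by rewrite normr0.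
  by rewrite mem_set.
move: E; apply: rV_dynkin.
- by rewrite setTI; exact: Ls_continuous_obox.
- by move=> a' b'; rewrite obox_setI; exact: Ls_continuous_obox.
- move=> E mE cE.
  rewrite (_ : \1_(~` E `&` obox a b) =
      (fun p => \1_(obox a b) p + (-1) * \1_(E `&` obox a b) p) :> (H -> R)).
    by apply: Ls_continuousD; [exact: Ls_continuous_obox|exact: Ls_continuousZ].
  apply/funext => p; rewrite !indicE !in_setI in_setC.
  by case: (p \in E); case: (p \in obox a b); rewrite /= ?mulr0 ?mulr1 ?addr0 ?subrr.
move=> F mF tF cF.
(* A point lies in one [F j] at most, so the partial sums of indicators are eventually constant and
   never exceed the indicator of the box. *)
have Fp p : (exists j, [/\ forall i, \1_(F i `&` obox a b) p = (i == j)%:R :> R,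
      \1_((\bigcup_i F i) `&` obox a b) p = 1 :> R & \1_(obox a b) p = 1 :> R]) \/
    (forall i, \1_(F i `&` obox a b) p = 0 :> R) /\
      \1_((\bigcup_i F i) `&` obox a b) p = 0 :> R.
  have [[[j _ Fj] bp]|np] := pselect (((\bigcup_i F i) `&` obox a b) p).
    left; exists j; split; rewrite ?indicE ?mem_set //; last by split => //; exists j.
    move=> i; rewrite indicE; have [->|ij] := eqVneq i j; first by rewrite mem_set.
    rewrite memNset // => -[Fi _]; move/trivIsetP : tF => /(_ i j Logic.I Logic.I ij).
    by move=> Fij; have : (F i `&` F j) p by []; rewrite Fij.
  right; split => [i|]; rewrite indicE memNset // => -[Fi ob].
  by apply: np; split => //; exists i.
apply: (@Ls_continuous_dct (fun m p => \sum_(i < m) \1_(F i `&` obox a b) p) _ (\1_(obox a b))) => //.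
- by move=> m; apply: Ls_continuous_sum.
- by apply: measurable_indic; apply: measurableI => //; exact: bigcup_measurable.
- move=> p; have [[j [Fj -> _]]|[F0 ->]] := Fp p.
    apply: cvg_near_cst; exists j.+1 => // m /= jm.
    rewrite (bigD1 (Ordinal jm)) //= Fj eqxx big1 ?addr0 // => i ij.
    by rewrite Fj; case: eqP => // ijE; move: ij; rewrite -val_eqE /= ijE eqxx.
  by apply: cvg_near_cst; apply: nearW => m; rewrite big1.
- move=> m p; have [[j [Fj _ ->]]|[F0 _]] := Fp p; last by rewrite big1 // normr0 indicE.
  have [jm|mj] := ltnP j m.
    rewrite (bigD1 (Ordinal jm)) //= Fj eqxx big1 ?addr0 ?normr1 // => i ij.
    by rewrite Fj; case: eqP => // ijE; move: ij; rewrite -val_eqE /= ijE eqxx.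
  rewrite big1 ?normr0 // => i _; rewrite Fj; case: eqP => // ijE.
  by move: mj; rewrite -ijE leqNgt ltn_ord.
- by move=> p; have [[j [_ -> ->]]|[_ ->]] := Fp p; rewrite ?normr1 // normr0 indicE.
Qed.

Import HBNNSimple.

(** Simple functions increasing to [g] are cut to growing cubes. This places their level sets in
    boxes, where [Ls_continuous_indicI] applies, and [g] itself is the majorant. *)
Lemma Ls_continuous_ge0 g : measurable_fun setT g -> (forall p, 0 <= g p) ->
  (Lsnorm s setT g < +oo)%E -> Ls_continuous g.
Proof.
move=> mg g0 gs.
have mEg : measurable_fun setT (EFin \o g) by exact/measurable_EFinP.
have [g_ [nd_g cvg_g]] := @approximation _ _ _ _ measurableT (EFin \o g) mEg (fun p _ => g0 p).
pose box m : set H := obox (const_mx (- m%:R)) (const_mx m%:R).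
have box_cvg p : \forall m \near \oo, \1_(box m) p = 1 :> R.
  near=> m; rewrite indicE mem_set // => i; rewrite !mxE -ltr_norml.
  apply: le_lt_trans (ler_coord_norm p i) _; near: m.
  exact: nbhs_infty_gtr.
have g_cvg p : g_ m p @[m --> \oo] --> g p by exact: (fine_cvg (cvg_g p Logic.I)).
have g_le m p : g_ m p <= g p.
  rewrite -(cvg_lim (@Rhausdorff R) (g_cvg p)).
  apply: nondecreasing_cvgn_le; first by move=> i j ij; apply/lefP/nd_g.
  by apply/cvg_ex; exists (g p); exact: g_cvg.
have box_le m p : 0 <= (\1_(box m) p : R) <= 1.
  by rewrite indicE; case: (_ \in _); rewrite ?ler01 ?lexx.
apply: (@Ls_continuous_dct (fun m p => g_ m p * \1_(box m) p) _ g) => //.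
- move=> m; have /= E := fimfunEord (g_ m).
  under eq_fun do rewrite E mulr_suml.
  apply: Ls_continuous_sum => i.
  under eq_fun do rewrite -mulrA -[X in _ * X]/((\1__ \* \1__) _) -indicI.
  apply: Ls_continuousZ; apply: Ls_continuous_indicI.
  exact: measurable_sfunP.
- move=> p; rewrite -[g p]mulr1; apply: cvgM; first exact: g_cvg.
  by apply: cvg_near_cst; exact: box_cvg.
- move=> m p; have /andP[b0 b1] := box_le m p.
  rewrite ger0_norm ?mulr_ge0 //.
  by apply: le_trans (g_le m p); rewrite ler_piMr.
- by move=> p; rewrite ger0_norm.
Unshelve. all: by end_near. Qed.

Lemma Ls_continuous_Ls g : measurable_fun setT g -> (Lsnorm s setT g < +oo)%E ->
  Ls_continuous g.
Proof.
move=> mg gs.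
have -> : g = (fun p => Num.max (g p) 0 + (-1) * Num.max (- g p) 0).
  apply/funext => p; rewrite mulN1r /Num.max; case: ltP => ?; case: ltP => ?; lra.
have H f : measurable_fun setT f -> (forall p, 0 <= f p) -> (forall p, f p <= `|g p|) ->
    Ls_continuous f.
  move=> mf f0 fg; apply: Ls_continuous_ge0 => //; apply: le_lt_trans gs.
  by apply: le_Lsnorm => // p _; rewrite ger0_norm.
apply: Ls_continuousD; last apply: Ls_continuousZ; apply: H.
- by apply: measurable_maxr => //; exact: measurable_cst.
- by move=> p; rewrite le_max lexx orbT.
- by move=> p; rewrite ge_max ler_norm normr_ge0.
- by apply: measurable_maxr; [exact: measurableT_comp|exact: measurable_cst].
- by move=> p; rewrite le_max lexx orbT.
- by move=> p; rewrite ge_max normr_ge0 andbT -normrN ler_norm.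
Qed.

End translation_continuity.

(** * Taylor estimates along flows *)

Section flow_taylor.
Context {R : realType} {n : nat}.
Notation H := (heis R n).
Notation mu1 := (@lebesgue_measure R).
Implicit Types (p q c w a b : H) (u g f h : H -> R) (A B : set H).
Local Opaque derive hderive.

Lemma continuous_affine (a b : R) : continuous (fun t : R => a + t * b).
Proof.
move=> t; apply: cvgD; first exact: cvg_cst.
by apply: cvgM; [exact: cvg_id|exact: cvg_cst].
Qed.

Lemma integrable_affine (a b e : R) :
  mu1.-integrable `[0, e] (fun t => (a + t * b)%:E).
Proof.
apply: continuous_compact_integrable; first exact: segment_compact.
by apply: continuous_subspaceT; exact: continuous_affine.
Qed.

Lemma Rintegral_affine (a b e : R) : 0 < e ->
  \int[mu1]_(t in `[0, e]) (a + t * b) = e * a + e ^+ 2 / 2 * b.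
Proof.
move=> e0; rewrite /Rintegral.
have D (t : R) : is_derive t (1 : R) (fun t => t * a + t ^+ 2 / 2 * b) (a + t * b).
  apply: (@is_derive_eq _ _ _ _ _ _ _ _ _); by rewrite /GRing.scale /=; field.
rewrite (FTC2_is_derive e0 D (@continuous_affine a b)) /=; ring.
Qed.

Variables (s : R) (Omega A : set H).
Hypothesis s1 : 1 <= s.
Hypothesis Omega_open : open Omega.
Hypothesis A_open : open A.
Let mO : measurable Omega. Proof. exact: open_measurable_rV. Qed.
Let mA : measurable A. Proof. exact: open_measurable_rV. Qed.

(** Extension by zero: composition with a flow is then measurable everywhere, and invariance can be
    used on the whole space. *)
Definition cut B u p : R := u p * \1_B p.

Lemma cutE B u p : B p -> cut B u p = u p.
Proof. by move=> Bp; rewrite /cut indicE mem_set // mulr1. Qed.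

Lemma measurable_cut B u : measurable B -> measurable_fun B u ->
  measurable_fun setT (cut B u).
Proof.
move=> mB mu; rewrite (_ : cut B u = u \_ B).
  exact/(measurable_restrictT _ mB).
by apply/funext => p; rewrite /cut patchE indicE; case: ifP; rewrite ?mulr1 ?mulr0.
Qed.

Lemma Lsnorm_cut B u : Lsnorm s setT (cut B u) = Lsnorm s B u.
Proof. by rewrite [RHS]Lsnorm_indic. Qed.

Definition flow_stays c (e : R) B := forall t p, 0 <= t <= e -> B p -> Omega (hflow c t p).

Lemma measurable_comp_flow c t u : (forall p, A p -> Omega (hflow c t p)) ->
  measurable_fun Omega u -> measurable_fun A (fun p => u (hflow c t p)).
Proof.
move=> AO mu; apply: (eq_measurable_fun (fun p => cut Omega u (hflow c t p))).
  by move=> p /set_mem Ap; rewrite cutE //; exact: AO.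
apply: measurable_funTS; apply: measurableT_comp; last exact: measurable_hflow.
exact: measurable_cut.
Qed.

Lemma Lsnorm_comp_flow_le c t u : (forall p, A p -> Omega (hflow c t p)) ->
  measurable_fun Omega u ->
  (Lsnorm s A (fun p => u (hflow c t p)) <= Lsnorm s Omega u)%E.
Proof.
move=> AO mu.
rewrite (eq_Lsnorm s (g := cut Omega u \o hflow c t)); last first.
  by move=> p Ap; rewrite /= cutE //; exact: AO.
rewrite -[leRHS]Lsnorm_cut -(Lsnorm_hflow s1 c t); last exact: measurable_cut.
apply: Lsnorm_subset => //; apply: measurableT_comp; last exact: measurable_hflow.
exact: measurable_cut.
Qed.

(** An error bound for [g] against an affine function of time is integrated once. With [h0 = h1 = 0]
    it bounds a first increment, with [h0 = g] a second one, and with [h1] the second derivative it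
    gives the second-order limit. *)
Lemma flow_taylor c (e : R) u g h0 h1 (M : \bar R) : 0 < e ->
  weak_along Omega c u g -> flow_stays c e A ->
  measurable_fun A h0 -> measurable_fun A h1 -> (0 <= M)%E ->
  (forall t, 0 <= t <= e ->
    (Lsnorm s A (fun p => (g (hflow c t p) - (h0 p + t * h1 p))%R) <= M)%E) ->
  (Lsnorm s A (fun p =>
     (u (hflow c e p) - u p - (e * h0 p + e ^+ 2 / 2 * h1 p))%R) <= e%:E * M)%E.
Proof.
move=> e0 W AO mh0 mh1 M0 HM.
have [[mu _] [mg _] _] := W.
have AO0 : A `<=` Omega.
  by move=> p Ap; rewrite -(hflow0 c p); apply: AO => //; rewrite lexx ltW.
have fl := flow_formula e0 Omega_open A_open W AO.
pose G (z : H * R) := cut Omega g (hflow c (1 * z.2) z.1) -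
  (cut A h0 z.1 + z.2 * cut A h1 z.1).
have GE p t : A p -> 0 <= t <= e -> G (p, t) = g (hflow c t p) - (h0 p + t * h1 p).
  by move=> Ap te; rewrite /G /= mul1r !cutE //; exact: AO.
apply: (Lsnorm_integral_le (G := G)) => //.
- apply: measurable_funB.
    apply: (@measurableT_comp _ _ _ _ _ _ (cut Omega g) _
      (fun z : H * R => hflow c (1 * z.2) z.1)); last exact: measurable_flow2.
    exact: measurable_cut.
  apply: measurable_funD.
    by apply: (@measurableT_comp _ _ _ _ _ _ (cut A h0) _ fst) => //; exact: measurable_cut.
  apply: measurable_funM => //.
  by apply: (@measurableT_comp _ _ _ _ _ _ (cut A h1) _ fst) => //; exact: measurable_cut.
- apply: measurable_funB.
    apply: measurable_funB; last exact: (measurable_funS mO AO0).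
    by apply: measurable_comp_flow => // p Ap; apply: AO => //; rewrite lexx ltW.
  by apply: measurable_funD; exact: measurable_funM.
- apply: filterS fl => p Hp Ap; have [ig E] := Hp Ap.
  have mI : measurable (`[0, e] : set (measurableTypeR R)) by exact: measurable_itv.
  have ia := integrable_affine (h0 p) (h1 p) e.
  have GI t : `[0, e]%classic t -> G (p, t) = g (hflow c t p) - (h0 p + t * h1 p).
    by rewrite /= in_itv /=; exact: GE.
  split.
    apply: (eq_integrable mI (fun t => (g (hflow c t p))%:E - (h0 p + t * h1 p)%:E)%E).
      by move=> t /set_mem tI; rewrite GI.
    exact: integrableB.
  rewrite E -(Rintegral_affine _ _ e0) -RintegralB //.
  by apply: eq_Rintegral => t /set_mem tI; rewrite GI.
- move=> t; rewrite /= in_itv /= => te; rewrite (eq_Lsnorm s (g := (fun p => (g (hflow c t p) - (h0 p + t * h1 p))%R))).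
    exact: HM.
  by move=> p Ap; exact: GE.
Qed.

Lemma Lsnorm0 B : Lsnorm s B (fun=> 0) = 0%E.
Proof.
have s0 : 0 < s by exact: lt_le_trans s1.
apply/eqP; rewrite eq_le Lsnorm_ge0 andbT; apply: (@lee_poweR2 _ s) => //.
  exact: Lsnorm_ge0.
rewrite (Lsnorm_pow B _ s0) integral0_eq ?poweR_ge0 // => p _.
by rewrite normr0 powR0 // gt_eqF.
Qed.

Lemma flow_diff_le c (e : R) u g : 0 <= e -> weak_along Omega c u g ->
  flow_stays c e A ->
  (Lsnorm s A (fun p => (u (hflow c e p) - u p)%R) <= e%:E * Lsnorm s Omega g)%E.
Proof.
move=> e0 W AO; have [[mu _] [mg _] _] := W.
move: e0; rewrite le_eqVlt => /predU1P[<-|e0].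
  by under [X in Lsnorm s A X]eq_fun do rewrite hflow0 subrr; rewrite Lsnorm0 mul0e.
rewrite (_ : (fun p => _) = (fun p => u (hflow c e p) - u p - (e * 0 + e ^+ 2 / 2 * 0))); last first.
  by apply/funext => p; rewrite !mulr0 addr0 subr0.
apply: (@flow_taylor c e u g (fun=> 0) (fun=> 0)) => //.
- exact: Lsnorm_ge0.
move=> t te; under [X in Lsnorm s A X]eq_fun do rewrite mulr0 addr0 subr0.
by apply: Lsnorm_comp_flow_le => // p Ap; exact: AO.
Qed.

(** The increment of [g] at time [t] is at most [t] times the norm of [g2]. [flow_taylor] takes one
    bound for all times, so [t] is replaced by [e], which yields the constant 1. *)
Lemma flow_second_le c (e : R) u g g2 : 0 < e -> weak_along Omega c u g ->
  weak_along Omega c g g2 -> flow_stays c e A ->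
  (Lsnorm s A (fun p => (u (hflow c e p) - u p - e * g p)%R)
     <= (e ^+ 2)%:E * Lsnorm s Omega g2)%E.
Proof.
move=> e0 W W2 AO; have [[mu _] [mg _] _] := W.
have AO0 : A `<=` Omega.
  by move=> p Ap; rewrite -(hflow0 c p); apply: AO => //; rewrite lexx ltW.
rewrite expr2 EFinM -muleA.
rewrite (_ : (fun p => _) = (fun p => u (hflow c e p) - u p - (e * g p + e ^+ 2 / 2 * 0))); last first.
  by apply/funext => p; rewrite mulr0 addr0.
apply: (@flow_taylor c e u g g (fun=> 0)) => //.
- exact: measurable_funS mO AO0 mg.
- by rewrite mule_ge0 ?Lsnorm_ge0 // lee_fin ltW.
move=> t /andP[t0 te]; under [X in Lsnorm s A X]eq_fun do rewrite mulr0 addr0.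
apply: (@le_trans _ _ (t%:E * Lsnorm s Omega g2)%E).
  apply: flow_diff_le => // r p /andP[r0 rt]; apply: AO.
  by rewrite r0 (le_trans rt).
by rewrite lee_wpmul2r ?Lsnorm_ge0 ?lee_fin.
Qed.

Lemma flow_Ls_continuous c g : measurable_fun Omega g -> (Lsnorm s Omega g < +oo)%E ->
  forall eps : R, 0 < eps -> exists2 d : R, 0 < d & forall t B, `|t| < d ->
  measurable B -> B `<=` Omega -> (forall p, B p -> Omega (hflow c t p)) ->
  (Lsnorm s B (fun p => (g (hflow c t p) - g p)%R) <= eps%:E)%E.
Proof.
move=> mg gs eps eps0.
have mcg := measurable_cut mO mg.
have [_ /(_ _ eps0) [d d0 Hd]] : Ls_continuous s c (cut Omega g).
  by apply: Ls_continuous_Ls => //; rewrite Lsnorm_cut.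
exists d => // t B td mB BO BOt; apply: le_trans (Hd _ td).
rewrite (eq_Lsnorm s (g := fun p => cut Omega g (hflow c t p) - cut Omega g p)).
  apply: Lsnorm_subset => //; apply: measurable_funB => //.
  by apply: measurableT_comp => //; exact: measurable_hflow.
by move=> p Bp; rewrite !cutE //; [exact: BO|exact: BOt].
Qed.

End flow_taylor.

Section flow_limits.
Context {R : realType} {n : nat}.
Notation H := (heis R n).
Implicit Types (p q c w a b : H) (u g f h : H -> R) (A B : set H).
Variables (s : R) (Omega : set H).
Hypothesis s1 : 1 <= s.
Hypothesis Omega_open : open Omega.
Local Opaque derive hderive.
Let mO : measurable Omega. Proof. exact: open_measurable_rV. Qed.

(** The threshold [d] precedes the set [A]: the vertical flow is later started from [flowed w e],
    which varies with [e]. *)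
Lemma flow_first_lim c u g : weak_along Omega c u g -> (Lsnorm s Omega g < +oo)%E ->
  forall eps : R, 0 < eps -> exists2 d : R, 0 < d & forall e A, 0 < e < d ->
  open A -> flow_stays Omega c e A ->
  (Lsnorm s A (fun p => (u (hflow c e p) - u p - e * g p)%R) <= (e * eps)%:E)%E.
Proof.
move=> W gs eps eps0; have [[mu _] [mg _] _] := W.
have [d d0 Hd] := flow_Ls_continuous s1 Omega_open c mg gs eps0.
exists d => // e A /andP[e0 ed] oA AO.
have mA : measurable A by exact: open_measurable_rV.
have AO0 : A `<=` Omega.
  by move=> p Ap; rewrite -(hflow0 c p); apply: AO => //; rewrite lexx ltW.
rewrite (_ : (fun p => _) = (fun p => u (hflow c e p) - u p - (e * g p + e ^+ 2 / 2 * 0))); last first.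
  by apply/funext => p; rewrite mulr0 addr0.
rewrite EFinM; apply: (@flow_taylor _ _ s Omega A s1 Omega_open oA c e u g g (fun=> 0)) => //.
- exact: measurable_funS mO AO0 mg.
- by rewrite lee_fin ltW.
move=> t /andP[t0 te]; under [X in Lsnorm s A X]eq_fun do rewrite mulr0 addr0.
apply: Hd => //; first by rewrite ger0_norm // (le_lt_trans te).
by move=> p Ap; apply: AO => //; rewrite t0.
Qed.

Lemma flow_second_lim c u g g2 : weak_along Omega c u g -> weak_along Omega c g g2 ->
  (Lsnorm s Omega g2 < +oo)%E ->
  forall eps : R, 0 < eps -> exists2 d : R, 0 < d & forall e A, 0 < e < d ->
  open A -> flow_stays Omega c e A ->
  (Lsnorm s A (fun p =>
     (u (hflow c e p) - u p - (e * g p + e ^+ 2 / 2 * g2 p))%R) <= (e ^+ 2 * eps)%:E)%E.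
Proof.
move=> W W2 gs eps eps0; have [[mu _] [mg _] _] := W; have [_ [mg2 _] _] := W2.
have [d d0 Hd] := flow_first_lim W2 gs eps0.
exists d => // e A /andP[e0 ed] oA AO.
have mA : measurable A by exact: open_measurable_rV.
have AO0 : A `<=` Omega.
  by move=> p Ap; rewrite -(hflow0 c p); apply: AO => //; rewrite lexx ltW.
have -> : e ^+ 2 * eps = e * (e * eps) by ring.
rewrite EFinM; apply: (@flow_taylor _ _ s Omega A s1 Omega_open oA c e u g g g2) => //.
- exact: measurable_funS mO AO0 mg.
- exact: measurable_funS mO AO0 mg2.
- by rewrite lee_fin mulr_ge0 // ltW.
(* [flow_first_lim] speaks of positive times; at time 0 the function is identically zero. *)
move=> t /andP[t0 te]; move: t0; rewrite le_eqVlt => /predU1P[<-|t0].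
  under [X in Lsnorm s A X]eq_fun do rewrite hflow0 mul0r addr0 subrr.
  by rewrite Lsnorm0 // lee_fin mulr_ge0 // ltW.
under [X in Lsnorm s A X]eq_fun do rewrite opprD addrA.
apply: le_trans (Hd t A _ oA _) _.
- by rewrite t0 (le_lt_trans te).
- by move=> r p /andP[r0 rt]; apply: AO; rewrite r0 (le_trans rt).
by rewrite lee_fin ler_pM2r.
Qed.

End flow_limits.

(** * Horizontal curves *)

Section derive_affine.
Context {R : realType} {V : normedModType R}.

Lemma is_derive_affine (gamma : R -> V) (a b t : R) (v : V) :
  is_derive (a * t + b) (1 : R) gamma v ->
  is_derive t (1 : R) (fun s => gamma (a * s + b)) (a *: v).
Proof.
move=> [dg dgE].
have dif : differentiable gamma (a * t + b) by apply/derivable1_diffP.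
have E : (fun h : R => h^-1 *: (((fun s => gamma (a * s + b)) \o shift t) (h *: (1 : R))
      - gamma (a * t + b))) =
    (fun h => h^-1 *: ((gamma \o shift (a * t + b)) (h *: a) - gamma (a * t + b))).
  apply/funext => h /=; congr (_ *: (gamma _ - _)).
  by rewrite /GRing.scale /=; ring.
apply: DeriveDef.
  by rewrite /derivable E; exact: diff_derivable.
rewrite /derive E -/(derive gamma (a * t + b) a) deriveE //.
have -> : 'd gamma (a * t + b) a = a *: 'd gamma (a * t + b) (1 : R).
  by rewrite -linearZ /=; congr ('d gamma _ _); rewrite /GRing.scale /= mulr1.
by rewrite -deriveE // dgE.
Qed.

End derive_affine.

(** * Horizontal paths and the distance to the boundary *)

Section carnot_caratheodory.
Context {R : realType} {n : nat}.
Notation H := (heis R n).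
Notation mu1 := (@lebesgue_measure R).
Implicit Types (p q c w : H) (A B : set H).

Lemma hfieldZ a c p : hfield (a *: c) p = a *: hfield c p.
Proof.
apply: heis_ext; rewrite /hfield ?(hx_hpoint, hy_hpoint, ht_hpoint, hxZ, hyZ, htZ) //.
by rewrite sympZr; ring.
Qed.

Lemma mul_frame c p : c *m frame p = hfield c p.
Proof.
rewrite hfieldE mulmx_sum_row; apply: eq_bigr => k _; congr (_ *: _).
by apply/rowP => j; rewrite !mxE.
Qed.

Lemma frame_unit p : frame p \in unitmx.
Proof.
rewrite -row_free_unit; apply: inj_row_free => v; rewrite mul_frame => E.
have hx0 : hx v = 0.
  by have := congr1 hx E; rewrite hx_hpoint => ->; apply/rowP => j; rewrite !mxE.
have hy0 : hy v = 0.
  by have := congr1 hy E; rewrite hy_hpoint => ->; apply/rowP => j; rewrite !mxE.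
apply: heis_ext; rewrite ?hx0 ?hy0; try by apply/rowP => j; rewrite !mxE.
have := congr1 (fun q => ht q) E; rewrite /= ht_hpoint /symp big1; last first.
  by move=> j _; rewrite hx0 hy0 !mxE; ring.
by rewrite mulr0 addr0.
Qed.

Lemma riem_hfield c p : riem p (hfield c p) (hfield c p) = dot c c.
Proof. by rewrite /riem -mul_frame -mulmxA mulmxV ?frame_unit // mulmx1. Qed.

Lemma horizontal_hfield c p : ht c = 0 -> horizontal p (hfield c p).
Proof.
move=> c0; rewrite /horizontal; apply/submxP; exists (hpart c).
rewrite hfieldE big_split_ord /= big_ord1.
have -> : c 0 (rshift (n + n) ord0) = 0 by [].
rewrite scale0r addr0 mulmx_sum_row; apply: eq_bigr => j _.
by rewrite mxE; congr (_ *: _); apply/rowP => k; rewrite !mxE.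
Qed.

Lemma dotZ k a (u : 'rV[R]_k) : dot (a *: u) (a *: u) = a ^+ 2 * dot u u.
Proof. by rewrite /dot mulr_sumr; apply: eq_bigr => i _; rewrite !mxE; ring. Qed.

Lemma dot_ge0 k (u : 'rV[R]_k) : 0 <= dot u u.
Proof. by apply: sumr_ge0 => i _; rewrite -expr2 sqr_ge0. Qed.

Lemma dot_eq0 k (u : 'rV[R]_k) : dot u u = 0 -> u = 0.
Proof.
move=> u0; apply/rowP => i; rewrite mxE; apply/eqP; rewrite -sqrf_eq0 expr2.
move: u0; rewrite /dot => /eqP; rewrite psumr_eq0.
  by move/allP => /(_ i (mem_index_enum _)).
by move=> j _; rewrite -expr2 sqr_ge0.
Qed.

Lemma is_derive_hflow c r p : is_derive r (1 : R) (fun r => hflow c r p) (hfield c p).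
Proof.
have C : h^-1 *: (((fun r => hflow c r p) \o shift r) (h *: (1 : R)) - hflow c r p)
    @[h --> 0^'] --> hfield c p.
  apply: cvg_near_cst; near=> h.
  have h0 : h != 0 by near: h; exact: nbhs_dnbhs_neq.
  rewrite /hflow /= opprD addrACA subrr add0r -scalerBl addrK /GRing.scale /= mulr1.
  by rewrite -/(GRing.scale _ _) scalerA mulVf // scale1r.
apply: DeriveDef; first by apply/cvg_ex; exists (hfield c p).
exact: (cvg_lim _ C).
Unshelve. all: by end_near. Qed.

(* Unit-speed parametrizations on [0, L]; the finite exceptional set [S] makes
   concatenation immediate. *)
Definition hpath p q (L : R) : Prop := 0 <= L /\ exists (gamma : R -> H) (K : R) (S : seq R),
  [/\ gamma 0 = p, gamma L = q,
    forall a b, 0 <= a -> a <= b -> b <= L -> `|gamma b - gamma a| <= K * (b - a) &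
    forall t, 0 < t < L -> t \notin S -> exists c, [/\ ht c = 0, dot c c <= 1 &
      is_derive t (1 : R) gamma (hfield c (gamma t))]].

Lemma hpath_segment c p : ht c = 0 -> hpath p (hflow c 1 p) (Num.sqrt (dot c c)).
Proof.
move=> c0; split; first exact: sqrtr_ge0.
set L := Num.sqrt _.
exists (fun t => hflow c (L^-1 * t + 0) p), (`|L^-1| * `|hfield c p|), [::].
split.
- by rewrite mulr0 addr0 hflow0.
(* For [L = 0] the inverse is 0 by convention and the path is constant, as it should be, since then
   [c = 0]. *)
- rewrite addr0; have [L0|L0] := eqVneq L 0; last by rewrite mulVf.
  have -> : c = 0.
    apply: dot_eq0; apply/eqP; rewrite eq_le dot_ge0 andbT.
    by rewrite -sqrtr_eq0 -/L L0.
  rewrite /hflow -[0 : H](scale0r (0 : H)) hfieldZ scale0r; congr (_ + _).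
  by rewrite !scaler0.
- move=> a b a0 ab bL; rewrite /hflow !addr0 opprD addrACA subrr add0r -scalerBl -mulrBr.
  rewrite normrZ normrM (ger0_norm (x := b - a)) ?subr_ge0 //.
  by rewrite le_eqVlt; apply/orP; left; apply/eqP; ring.
- move=> t /andP[t0 tL] _; have L0 : 0 < L by exact: lt_trans tL.
  exists (L^-1 *: c); split.
  + by rewrite htZ c0 mulr0.
  + by rewrite dotZ exprVn -[dot c c]sqr_sqrtr ?dot_ge0 // -/L mulVf // expf_neq0 // gt_eqF.
  rewrite hfieldZ hfield_hflow; apply: (@is_derive_affine R _ (fun r => hflow c r p)).
  exact: is_derive_hflow.
Qed.

Lemma hpath_cat p q r L1 L2 : hpath p q L1 -> hpath q r L2 -> hpath p r (L1 + L2).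
Proof.
move=> [L10 [g1 [K1 [S1 [g10 g1L lip1 d1]]]]] [L20 [g2 [K2 [S2 [g20 g2L lip2 d2]]]]].
split; first exact: addr_ge0.
(* The time shift has the shape expected by [is_derive_affine]. *)
pose g t := if t <= L1 then g1 t else g2 (1 * t + - L1).
have gle t : t <= L1 -> g t = g1 t by rewrite /g => ->.
have gge t : L1 <= t -> g t = g2 (1 * t + - L1).
  rewrite le_eqVlt => /predU1P[<-|L1t]; last by rewrite /g leNgt L1t.
  by rewrite gle // mul1r subrr g1L g20.
(* The corner at time [L1] joins the exceptional times. *)
exists g, (Num.max K1 K2), (L1 :: S1 ++ [seq t + L1 | t <- S2]); split.
- by rewrite gle.
- by rewrite gge ?lerDl // mul1r addrC addKr.
- have lemax1 x : 0 <= x -> K1 * x <= Num.max K1 K2 * x.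
    by move=> x0; rewrite ler_wpM2r // le_max lexx.
  have lemax2 x : 0 <= x -> K2 * x <= Num.max K1 K2 * x.
    by move=> x0; rewrite ler_wpM2r // le_max lexx orbT.
  move=> a b a0 ab bL.
  have [bL1|L1b] := leP b L1.
    rewrite !gle //; last exact: le_trans ab _.
    by apply: le_trans (lip1 _ _ a0 ab bL1) _; rewrite lemax1 // subr_ge0.
  have [aL1|L1a] := leP a L1; last first.
    rewrite !gge //; try exact: ltW.
    have -> : b - a = (1 * b - L1) - (1 * a - L1) by ring.
    apply: le_trans (lip2 _ _ _ _ _) _; rewrite ?mul1r ?subr_ge0 ?lerD2r ?lerBlDl //.
      exact: ltW.
    by rewrite lemax2 // opprB addrA subrK subr_ge0.
  rewrite (gge b); last exact: ltW.
  rewrite (gle a) //.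
  have -> : g2 (1 * b + - L1) - g1 a = (g2 (1 * b + - L1) - g2 0) + (g1 L1 - g1 a).
    by rewrite g20 g1L addrA subrK.
  apply: le_trans (ler_normD _ _) _.
  have -> : b - a = (1 * b + - L1 - 0) + (L1 - a) by ring.
  have b1 : 0 <= 1 * b + - L1 by rewrite mul1r subr_ge0 ltW.
  rewrite mulrDr lerD //.
    apply: le_trans (lip2 _ _ (lexx 0) b1 _) _; first by rewrite mul1r lerBlDl.
    by rewrite lemax2 // subr0.
  by apply: le_trans (lip1 _ _ a0 aL1 (lexx L1)) _; rewrite lemax1 // subr_ge0.
- move=> t /andP[t0 tL]; rewrite inE mem_cat !negb_or => /and3P[tL1 tS1 tS2].
  have [tlt|tgt|tE] := ltgtP t L1; last by rewrite tE eqxx in tL1.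
    have [|c [c0 c1 dc]] := d1 t _ tS1; first by rewrite t0.
    exists c; split => //; rewrite gle ?ltW //.
    apply: near_eq_is_derive dc; near=> x; rewrite gle //.
    by apply: ltW; near: x; exact: lt_nbhsl.
  have [||c [c0 c1 dc]] := d2 (1 * t + - L1).
  + by rewrite mul1r subr_gt0 tgt ltrBlDl.
  + apply: contra tS2 => tS2; apply/mapP; exists (1 * t + - L1) => //.
    by rewrite mul1r subrK.
  exists c; split => //; rewrite gge ?ltW //.
  have := is_derive_affine dc; rewrite scale1r.
  apply: near_eq_is_derive; near=> x; rewrite gge //.
  by apply: ltW; near: x; exact: lt_nbhsr.
Unshelve. all: by end_near. Qed.

Import HBNNSimple.

(* The speed of a curve is not known to be measurable, so the library's
   comparison of integrals does not apply to [f]. *)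
Lemma integral_le_off_null (f : R -> \bar R) (N : set (measurableTypeR R)) (L : R) :
  measurable N -> mu1 N = 0%E -> 0 <= L -> (forall t, (0 <= f t)%E) ->
  (forall t, 0 <= t <= 1 -> ~ N t -> (f t <= L%:E)%E) ->
  (\int[mu1]_(t in `[0%R, 1%R]) f t <= L%:E)%E.
Proof.
move=> mN N0 L0 f0 fL.
have mI : measurable (`[0, 1] : set (measurableTypeR R)) by exact: measurable_itv.
(* The integral of a nonnegative function is the supremum over the simple functions below it, and
   each of these is measurable. *)
rewrite ge0_integralE //; apply: ge_ereal_sup => _ [h /= hf <-].
rewrite -integralT_nnsfun.
have -> : L%:E = (\int[mu1]_t (L%:E * (\1_(`[0, 1] : set R) t)%:E))%E.
  rewrite ge0_integralZl //.
  - by rewrite (integral_indic mu1 measurableT mI) setIT [X in (_ * X)%E](lebesgue_measure_itv0 ltr01) mule1.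
  - by apply/measurable_EFinP; exact: measurable_indic.
apply: ae_ge0_le_integral => //.
- by move=> t _; rewrite lee_fin.
- by apply/measurable_EFinP; exact: measurable_funTS.
- by move=> t _; rewrite mule_ge0 // lee_fin.
- by apply: emeasurable_funM => //; apply/measurable_EFinP; exact: measurable_indic.
exists N; split => // t Ht; apply: contrapT => tN; apply: Ht => _.
apply: le_trans (hf t) _; rewrite patchE indicE.
case: ifPn => [/set_mem|_]; last by rewrite mule0.
by rewrite /= in_itv /= mule1 => t01; exact: fL.
Qed.

(** The path waits at [q] for the remaining time; the speed is only bounded by 1, so zero speed is
    allowed. *)
Lemma hpath_le p q L L' : hpath p q L -> L <= L' -> hpath p q L'.
Proof.
move=> H1 LL'; rewrite -(subrKC L L'); apply: hpath_cat H1 _.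
split; first by rewrite subr_ge0.
exists (fun=> q), 0, [::]; split => //.
  by move=> a b _ _ _; rewrite subrr normr0 mul0r.
move=> t _ _; exists 0; split.
- by rewrite /ht mxE.
- by rewrite /dot big1 // => i _; rewrite mxE mul0r.
rewrite -(scale0r (0 : H)) hfieldZ scale0r; exact: is_derive_cst.
Qed.

Lemma hpath_horizontal_curve p q L : hpath p q L ->
  exists2 gamma, [/\ horizontal_curve gamma, gamma 0 = p & gamma 1 = q] &
    (curve_length gamma <= L%:E)%E.
Proof.
move=> [L0 [g [K [S [g0 gL lip dg]]]]].
(* The exceptional times after rescaling to [0, 1], with the two endpoints, where [hpath] says
   nothing about derivatives. *)
pose Ns := [:: 0; 1] ++ [seq t / L | t <- S].
have cN : countable [set` Ns] by apply: finite_set_countable; exact: finite_seq.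
have mN : measurable ([set` Ns] : set (measurableTypeR R)).
  by apply: countable_measurable => // t; exact: measurable_set1.
have N0 : mu1 [set` Ns] = 0%E.
  exact: countable_lebesgue_measure0.
have D t : 0 <= t <= 1 -> t \notin Ns -> exists c, [/\ ht c = 0, dot c c <= L ^+ 2 &
    is_derive t (1 : R) (fun t => g (L * t + 0)) (hfield c (g (L * t + 0)))].
  move=> /andP[t0 t1]; rewrite mem_cat !inE !negb_or -andbA => /and3P[tn0 tn1 tS].
  have {}t0 : 0 < t by rewrite lt_neqAle eq_sym tn0.
  have {}t1 : t < 1 by rewrite lt_neqAle tn1.
  move: (L0); rewrite le_eqVlt => /predU1P[LE|Lp].
    exists 0; split.
    - by rewrite /ht mxE.
    - by rewrite /dot big1 ?sqr_ge0 // => i _; rewrite mxE mul0r.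
    rewrite -LE; under [X in is_derive _ _ X]eq_fun do rewrite mul0r.
    rewrite -(scale0r (0 : H)) hfieldZ scale0r; exact: is_derive_cst.
  have [||c [c0 c1 dc]] := dg (L * t + 0).
  - by rewrite addr0 mulr_gt0 //= gtr_pMr.
  - apply: contra tS => tS; apply/mapP; exists (L * t + 0) => //.
    by rewrite addr0 mulrAC divff ?mul1r // gt_eqF.
  exists (L *: c); split.
  - by rewrite htZ c0 mulr0.
  - by rewrite dotZ ler_piMr // sqr_ge0.
  by rewrite hfieldZ; exact: is_derive_affine.
exists (fun t => g (L * t + 0)); first split.
- split.
    (* The rescaled curve is Lipschitz with constant [|K| * L], which may be 0; hence the added
       1. *)
    move=> e e0; exists (e / (`|K| * L + 1)).
      by rewrite divr_gt0 // ltr_wpDl // mulr_ge0.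
    move=> m a b ab _ sab.
    apply: (@le_lt_trans _ _ (\sum_(i < m) (`|K| * L) * (b i - a i))).
      apply: ler_sum => i _; have [a0 aib b1] := ab i.
      apply: le_trans (lip _ _ _ _ _) _.
      + by rewrite addr0 mulr_ge0.
      + by rewrite !addr0 ler_wpM2l.
      + by rewrite addr0 ler_piMr.
      rewrite !addr0 -mulrBr mulrA ler_wpM2r ?subr_ge0 //.
      by rewrite ler_wpM2r // ler_norm.
    rewrite -mulr_sumr; move: sab; rewrite ltr_pdivlMr; last first.
      by rewrite ltr_wpDl // mulr_ge0.
    apply: le_lt_trans; rewrite mulrC ler_wpM2l //; last by rewrite lerDl.
    by apply: sumr_ge0 => i _; rewrite subr_ge0; have [] := ab i.
  exists [set` Ns]; split => // t Ht; apply: contrapT => /negP tN; apply: Ht => /=.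
  rewrite in_itv /= => t01; have [c [c0 _ dc]] := D t t01 tN; split.
    exact: (@ex_derive _ _ _ _ _ _ _ dc).
  by rewrite derive1E (@derive_val _ _ _ _ _ _ _ dc); exact: horizontal_hfield.
- by rewrite mulr0 addr0.
- by rewrite mulr1 addr0.
apply: (integral_le_off_null mN N0) => //.
move=> t t01 /negP tN; have [c [c0 cL dc]] := D t t01 tN.
rewrite lee_fin derive1E (@derive_val _ _ _ _ _ _ _ dc) riem_hfield.
by rewrite -[leRHS](ger0_norm L0) -sqrtr_sqr ler_wsqrtr.
Qed.

Lemma hpath_notin_boundary (Omega A : set H) p q L : hpath p q L -> A p ->
  (L%:E < set_ccdist A (boundary Omega))%E -> ~ boundary Omega q.
Proof.
move=> /hpath_horizontal_curve[g [gh g0 g1] gL] Ap + bq.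
rewrite ltNge => /negP; apply; apply: le_trans gL.
apply: (@le_trans _ _ (ccdist p q)).
  by apply: ereal_inf_lbound; exists (p, q).
by apply: ereal_inf_lbound; exists g.
Qed.

(** The times spent in [Omega] form an open subset of the interval, and a closed one because the
    boundary is never met; the interval is connected. *)
Lemma curve_stays (Omega : set H) (g : R -> H) (e : R) : open Omega ->
  continuous g -> Omega (g 0) -> 0 <= e ->
  (forall t, 0 <= t <= e -> ~ boundary Omega (g t)) ->
  forall t, 0 <= t <= e -> Omega (g t).
Proof.
move=> oO cg O0 e0 nb t te.
have cI : connected (`[0, e] : set R) by exact: segment_connected.
suff E : `[0, e]%classic `&` g @^-1` Omega = `[0, e]%classic.
  by have : (`[0, e]%classic `&` g @^-1` Omega) t; [rewrite E /= in_itv|case].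
apply: cI.
- by exists 0; split => //; rewrite /= in_itv /= lexx.
- exists (g @^-1` Omega) => //; exact: open_comp.
- exists (g @^-1` closure Omega); first by apply: preimage_closed => //; exact: closed_closure.
  apply/seteqP; split => r [rI gr]; split => //; first exact: subset_closure.
  apply: contrapT => nO; apply: (nb r); first by move: rI; rewrite /= in_itv.
  by split => //; move/interior_id : oO => ->.
Qed.

Lemma dot_split c : dot c c = dot (hx c) (hx c) + dot (hy c) (hy c) + ht c ^+ 2.
Proof.
rewrite /dot big_split_ord /= big_split_ord /= big_ord1 -/(ht c) expr2.
by congr (_ + _ + _); apply: eq_bigr => j _; rewrite ?hxE ?hyE.
Qed.

Lemma hhor_hidx w j : hhor w 0 (hidx j) = hpart w 0 j.
Proof.
have /rowP/(_ j) : lsubmx (hhor w) = hpart w.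
  by rewrite /hhor /hpoint row_mxKl /hx /hy hsubmxK.
by rewrite [in LHS]mxE.
Qed.

Lemma dot_hhor w : dot (hhor w) (hhor w) = frobenius (hpart w) ^+ 2.
Proof.
rewrite /frobenius sqr_sqrtr; last first.
  by apply: sumr_ge0 => i _; apply: sumr_ge0 => j _; exact: sqr_ge0.
rewrite big_ord1 /dot big_split_ord /= big_ord1.
rewrite -/(ht (hhor w)) ht_hpoint mulr0 addr0; apply: eq_bigr => j _.
by rewrite -/(hidx j) hhor_hidx expr2.
Qed.

Lemma hflowZ a r c p : hflow (a *: c) r p = hflow c (r * a) p.
Proof. by rewrite /hflow hfieldZ scalerA. Qed.

Lemma hpath_hor w t p : 0 <= t ->
  hpath p (hflow (hhor w) t p) (t * frobenius (hpart w)).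
Proof.
move=> t0; have c0 : ht (t *: hhor w) = 0 by rewrite htZ ht_hpoint mulr0.
have := hpath_segment p c0; rewrite hflowZ mul1r dotZ dot_hhor.
by rewrite -exprMn sqrtr_sqr ger0_norm // mulr_ge0 // sqrtr_ge0.
Qed.

Lemma hx_hflow c r p : hx (hflow c r p) = hx p + r *: hx c.
Proof. by rewrite /hflow hxD hxZ hx_hpoint. Qed.

Lemma hy_hflow c r p : hy (hflow c r p) = hy p + r *: hy c.
Proof. by rewrite /hflow hyD hyZ hy_hpoint. Qed.

Lemma ht_hflow c r p : ht (hflow c r p) = ht p + r * (ht c + 2 * symp p c).
Proof. by rewrite /hflow htD htZ ht_hpoint. Qed.

Lemma symp_hflow c r p c' : symp (hflow c r p) c' = symp p c' + r * symp c c'.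
Proof.
rewrite /hflow sympDl sympZl; congr (_ + _ * _).
by apply: symp_eq; rewrite ?hx_hpoint ?hy_hpoint.
Qed.

(** The four displacements cancel horizontally, and the height gained is four times the symplectic
    area [a * b * symp c c'] of the parallelogram. *)
Lemma hflow_commutator a b c c' p : ht c = 0 -> ht c' = 0 ->
  hflow c' (- b) (hflow c (- a) (hflow c' b (hflow c a p))) =
  p + hpoint 0 0 (4 * a * b * symp c c').
Proof.
move=> c0 c'0; have E : symp c' c = - symp c c'.
  by rewrite /symp -sumrN; apply: eq_bigr => j _; ring.
apply: heis_ext.
- rewrite hxD !hx_hflow hx_hpoint addr0 !scaleNr addrAC addrK.
  by rewrite addrK.
- rewrite hyD !hy_hflow hy_hpoint addr0 !scaleNr addrAC addrK.
  by rewrite addrK.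
rewrite htD ht_hpoint !ht_hflow !symp_hflow c0 c'0 !sympxx E; ring.
Qed.

Lemma hpath_ver w t p : (1 <= n)%N -> 0 <= t ->
  hpath p (hflow (hver w) t p) (2 * Num.sqrt (t * `|ht w|)).
Proof.
move=> n1 t0; set N := t * _; have N0 : 0 <= N by rewrite mulr_ge0.
pose j0 : 'I_n := Ordinal n1.
pose cX : H := hpoint (delta_mx 0 j0) 0 0.
pose cY : H := hpoint 0 (delta_mx 0 j0) 0.
have delta2 : dot (delta_mx 0 j0) (delta_mx 0 j0 : 'rV[R]_n) = 1.
  rewrite /dot (bigD1 j0) //= big1 => [|j jj0]; first by rewrite !mxE !eqxx mulr1 addr0.
  by rewrite !mxE (negbTE jj0) andbF mulr0.
have dot00 : dot (0 : 'rV[R]_n) 0 = 0 by rewrite /dot big1 // => j _; rewrite mxE mulr0.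
have sXY : symp cX cY = -1.
  rewrite -delta2 /symp !hx_hpoint !hy_hpoint /dot -sumrN; apply: eq_bigr => j _.
  by rewrite [(0 : 'rV_n) 0 j]mxE mul0r sub0r.
have dX : dot cX cX = 1.
  by rewrite dot_split hx_hpoint hy_hpoint ht_hpoint delta2 dot00 expr0n !addr0.
have dY : dot cY cY = 1.
  by rewrite dot_split hx_hpoint hy_hpoint ht_hpoint delta2 dot00 expr0n addr0 add0r.
have seg c r q : ht c = 0 -> dot c c = 1 -> hpath q (hflow c r q) `|r|.
  move=> c0 c1; have c0' : ht (r *: c) = 0 by rewrite htZ c0 mulr0.
  by have := hpath_segment q c0'; rewrite hflowZ mul1r dotZ c1 mulr1 sqrtr_sqr.
pose a := Num.sqrt N / 2.
have a0 : 0 <= a by rewrite divr_ge0 // sqrtr_ge0.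
have a2 : 4 * a * a = N.
  by rewrite -[RHS](sqr_sqrtr N0) /a; field.
(* Since [symp cX cY = -1], this sign makes the height gained equal to [t * ht w]. *)
pose b := - Num.sg (ht w) * a.
have bL : `|b| <= a.
  by rewrite normrM normrN (ger0_norm a0) ler_piMl // normr_sg; case: (_ != _).
have E : hflow (hver w) t p = hflow cY (- b) (hflow cX (- a) (hflow cY b (hflow cX a p))).
  rewrite hflow_commutator ?ht_hpoint // sXY.
  have -> : 4 * a * b * -1 = t * ht w.
    have -> : 4 * a * b * -1 = Num.sg (ht w) * (4 * a * a) by rewrite /b; ring.
    by rewrite a2 mulrCA -numEsg.
  apply: heis_ext; rewrite ?hx_hflow ?hy_hflow ?ht_hflow ?hxD ?hyD ?htD
    ?hx_hpoint ?hy_hpoint ?ht_hpoint ?scaler0 //.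
  rewrite /symp big1 ?mulr0 ?addr0 // => j _.
  by rewrite hx_hpoint hy_hpoint !mxE mul0r mulr0 subr0.
have X0 : ht cX = 0 by rewrite ht_hpoint.
have Y0 : ht cY = 0 by rewrite ht_hpoint.
have P := hpath_cat (hpath_cat (hpath_cat (seg cX a p X0 dX) (seg cY b _ Y0 dY))
  (seg cX (- a) _ X0 dX)) (seg cY (- b) _ Y0 dY).
rewrite E; apply: hpath_le P _.
rewrite !normrN (ger0_norm a0).
have -> : 2 * Num.sqrt N = a + a + a + a by rewrite /a; field.
lra.
Qed.

(** A point at vertical time [r <= e ^+ 2] is reached by a horizontal leg of length [e |w_H|] and a
    square of perimeter [2 sqrt (r |w_N|) <= 2 e sqrt |w_N|], within the assumed bound. So neither
    flow line meets the boundary. *)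
Lemma cc_stays (Omega A : set H) p w (e : R) : (1 <= n)%N -> open Omega ->
  A `<=` Omega -> A p -> 0 <= e ->
  ((e * (frobenius (hpart w) + 2 * Num.sqrt `|ht w|))%:E
     < set_ccdist A (boundary Omega))%E ->
  (forall t, 0 <= t <= e -> Omega (hflow (hhor w) t p)) /\
  (forall t, 0 <= t <= e ^+ 2 -> Omega (hflow (hver w) t (hflow (hhor w) e p))).
Proof.
move=> n1 oO AO Ap e0 eD.
have f0 : 0 <= frobenius (hpart w) by exact: sqrtr_ge0.
have s0 : 0 <= Num.sqrt `|ht w| by exact: sqrtr_ge0.
have cf c q : continuous (fun t : R => hflow c t q).
  by move=> t; apply: cvgD; [exact: cvg_cst|apply: cvgZ; [exact: cvg_id|exact: cvg_cst]].
have hor t : 0 <= t <= e -> Omega (hflow (hhor w) t p).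
  apply: (@curve_stays _ (fun t => hflow (hhor w) t p)) => //.
    by rewrite hflow0; exact: AO.
  move=> r /andP[r0 re]; apply: hpath_notin_boundary (hpath_hor w p r0) Ap _.
  apply: le_lt_trans eD; rewrite lee_fin.
  by rewrite ler_pM // lerDl mulr_ge0.
split => //.
apply: (@curve_stays _ (fun t => hflow (hver w) t (hflow (hhor w) e p))) => //.
- by rewrite hflow0; apply: hor; rewrite e0 lexx.
- exact: sqr_ge0.
move=> r /andP[r0 re].
apply: hpath_notin_boundary (hpath_cat (hpath_hor w p e0) (hpath_ver w _ n1 r0)) Ap _.
apply: le_lt_trans eD; rewrite lee_fin mulrDr lerD2l mulrCA ler_wpM2l //.
have -> : e * Num.sqrt `|ht w| = Num.sqrt (e ^+ 2 * `|ht w|).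
  by rewrite sqrtrM ?sqr_ge0 // sqrtr_sqr (ger0_norm e0).
by rewrite ler_wsqrtr // ler_wpM2r.
Qed.

End carnot_caratheodory.

(** * Second-order expansion of Sobolev functions *)

Section sobolev_expansion.
Context {R : realType} {n : nat}.
Notation H := (heis R n).
Implicit Types (p q c w a b : H) (u g f h : H -> R) (A B : set H).
Local Opaque derive hderive.

Lemma cvg_ereal0 (T : Type) (F : set_system T) (FF : Filter F) (h : T -> \bar R) :
  (forall x, (0 <= h x)%E) ->
  (forall e : R, 0 < e -> \forall x \near F, (h x <= e%:E)%E) -> h x @[x --> F] --> 0%E.
Proof.
move=> h0 hF; apply/fine_cvgP; split.
  apply: filterS (hF 1 ltr01) => x hx; rewrite ge0_fin_numE //.
  exact: le_lt_trans hx (ltry _).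
apply/cvgrPdist_le => e e0; apply: filterS (hF e e0) => x hx.
rewrite sub0r normrN /= ger0_norm ?fine_ge0 // -lee_fin fineK //.
by rewrite ge0_fin_numE // (le_lt_trans hx) // ltry.
Qed.

Variable s : R.
Hypothesis s1 : 1 <= s.

Let s0 : 0 < s. Proof. exact: lt_le_trans s1. Qed.

Lemma ae_eq_Lsnorm A u g : measurable A -> measurable_fun A u -> measurable_fun A g ->
  {ae leb, forall p, A p -> u p = g p} -> Lsnorm s A u = Lsnorm s A g.
Proof.
move=> mA mu mg ug.
have E : (Lsnorm s A u `^ s = Lsnorm s A g `^ s)%E.
  rewrite !(Lsnorm_pow A _ s0); apply: ae_eq_integral => //.
  - by apply/measurable_EFinP; exact: measurable_normr_powR.
  - by apply/measurable_EFinP; exact: measurable_normr_powR.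
  - by apply: filterS ug => p ug Ap; rewrite ug.
by apply/eqP; rewrite eq_le; apply/andP; split; apply: (@lee_poweR2 _ s) => //;
  rewrite ?E // Lsnorm_ge0.
Qed.

Lemma Lsnorm_comp_image c t A h : measurable A ->
  measurable_fun (hflow c (- t) @^-1` A) h ->
  Lsnorm s A (fun p => h (hflow c t p)) = Lsnorm s (hflow c (- t) @^-1` A) h.
Proof.
move=> mA mh; set B := hflow c (- t) @^-1` A.
have mB : measurable B.
  by rewrite -[X in measurable X]setTI; exact: measurable_hflow.
rewrite (eq_Lsnorm s (g := cut B h \o hflow c t)); last first.
  by move=> p Ap; rewrite /= cutE // /B /= hflowK.
rewrite (Lsnorm_image s1) //; last exact: measurable_cut.
by apply: eq_Lsnorm => p Bp; rewrite cutE.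
Qed.

Lemma in_LsD A u g : measurable A -> in_Ls s A u -> in_Ls s A g ->
  in_Ls s A (fun p => u p + g p).
Proof.
move=> mA [mu us] [mg gs]; split; first exact: measurable_funD.
by apply: le_lt_trans (LsnormD s1 mA mu mg) _; exact: lte_add_pinfty.
Qed.

Lemma in_LsZ A r u : measurable A -> in_Ls s A u -> in_Ls s A (fun p => r * u p).
Proof.
move=> mA [mu us]; split; first exact: measurable_funM.
by rewrite LsnormZ // lte_mul_pinfty.
Qed.

Lemma in_Ls_sum A (I : Type) (r : seq I) (u_ : I -> H -> R) : measurable A ->
  (forall i, in_Ls s A (u_ i)) -> in_Ls s A (fun p => \sum_(i <- r) u_ i p).
Proof.
move=> mA Hu; elim: r => [|i r IH].
  under eq_fun do rewrite big_nil; split; first exact: measurable_cst.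
  by rewrite Lsnorm0.
by under eq_fun do rewrite big_cons; exact: in_LsD.
Qed.

Lemma in_Ls_subset A B u : measurable A -> measurable B -> A `<=` B ->
  in_Ls s B u -> in_Ls s A u.
Proof.
move=> mA mB AB [mu us]; split; first exact: measurable_funS mB AB mu.
exact: le_lt_trans (Lsnorm_subset s1 mA mB mu AB) us.
Qed.

Lemma Lsnorm_div_le A r u (M : \bar R) : measurable A -> measurable_fun A u -> 0 < r ->
  (Lsnorm s A u <= r%:E * M)%E -> (Lsnorm s A (fun p => u p / r)%R <= M)%E.
Proof.
move=> mA mu r0 uM; under [X in Lsnorm s A X]eq_fun do rewrite mulrC.
by rewrite LsnormZ // gtr0_norm ?invr_gt0 // lee_pdivrMl.
Qed.

(** Lagrange's identity: the double sum of the squares [(a i * b j - a j * b i) ^+ 2] is twice the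
    gap. *)
Lemma cauchy_schwarz (I : finType) (a b : I -> R) :
  (\sum_i a i * b i) ^+ 2 <= (\sum_i a i ^+ 2) * (\sum_i b i ^+ 2).
Proof.
have : 0 <= \sum_i \sum_j (a i * b j - a j * b i) ^+ 2.
  by apply: sumr_ge0 => i _; apply: sumr_ge0 => j _; exact: sqr_ge0.
have -> : \sum_i \sum_j (a i * b j - a j * b i) ^+ 2 =
    2 * ((\sum_i a i ^+ 2) * (\sum_i b i ^+ 2) - (\sum_i a i * b i) ^+ 2).
  have E (x y : I -> R) : (\sum_i x i) * (\sum_j y j) = \sum_i \sum_j x i * y j.
    by rewrite mulr_suml; apply: eq_bigr => i _; rewrite mulr_sumr.
  have E' (x y : I -> R) : (\sum_i x i) * (\sum_j y j) = \sum_i \sum_j x j * y i.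
    by rewrite E exchange_big.
  rewrite mulr2n mulrDl mul1r {1}E {1}E' expr2 !E -!sumrB -big_split /=.
  apply: eq_bigr => i _; rewrite -!sumrB -big_split /=; apply: eq_bigr => j _; ring.
by rewrite pmulr_rge0 // subr_ge0.
Qed.

(** The quadratic form is the scalar product, over pairs of indices, of [M] with the tensor square
    of [v], whose norm is [frobenius v ^+ 2]. *)
Lemma frobenius_quadratic k (M : 'M[R]_k) (v : 'rV[R]_k) :
  `|dot (v *m M^T) v| <= frobenius v ^+ 2 * frobenius M.
Proof.
have v0 : 0 <= \sum_j v 0 j ^+ 2 by apply: sumr_ge0 => j _; exact: sqr_ge0.
have F1 : frobenius v ^+ 2 = \sum_j v 0 j ^+ 2.
  by rewrite /frobenius big_ord1 sqr_sqrtr.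
have F2 : frobenius M ^+ 2 = \sum_i \sum_j M i j ^+ 2.
  rewrite /frobenius sqr_sqrtr //.
  by apply: sumr_ge0 => i _; apply: sumr_ge0 => j _; exact: sqr_ge0.
have F0 : 0 <= frobenius M by exact: sqrtr_ge0.
have Fv : 0 <= frobenius v by exact: sqrtr_ge0.
rewrite -(@ler_pXn2r _ 2) ?nnegrE ?mulr_ge0 ?sqr_ge0 // real_normK ?num_real //.
have -> : dot (v *m M^T) v = \sum_(ij : 'I_k * 'I_k) (v 0 ij.1 * v 0 ij.2) * M ij.1 ij.2.
  rewrite -(pair_bigA _ (fun i j => v 0 i * v 0 j * M i j)) /=; apply: eq_bigr => i _.
  by rewrite mxE mulr_suml; apply: eq_bigr => j _; rewrite mxE; ring.
apply: le_trans (cauchy_schwarz _ _) _; rewrite exprMn F1 F2.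
rewrite (pair_bigA _ (fun i j => M i j ^+ 2)) le_eqVlt; apply/orP; left; apply/eqP.
congr (_ * _); rewrite -(pair_bigA _ (fun i j => (v 0 i * v 0 j) ^+ 2)) /= expr2.
rewrite mulr_suml; apply: eq_bigr => i _; rewrite mulr_sumr; apply: eq_bigr => j _.
by rewrite exprMn.
Qed.

Variables (Omega : set H) (f : H -> R).
Hypothesis n_ge1 : (1 <= n)%N.
Hypothesis Omega_open : open Omega.
Hypothesis fW : hsobolev2 s Omega f.
Let mO : measurable Omega. Proof. exact: open_measurable_rV. Qed.

Let dj j : weakly_derivable Omega (hidx j) f /\ in_Ls s Omega (weakZ Omega (hidx j) f).
Proof. by case: fW. Qed.

Let dij i j : weakly_derivable Omega (hidx i) (weakZ Omega (hidx j) f) /\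
  in_Ls s Omega (weakZ Omega (hidx i) (weakZ Omega (hidx j) f)).
Proof. by case: fW. Qed.

Definition grad_along w p := dot (hgrad Omega f p) (hpart w).
Definition hess_along w p := dot (hpart w *m (hhess Omega f p)^T) (hpart w).

(** Any weak derivative carries local integrability of [f] with it, and [n >= 1] ensures that there
    is a horizontal field to differentiate along. *)
Lemma loc_integrable_hsobolev2 : loc_integrable Omega f.
Proof. by have [/weakZP[]] := dj (hX (Ordinal n_ge1)). Qed.

Lemma weak_along_grad w : weak_along Omega (hhor w) f (grad_along w).
Proof.
rewrite (_ : grad_along w = fun p => \sum_j hhor w 0 (hidx j) * weakZ Omega (hidx j) f p).
  apply: (weak_along_hor Omega_open); first by rewrite ht_hpoint.
    exact: loc_integrable_hsobolev2.
  by move=> j; apply: weakZP; have [] := dj j.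
by apply/funext => p; apply: eq_bigr => j _; rewrite hhor_hidx mxE mulrC.
Qed.

Lemma weak_along_hess w : weak_along Omega (hhor w) (grad_along w) (hess_along w).
Proof.
rewrite (_ : grad_along w = fun p => \sum_j hhor w 0 (hidx j) * weakZ Omega (hidx j) f p); last first.
  by apply/funext => p; apply: eq_bigr => j _; rewrite hhor_hidx mxE mulrC.
rewrite (_ : hess_along w = fun p => \sum_j hhor w 0 (hidx j) *
    (\sum_i hhor w 0 (hidx i) * weakZ Omega (hidx i) (weakZ Omega (hidx j) f) p)); last first.
  apply/funext => p; rewrite /hess_along /dot.
  under eq_bigr do rewrite mxE mulr_suml.
  rewrite exchange_big; apply: eq_bigr => j _; rewrite mulr_sumr.
  by apply: eq_bigr => i _; rewrite !hhor_hidx !mxE; ring.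
apply: (weak_along_suml Omega_open) => j; apply: (weak_along_hor Omega_open); first by rewrite ht_hpoint.
  by have [/weakZP[_ ]] := dj j.
by move=> i; apply: weakZP; have [] := dij i j.
Qed.

Lemma in_Ls_grad_along w : in_Ls s Omega (grad_along w).
Proof.
apply: in_Ls_sum => // j; under eq_fun do rewrite mxE mulrC.
by apply: in_LsZ => //; have [] := dj j.
Qed.

Lemma in_Ls_hess_along w : in_Ls s Omega (hess_along w).
Proof.
apply: in_Ls_sum => // i; under eq_fun do rewrite mxE mulrC.
apply: in_LsZ => //; apply: in_Ls_sum => // j; under eq_fun do rewrite !mxE.
by apply: in_LsZ => //; have [] := dij i j.
Qed.

Let j0 : 'I_n := Ordinal n_ge1.

Let gT p : R := 4^-1 *
  (weakZ Omega (hidx (hY j0)) (weakZ Omega (hidx (hX j0)) f) p -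
   weakZ Omega (hidx (hX j0)) (weakZ Omega (hidx (hY j0)) f) p).

Let weak_gT : is_weak_derivative Omega tidx f gT.
Proof.
apply: (is_weak_derivative_T Omega_open (j := j0)); apply: weakZP.
- by have [] := dj (hX j0).
- by have [] := dj (hY j0).
- by have [] := dij (hX j0) (hY j0).
- by have [] := dij (hY j0) (hX j0).
Qed.

Lemma is_weak_derivative_Tderive : is_weak_derivative Omega tidx f (Tderive Omega f).
Proof. by apply: weakZP; exists gT. Qed.

(** [Tderive] is a chosen representative, a priori only locally integrable. By uniqueness it agrees
    almost everywhere with the commutator [gT], which is in [L^s]. *)
Lemma in_Ls_Tderive : in_Ls s Omega (Tderive Omega f).
Proof.
have wT := is_weak_derivative_Tderive; have [_ [mT _] _] := wT; split => //.
have [mg gs] : in_Ls s Omega gT.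
  rewrite /gT; apply: (in_LsZ _ mO); under eq_fun do rewrite -mulN1r.
  have [_ l1] := dij (hY j0) (hX j0); have [_ l2] := dij (hX j0) (hY j0).
  by apply: (in_LsD mO l1); exact: (in_LsZ _ mO l2).
rewrite (ae_eq_Lsnorm mO mT mg) //.
exact: (weak_derivative_unique Omega_open wT weak_gT).
Qed.

Lemma measurable_frobenius_hess :
  measurable_fun Omega (fun p => frobenius (hhess Omega f p)).
Proof.
apply: (@measurableT_comp _ _ _ _ _ _ (@Num.sqrt R)).
  by apply: continuous_measurable_fun; exact: sqrt_continuous.
apply: measurable_sum => i; apply: measurable_sum => j; apply: measurable_funX.
under eq_fun do rewrite mxE.
by have [_ []] := dij i j.
Qed.

Lemma Lsnorm_hess_along_le w :
  (Lsnorm s Omega (hess_along w) <= (frobenius (hpart w) ^+ 2)%:E *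
     Lsnorm s Omega (fun p => frobenius (hhess Omega f p)))%E.
Proof.
have mF := measurable_frobenius_hess; have [mh _] := in_Ls_hess_along w.
rewrite -[X in (X%:E * _)%E]ger0_norm ?sqr_ge0 // -LsnormZ //.
apply: le_Lsnorm => //; first exact: measurable_funM.
move=> p _; rewrite [leRHS]ger0_norm ?mulr_ge0 ?sqr_ge0 ?sqrtr_ge0 //.
exact: frobenius_quadratic.
Qed.

Variable A : set H.
Hypothesis A_open : open A.
Hypothesis A_Omega : A `<=` Omega.
Let mA : measurable A. Proof. exact: open_measurable_rV. Qed.

(** The image of [A] under the horizontal flow at time [e], written as a preimage so that openness
    and measurability are immediate. *)
Definition flowed w (e : R) := hflow (hhor w) (- e) @^-1` A.

Lemma open_flowed w e : open (flowed w e).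
Proof. by apply: open_comp => // p _; exact: continuous_hflow. Qed.

Definition dilation_stays w (e : R) := flow_stays Omega (hhor w) e A /\
  flow_stays Omega (hver w) (e ^+ 2) (flowed w e).

Definition hor_increment w e p : R := f (hflow (hhor w) e p) - f p.
Definition ver_increment w e q : R := f (hflow (hver w) (e ^+ 2) q) - f q.

Lemma increment_split w e p : f (hmul p (hdil e w)) - f p - e * grad_along w p =
  ver_increment w e (hflow (hhor w) e p) + (hor_increment w e p - e * grad_along w p).
Proof. by rewrite hmul_hdil /ver_increment /hor_increment !addrA subrK. Qed.

Let mf : measurable_fun Omega f. Proof. by case: fW => -[mf _] _ _; exact: mf. Qed.

Let flow_end c (e : R) B p : 0 <= e -> flow_stays Omega c e B -> B p -> Omega (hflow c e p).
Proof. by move=> e0 S Bp; apply: S => //; rewrite e0 lexx. Qed.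

Let flow_start c (e : R) B : 0 <= e -> flow_stays Omega c e B -> B `<=` Omega.
Proof. by move=> e0 S p Bp; rewrite -(hflow0 c p); apply: S => //; rewrite lexx. Qed.

Lemma measurable_hor_increment w e : 0 <= e -> dilation_stays w e ->
  measurable_fun A (fun p => hor_increment w e p - e * grad_along w p).
Proof.
move=> e0 [S1 S2]; have [mg _] := in_Ls_grad_along w.
apply: measurable_funB; last by apply: measurable_funM => //; exact: measurable_funS mO A_Omega mg.
apply: measurable_funB; last exact: measurable_funS mO A_Omega mf.
by apply: (measurable_comp_flow (u := f) Omega_open _ mf) => p; exact: flow_end.
Qed.

Lemma measurable_ver_increment w e : dilation_stays w e ->
  measurable_fun (flowed w e) (ver_increment w e).
Proof.
move=> [S1 S2]; have e0 := sqr_ge0 e.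
apply: measurable_funB; last exact: measurable_funS mO (flow_start e0 S2) mf.
by apply: (measurable_comp_flow (u := f) Omega_open _ mf) => p; exact: flow_end.
Qed.

Lemma measurable_ver_increment_flow w e : dilation_stays w e ->
  measurable_fun A (fun p => ver_increment w e (hflow (hhor w) e p)).
Proof.
move=> S; have oB := @open_flowed w e.
apply: (eq_measurable_fun (fun p => cut (flowed w e) (ver_increment w e) (hflow (hhor w) e p))).
  by move=> p /set_mem Ap; rewrite cutE // /flowed /= hflowK.
apply: measurable_funTS; apply: measurableT_comp; last exact: measurable_hflow.
by apply: measurable_cut; [exact: open_measurable_rV|exact: measurable_ver_increment].
Qed.

Lemma measurable_increment w e : 0 < e -> dilation_stays w e ->
  measurable_fun A (fun p => f (hmul p (hdil e w)) - f p - e * grad_along w p).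
Proof.
move=> /ltW e0 S; under eq_fun do rewrite increment_split.
apply: measurable_funD; first exact: measurable_ver_increment_flow.
exact: measurable_hor_increment.
Qed.

Lemma Lsnorm_increment_le w e : 0 < e -> dilation_stays w e ->
  (Lsnorm s A (fun p => ((f (hmul p (hdil e w)) - f p - e * grad_along w p) / e ^+ 2)%R)
    <= `|ht w|%:E * Lsnorm s Omega (Tderive Omega f) + Lsnorm s Omega (hess_along w))%E.
Proof.
move=> e0 S; have [S1 S2] := S; have e20 := exprn_gt0 2 e0.
apply: (Lsnorm_div_le mA _ e20); first exact: measurable_increment.
under [X in Lsnorm s A X]eq_fun do rewrite increment_split.
apply: le_trans (LsnormD s1 mA (measurable_ver_increment_flow S) (measurable_hor_increment (ltW e0) S)) _.
have [mT Ts] := in_Ls_Tderive.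
rewrite ge0_muleDr ?Lsnorm_ge0 ?mule_ge0 ?Lsnorm_ge0 // leeD //.
  (* Invariance moves the norm to [flowed w e], where the vertical part is a plain increment along
     one flow, of duration [e ^+ 2]. *)
  rewrite (Lsnorm_comp_image mA (measurable_ver_increment S)).
  rewrite -LsnormZ //.
  apply: (flow_diff_le s1 Omega_open (@open_flowed w e) (ltW e20)) S2.
  by apply: (weak_along_ver Omega_open); exact: is_weak_derivative_Tderive.
apply: (flow_second_le s1 Omega_open A_open e0 _ _ S1).
  exact: weak_along_grad.
exact: weak_along_hess.
Qed.

Definition taylor_term w p : R := 2^-1 * hess_along w p + ht w * Tderive Omega f p.

Lemma in_Ls_taylor_term w : in_Ls s A (taylor_term w).
Proof.
apply: (in_Ls_subset mA mO A_Omega).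
have l1 := in_LsZ 2^-1 mO (in_Ls_hess_along w).
have l2 := in_LsZ (ht w) mO in_Ls_Tderive.
exact: (in_LsD mO l1 l2).
Qed.

Lemma Lsnorm_increment_cvg w (eps : R) : 0 < eps ->
  exists2 d : R, 0 < d & forall e, 0 < e < d -> dilation_stays w e ->
  (Lsnorm s A (fun p => ((f (hmul p (hdil e w)) - f p - e * grad_along w p) / e ^+ 2
    - taylor_term w p)%R) <= eps%:E)%E.
Proof.
move=> eps0; have e30 : 0 < eps / 3 by rewrite divr_gt0.
have [mT Ts] := in_Ls_Tderive.
have [mG Gs] := in_LsZ (ht w) mO in_Ls_Tderive.
have wT := weak_along_ver Omega_open w is_weak_derivative_Tderive.
have [d1 d10 H1] := flow_first_lim s1 Omega_open wT Gs e30.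
have [d2 d20 H2] := flow_Ls_continuous s1 Omega_open (hhor w) mG Gs e30.
have [_ hs] := in_Ls_hess_along w.
have [d3 d30 H3] := flow_second_lim s1 Omega_open (weak_along_grad w) (weak_along_hess w) hs e30.
(* The vertical flow runs for time [e ^+ 2]; with [e < 1] this is below [e], hence below [d1]. *)
exists (Num.min (Num.min 1 d1) (Num.min d2 d3)); first by rewrite !lt_min ltr01 d10 d20.
move=> e /andP[e0]; rewrite !lt_min => /andP[/andP[e1 ed1] /andP[ed2 ed3]] S.
have [S1 S2] := S; have e20 := exprn_gt0 2 e0.
have mI := measurable_increment e0 S.
have [mt _] := in_Ls_taylor_term w.
(* Three errors, each to be at most [e ^+ 2 * (eps / 3)] in norm after weighting: [D1] is the
   first-order error of the vertical flow at the moved point, [D2] the change of [ht w * T f]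
   between that point and [p], and [D3] the second-order error of the horizontal flow. *)
pose D1 q := ver_increment w e q - e ^+ 2 * (ht w * Tderive Omega f q).
pose D2 p := ht w * Tderive Omega f (hflow (hhor w) e p) - ht w * Tderive Omega f p.
pose D3 p := hor_increment w e p - (e * grad_along w p + e ^+ 2 / 2 * hess_along w p).
have E : (fun p => (f (hmul p (hdil e w)) - f p - e * grad_along w p) / e ^+ 2 - taylor_term w p)
    = (fun p => (D1 (hflow (hhor w) e p) + (e ^+ 2 * D2 p + D3 p)) / e ^+ 2).
  apply/funext => p; rewrite increment_split /D1 /D2 /D3 /taylor_term; field.
  by rewrite gt_eqF.
have BO := flow_start (ltW e20) S2.
have mB : measurable (flowed w e) by apply: open_measurable_rV; exact: open_flowed.
have mD1 : measurable_fun (flowed w e) D1.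
  apply: measurable_funB; first exact: measurable_ver_increment.
  by apply: measurable_funM => //; exact: measurable_funS mO BO mG.
have mD1' : measurable_fun A (fun p => D1 (hflow (hhor w) e p)).
  apply: (eq_measurable_fun (fun p => cut (flowed w e) D1 (hflow (hhor w) e p))).
    by move=> p /set_mem Ap; rewrite cutE // /flowed /= hflowK.
  apply: measurable_funTS; apply: measurableT_comp; last exact: measurable_hflow.
  exact: measurable_cut.
have mD2 : measurable_fun A D2.
  apply: measurable_funB; last exact: measurable_funS mO A_Omega mG.
  apply: (measurable_comp_flow (u := fun p => ht w * Tderive Omega f p) Omega_open _ mG) => p.
  by apply: flow_end S1; exact: ltW.
have mD2' : measurable_fun A (fun p => e ^+ 2 * D2 p) by exact: measurable_funM.
have mD3 : measurable_fun A D3.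
  rewrite /D3; under eq_fun do rewrite opprD addrA.
  apply: measurable_funB; first by apply: measurable_hor_increment => //; exact: ltW.
  by have [mh _] := in_Ls_hess_along w; apply: measurable_funM => //; exact: measurable_funS mO A_Omega mh.
have mD23 : measurable_fun A (fun p => e ^+ 2 * D2 p + D3 p) by exact: measurable_funD.
rewrite E; apply: (Lsnorm_div_le mA _ e20); first exact: measurable_funD.
have -> : eps = eps / 3 + (eps / 3 + eps / 3) by field.
rewrite -EFinM !mulrDr 2!EFinD.
apply: le_trans (LsnormD s1 mA mD1' mD23) _; apply: leeD.
  rewrite (Lsnorm_comp_image mA mD1).
  apply: H1 => //; last exact: open_flowed.
  rewrite e20 /=; apply: le_lt_trans ed1.
  by rewrite expr2 ler_piMl // ltW.
apply: le_trans (LsnormD s1 mA mD2' mD3) _; apply: leeD.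
  rewrite LsnormZ // (ger0_norm (sqr_ge0 e)) (EFinM (e ^+ 2) (eps / 3)); apply: lee_wpmul2l.
    by rewrite lee_fin sqr_ge0.
  apply: H2 => //; first by rewrite gtr0_norm.
  by move=> p; apply: flow_end S1; exact: ltW.
by apply: H3 => //; rewrite e0.
Qed.

End sobolev_expansion.

Theorem theorem3p5 (R : realType) (n : nat) (n_ge1 : (1 <= n)%N)
    (s : R) (s_ge1 : 1 <= s)
    (Omega : set (heis R n)) (Omega_open : open Omega)
    (f : heis R n -> R) (fW : hsobolev2 s Omega f)
    (A : set (heis R n)) (A_open : open A) (A_Omega : A `<=` Omega)
    (A_dist : (0 < set_ccdist A (boundary Omega))%E) :
  (forall w : heis R n,
    cvg_Ls s A
      (fun (e : R) (p : heis R n) =>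
        (f (hmul p (hdil e w)) - f p - e * dot (hgrad Omega f p) (hpart w))
          / e ^+ 2)
      0^'+
      (fun p : heis R n =>
        2^-1 * dot (hpart w *m (hhess Omega f p)^T) (hpart w)
          + ht w * Tderive Omega f p)) /\
  (forall (e : R) (w : heis R n), 0 < e ->
    ((e * (frobenius (hpart w) + 2 * Num.sqrt `|ht w|))%:E
       < set_ccdist A (boundary Omega))%E ->
    (Lsnorm s A
       (fun p : heis R n =>
         ((f (hmul p (hdil e w)) - f p - e * dot (hgrad Omega f p) (hpart w))
           / e ^+ 2)%R)
     <= `|ht w|%:E * Lsnorm s Omega (Tderive Omega f)
        + (frobenius (hpart w) ^+ 2)%:E
          * Lsnorm s Omega (fun p => frobenius (hhess Omega f p)))%E).
Proof.
have mA : measurable A by exact: open_measurable_rV.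
have stays (e : R) w : 0 < e ->
    ((e * (frobenius (hpart w) + 2 * Num.sqrt `|ht w|))%:E
       < set_ccdist A (boundary Omega))%E -> dilation_stays Omega A w e.
  move=> e0 eD; split=> t p te Ap.
    by have [H _] := cc_stays n_ge1 Omega_open A_Omega Ap (ltW e0) eD; exact: H.
  have [_ H] := cc_stays n_ge1 Omega_open A_Omega Ap (ltW e0) eD.
  by have := H _ te; rewrite hflowNK.
split; last first.
  move=> e w e0 /(stays _ _ e0) S.
  apply: le_trans (Lsnorm_increment_le s_ge1 n_ge1 Omega_open fW A_open A_Omega e0 S) _.
  by apply: leeD => //; exact: Lsnorm_hess_along_le.
move=> w.
have near_stays : \forall e \near 0^'+, 0 < e /\ dilation_stays Omega A w e.
  set b := frobenius (hpart w) + 2 * Num.sqrt `|ht w|.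
  have b0 : 0 <= b by rewrite addr_ge0 ?mulr_ge0 ?sqrtr_ge0.
  have [d d0 Hd] : exists2 d : R, 0 < d & forall e, 0 < e < d ->
      ((e * b)%:E < set_ccdist A (boundary Omega))%E.
    (* An infinite distance, as for an empty boundary, puts no restriction on [e]. In the finite
       case [b] may be 0, hence the denominator [b + 1]. *)
    case: (set_ccdist _ _) A_dist => [r| |] //; last first.
      by move=> _; exists 1 => // e _; exact: ltry.
    rewrite lte_fin => r0; exists (r / (b + 1)); first by rewrite divr_gt0 // ltr_wpDl.
    move=> e /andP[e0]; rewrite ltr_pdivlMr ?ltr_wpDl // lte_fin; apply: le_lt_trans.
    by apply: ler_wpM2l; [exact: ltW|rewrite lerDl].
  near=> e; have e0 : 0 < e by near: e; exact: nbhs_right_gt.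
  split => //; apply: stays => //; apply: Hd; rewrite e0 /=.
  by near: e; exact: nbhs_right_lt.
split.
- exact: in_Ls_taylor_term.
- apply: filterS near_stays => e [e0 S]; split.
    apply: measurable_funM => //.
    exact: (measurable_increment s_ge1 Omega_open fW A_open A_Omega e0 S).
  apply: le_lt_trans (Lsnorm_increment_le s_ge1 n_ge1 Omega_open fW A_open A_Omega e0 S) _.
  have [_ Ts] := in_Ls_Tderive s_ge1 n_ge1 Omega_open fW.
  have [_ hs] := in_Ls_hess_along s_ge1 Omega_open fW w.
  by rewrite lte_add_pinfty // lte_mul_pinfty // lee_fin.
- apply: cvg_ereal0 => [e|eps eps0]; first exact: Lsnorm_ge0.
  have [d d0 Hd] := Lsnorm_increment_cvg s_ge1 n_ge1 Omega_open fW A_open A_Omega w eps0.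
  have near_d : \forall e \near 0^'+, e < d by exact: nbhs_right_lt.
  apply: filterS2 near_stays near_d => e [e0 S] ed.
  by apply: Hd => //; rewrite e0.
Unshelve. all: by end_near. Qed.
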